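(* Let $\gamma$ be a subexpression of a word $\underline{w}=(i_1,\dots,i_\ell)$. Then the mutation sequences $M(\gamma)$ and $\overrightarrow{\mu_\gamma}$ satisfy $$\overleftarrow{\mu_{\gamma^+}}\circ M(\gamma)(\mathbf{s}(\underline{w}))=\overrightarrow{\mu_\gamma}(\mathbf{s}(\underline{w})).$$
   Context: Setting. $G$ is a simple complex algebraic group, $B,B^-$ opposite Borels with unipotent radicals $U,U^-$, $T=B\cap B^-$, simple roots indexed by $I$, Cartan matrix $a_{ij}$ with $\alpha_i(\alpha_j^\vee(x))=x^{a_{ij}}$, symmetriser $d_i$ with $(a_{ij}d_j)$ symmetric. A pinning gives $\varphi_i:SL_2\to G$; $B_i(z)=\varphi_i\begin{pmatrix}1&z\\0&1\end{pmatrix}\varphi_i\begin{pmatrix}0&-1\\1&0\end{pmatrix}$. A subexpression of $\underline{w}$ is $\gamma=(\gamma_1,\dots,\gamma_\ell)$ with $\gamma_j\in\{i_j,-i_j\}$; $\gamma^+$ is the word of its positive letters, in order. $\underline{v}[p]$ denotes the prefix of length $p$. Seeds. A seed is $((A_j)_{j\in J},J_{\mathrm{fr}},(\varepsilon_{jk}),(d_j))$: a transcendence basis of a field, frozen indices, a matrix with $(d_j\varepsilon_{jk})$ skew-symmetric (rational entries allowed only between frozen indices). Mutation $\mu_k$ at a non-frozen $k$: $A_kA_k'=\prod_{\varepsilon_{jk}<0}A_j^{-\varepsilon_{jk}}+\prod_{\varepsilon_{jk}>0}A_j^{\varepsilon_{jk}}$; $\varepsilon'_{ij}=-\varepsilon_{ij}$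 if $k\in\{i,j\}$, otherwise $\varepsilon_{ij}+\varepsilon_{ik}\varepsilon_{kj}$ if $\varepsilon_{ik},\varepsilon_{kj}>0$, $\varepsilon_{ij}-\varepsilon_{ik}\varepsilon_{kj}$ if $\varepsilon_{ik},\varepsilon_{kj}<0$, and $\varepsilon_{ij}$ else. The seed $\mathbf{s}(\underline{v})$, $\underline{v}=(h_1,\dots,h_r)$, in the field $\mathbb{C}(z_1,\dots,z_r)$. Index set $J(\underline{v})=\{1,\dots,r\}$; the index $j$ is also denoted $(i,l)$ if $h_j=i$ is the $l$-th occurrence of $i$. Let $s(j)=\min\{k>j:h_k=h_j\}$ ($\infty$ if none), $p(j)=\max\{k<j:h_k=h_j\}$ ($-\infty$ if none); $j$ is frozen iff $s(j)=\infty$; $d_j=d_{h_j}$; $A_j=\Delta_{\omega_{h_j},\omega_{h_j}}(B_{h_1}(z_1)\cdots B_{h_j}(z_j))$ with $\Delta_{\omega_i,\omega_i}$ the principal generalised minor ($\Delta_{\omega_i,\omega_i}(u_-tu_+)=\omega_i(t)$ on $U^-TU$ in $G$ or its simply connected cover); $\varepsilon_{jk}=a_{h_k,h_j}$ if $k<j<s(k)<s(j)$; $-a_{h_k,h_j}$ if $j<k<s(j)<s(k)$; $\frac12a_{h_k,h_j}$ if $k<j<s(k)=s(j)=\infty$; $-\frac12a_{h_k,h_j}$ if $j<k<s(j)=s(k)=\infty$; $1$ if $j=s(k)$; $-1$ if $j=p(k)$; $0$ else. Sequences $\overrightarrow{\mu_{\underline{v}}},\overleftarrow{\mu_{\underline{v}}}$.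 Let $n_i$ be the number of occurrences of $i$ in $\underline{v}$ and let $h_j=i$ be the $a_j$-th occurrence of $i$; put $\widetilde\mu_j=\mu_{(i,n_i-a_j)}\circ\cdots\circ\mu_{(i,1)}$ if $a_j<n_i$ and $\widetilde\mu_j=\mathrm{id}$ if $a_j=n_i$; $\overrightarrow{\mu_{\underline{v}}}=\widetilde\mu_r\circ\cdots\circ\widetilde\mu_1$; $\overleftarrow{\mu_{\underline{v}}}$ is the same list of mutations in reverse order. For a prefix, $J(\underline{v}[p])\subset J(\underline{v})$ via $(i,l)\mapsto(i,l)$. The sequence $\overrightarrow{\mu_\gamma}$. Let $j_1<\dots<j_m$ be the positions with $\gamma_{j_l}<0$; for $0\le l\le m$ let $v_l$ be $\underline{w}$ with positions $j_1,\dots,j_l$ removed and $p_l=j_l-l+1$, so $v_l$ is $v_{l-1}$ with its $p_l$-th letter (equal to $i_{j_l}$) removed, $v_0=\underline{w}$, $v_m=\gamma^+$. Let $\iota_l:J(v_l)\to J(v_{l-1})$ send $(i,k)\mapsto(i,k)$ if $i\neq i_{j_l}$ and $(i_{j_l},k)\mapsto(i_{j_l},k+1)$. Put $\nu_l=\overleftarrow{\mu_{v_{l-1}[p_l-1]}}\circ\overrightarrow{\mu_{v_{l-1}[p_l]}}$ acting at vertices of $J(v_{l-1})$, where the first-applied factor uses $J(v_{l-1}[p_l])\subset J(v_{l-1})$ and the factor $\overleftarrow{\mu_{v_{l-1}[p_l-1]}}$ uses $J(v_{l-1}[p_l-1])\subset J(v_l)\xrightarrow{\iota_l}J(v_{l-1})$.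 Then $\overrightarrow{\mu_\gamma}=\nu_m\circ\cdots\circ\nu_1$, where $\nu_l$ acts at vertices of $J(\underline{w})$ via $\iota_1\circ\cdots\circ\iota_{l-1}$. Likewise $\overleftarrow{\mu_{\gamma^+}}$ acts at vertices of $J(\underline{w})$ via $\iota_1\circ\cdots\circ\iota_m:J(\gamma^+)\to J(\underline{w})$, i.e. $(i,k)\mapsto(i,k+c_i)$ with $c_i$ the number of occurrences of $-i$ in $\gamma$. M\'enard's sequence $M(\gamma)$. Let $n_i$ be the number of occurrences of $i$ in $\underline{w}$, let $i_j=i$ be the $a_j$-th occurrence of $i=i_j$ in $\underline{w}$, and $b_j=|\{k<j:\gamma_k=-i\}|$. Put $\widetilde{\widetilde\mu}_j=\mu_{(i,n_i-(a_j-b_j))}\circ\cdots\circ\mu_{(i,b_j+1)}$ (rightmost applied first, second index increasing by one) if $a_j<n_i$ and $\gamma_j=i$, and $\widetilde{\widetilde\mu}_j=\mathrm{id}$ if $\gamma_j=-i$ or $a_j=n_i$. Then $M(\gamma)=\widetilde{\widetilde\mu}_\ell\circ\cdots\circ\widetilde{\widetilde\mu}_1$. *)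

(* Defs.v *)
From HB Require Import structures.
From mathcomp Require Import all_boot all_order all_algebra.
From mathcomp Require Import reals complex mpoly.

Set Implicit Arguments.
Unset Strict Implicit.
Unset Printing Implicit Defensive.

Import GRing.Theory.
Local Open Scope ring_scope.

(** * Linear algebraic groups

    Subsets of ['M[F]_N] are [Prop]-valued predicates.  The definitions are
    meant over an algebraically closed field of characteristic 0. *)

Section LinearAlgebraicGroups.

Variable F : fieldType.
Implicit Types N M : nat.

Definition eval_mx N (p : {mpoly F[N * N]}) (g : 'M[F]_N) : F :=
  p.@[fun k => mxvec g ord0 k].

Definition sub_mx N (A A' : 'M[F]_N -> Prop) : Prop := forall g, A g -> A' g.

Definition closed_in N (A Z : 'M[F]_N -> Prop) : Prop :=
  exists S : {mpoly F[N * N]} -> Prop,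
    forall g, Z g <-> A g /\ (forall p, S p -> eval_mx p g = 0).

Definition dense_in N (A Z : 'M[F]_N -> Prop) : Prop :=
  sub_mx Z A /\
  forall p : {mpoly F[N * N]},
    (forall g, Z g -> eval_mx p g = 0) -> forall g, A g -> eval_mx p g = 0.

Definition algebraic_group N (G : 'M[F]_N -> Prop) : Prop :=
  [/\ closed_in (fun g => g \in unitmx) G,
      G 1%:M,
      forall g h, G g -> G h -> G (g *m h)
    & forall g, G g -> G (invmx g)].

Definition connected_group N (G : 'M[F]_N -> Prop) : Prop :=
  forall Z : 'M[F]_N -> Prop,
    closed_in G Z -> closed_in G (fun g => G g /\ ~ Z g) ->
    sub_mx G Z \/ (forall g, ~ Z g).

Definition normal_in N (G H : 'M[F]_N -> Prop) : Prop :=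
  forall g h, G g -> H h -> H (g *m h *m invmx g).

Definition simple_group N (G : 'M[F]_N -> Prop) : Prop :=
  [/\ algebraic_group G,
      connected_group G,
      ~ (forall g h, G g -> G h -> g *m h = h *m g)
    & forall H : 'M[F]_N -> Prop,
        algebraic_group H -> connected_group H -> sub_mx H G ->
        normal_in G H -> (forall g, H g -> g = 1%:M) \/ sub_mx G H].

(* Inverses need not be added: the inverse of a commutator is a commutator. *)
Inductive derived_group N (G : 'M[F]_N -> Prop) : 'M[F]_N -> Prop :=
| derived_one : derived_group G 1%:M
| derived_mul g h k : G g -> G h -> derived_group G k ->
    derived_group G (g *m h *m invmx g *m invmx h *m k).

Definition solvable_group N (G : 'M[F]_N -> Prop) : Prop :=
  exists n, forall g, iter n (@derived_group N) G g -> g = 1%:M.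

Definition borel N (G B : 'M[F]_N -> Prop) : Prop :=
  [/\ algebraic_group B, connected_group B, solvable_group B, sub_mx B G
    & forall H : 'M[F]_N -> Prop,
        algebraic_group H -> connected_group H -> solvable_group H ->
        sub_mx H G -> sub_mx B H -> sub_mx H B].

Definition unipotent N (H : 'M[F]_N -> Prop) : Prop :=
  forall g, H g -> (g - 1%:M) ^+ N = 0.

Definition unipotent_radical N (B U : 'M[F]_N -> Prop) : Prop :=
  [/\ algebraic_group U /\ connected_group U, unipotent U, sub_mx U B,
      normal_in B U
    & forall V : 'M[F]_N -> Prop,
        algebraic_group V -> connected_group V -> unipotent V ->
        sub_mx V B -> normal_in B V -> sub_mx V U].

Definition torus N (T : 'M[F]_N -> Prop) : Prop :=
  [/\ algebraic_group T, connected_group T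
    & exists2 P : 'M[F]_N, P \in unitmx
      & forall t, T t -> is_diag_mx (P *m t *m invmx P)].

Definition maximal_torus N (G T : 'M[F]_N -> Prop) : Prop :=
  [/\ torus T, sub_mx T G
    & forall T' : 'M[F]_N -> Prop,
        torus T' -> sub_mx T' G -> sub_mx T T' -> sub_mx T' T].

Definition regular_on N (G : 'M[F]_N -> Prop) (f : 'M[F]_N -> F) : Prop :=
  exists (p : {mpoly F[N * N]}) (n : nat),
    forall g, G g -> f g = eval_mx p g / \det g ^+ n.

Definition group_morphism N M (G : 'M[F]_N -> Prop) (H : 'M[F]_M -> Prop)
    (f : 'M[F]_N -> 'M[F]_M) : Prop :=
  [/\ forall g, G g -> H (f g),
      forall g h, G g -> G h -> f (g *m h) = f g *m f h
    & forall i j, regular_on G (fun g => f g i j)].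

Definition group_character N (T : 'M[F]_N -> Prop) (chi : 'M[F]_N -> F) : Prop :=
  [/\ regular_on T chi, chi 1%:M = 1
    & forall s t, T s -> T t -> chi (s *m t) = chi s * chi t].

Definition isogeny N M (G : 'M[F]_N -> Prop) (H : 'M[F]_M -> Prop)
    (f : 'M[F]_N -> 'M[F]_M) : Prop :=
  [/\ group_morphism G H f,
      forall h, H h -> exists2 g, G g & f g = h
    & exists s : seq 'M[F]_N, forall g, G g -> f g = 1%:M -> g \in s].

Definition simply_connected N (G : 'M[F]_N -> Prop) : Prop :=
  forall M (H : 'M[F]_M -> Prop) (f : 'M[F]_M -> 'M[F]_N),
    algebraic_group H -> connected_group H -> isogeny H G f ->
    forall h, H h -> f h = 1%:M -> h = 1%:M.

(* Tangent space at the identity. *)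
Definition lie_algebra N (G : 'M[F]_N -> Prop) (X : 'M[F]_N) : Prop :=
  forall p : {mpoly F[N * N]}, (forall g, G g -> eval_mx p g = 0) ->
    \sum_(k < N * N) eval_mx p^`M(k) 1%:M * mxvec X ord0 k = 0.

(* Nontrivial weights of T on Lie(H): roots for H = G, positive roots for
   H a Borel subgroup containing T. *)
Definition root_in N (H T : 'M[F]_N -> Prop) (alpha : 'M[F]_N -> F) : Prop :=
  [/\ group_character T alpha,
      exists2 t, T t & alpha t != 1
    & exists X : 'M[F]_N, [/\ lie_algebra H X, X != 0
      & forall t, T t -> t *m X *m invmx t = alpha t *: X]].

Definition simple_root N (B T : 'M[F]_N -> Prop) (alpha : 'M[F]_N -> F) : Prop :=
  root_in B T alpha /\
  forall beta gamma : 'M[F]_N -> F, root_in B T beta -> root_in B T gamma ->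
    ~ (forall t, T t -> alpha t = beta t * gamma t).

Definition mx22 (a b c d : F) : 'M[F]_2 :=
  \matrix_(i < 2, j < 2)
    if i == ord0 then (if j == ord0 then a else b)
    else (if j == ord0 then c else d).

Definition SL2 (g : 'M[F]_2) : Prop := \det g = 1.

(** A simple group with opposite Borel subgroups, the maximal torus
    T = B ∩ B^-, the simple roots and a pinning. *)
Record pinned_group (I : finType) := PinnedGroup {
  pg_dim : nat;
  pg_G : 'M[F]_pg_dim -> Prop;
  pg_B : 'M[F]_pg_dim -> Prop;
  pg_Bm : 'M[F]_pg_dim -> Prop;
  pg_U : 'M[F]_pg_dim -> Prop;
  pg_Um : 'M[F]_pg_dim -> Prop;
  pg_alpha : I -> 'M[F]_pg_dim -> F;
  pg_phi : I -> 'M[F]_2 -> 'M[F]_pg_dim;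
  pg_T := fun t => pg_B t /\ pg_Bm t;
  pg_simple : simple_group pg_G;
  pg_borel : borel pg_G pg_B;
  pg_borelm : borel pg_G pg_Bm;
  pg_opposite : maximal_torus pg_G pg_T;
  pg_radical : unipotent_radical pg_B pg_U;
  pg_radicalm : unipotent_radical pg_Bm pg_Um;
  pg_alpha_simple : forall i, simple_root pg_B pg_T (pg_alpha i);
  pg_alpha_inj : forall i j,
    (forall t, pg_T t -> pg_alpha i t = pg_alpha j t) -> i = j;
  pg_alpha_all : forall beta, simple_root pg_B pg_T beta ->
    exists i, forall t, pg_T t -> beta t = pg_alpha i t;
  pg_phi_morph : forall i, group_morphism SL2 pg_G (pg_phi i);
  pg_phi_diag : forall i (x : F), x != 0 -> pg_T (pg_phi i (mx22 x 0 0 x^-1));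
  pg_phi_upper : forall i z, pg_U (pg_phi i (mx22 1 z 0 1));
  pg_phi_lower : forall i z, pg_Um (pg_phi i (mx22 1 0 z 1));
  pg_phi_upper_inj : forall i, injective (fun z => pg_phi i (mx22 1 z 0 1));
  pg_phi_lower_inj : forall i, injective (fun z => pg_phi i (mx22 1 0 z 1));
  pg_phi_upperJ : forall i t z, pg_T t ->
    t *m pg_phi i (mx22 1 z 0 1) *m invmx t
      = pg_phi i (mx22 1 (pg_alpha i t * z) 0 1);
  pg_phi_lowerJ : forall i t z, pg_T t ->
    t *m pg_phi i (mx22 1 0 z 1) *m invmx t
      = pg_phi i (mx22 1 0 ((pg_alpha i t)^-1 * z) 1)
}.

Arguments pg_dim {I} p.
Arguments pg_G {I} p.
Arguments pg_B {I} p.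
Arguments pg_Bm {I} p.
Arguments pg_U {I} p.
Arguments pg_Um {I} p.
Arguments pg_T {I} p.
Arguments pg_alpha {I} p.
Arguments pg_phi {I} p.

Section Pinned.

Variable I : finType.
Implicit Types D E : pinned_group I.

Definition coroot D (i : I) (x : F) : 'M[F]_(pg_dim D) :=
  pg_phi D i (mx22 x 0 0 x^-1).

Definition cartan_matrix D (a : I -> I -> int) : Prop :=
  forall i j (x : F), x != 0 -> pg_alpha D i (coroot D j x) = x ^ a i j.

(* E is the simply connected cover of D, with the lifted pinning. *)
Definition simply_connected_cover E D
    (pi : 'M[F]_(pg_dim E) -> 'M[F]_(pg_dim D)) : Prop :=
  [/\ simply_connected (pg_G E),
      isogeny (pg_G E) (pg_G D) pi,
      forall g, pg_G E g ->
        (pg_B E g <-> pg_B D (pi g)) /\ (pg_Bm E g <-> pg_Bm D (pi g)),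
      forall i t, pg_T E t -> pg_alpha E i t = pg_alpha D i (pi t)
    & forall i g, SL2 g -> pi (pg_phi E i g) = pg_phi D i g].

Definition fundamental_weights D (omega : I -> 'M[F]_(pg_dim D) -> F) : Prop :=
  forall i, group_character (pg_T D) (omega i) /\
    forall j (x : F), x != 0 -> omega i (coroot D j x) = if j == i then x else 1.

(* Density of U^- T U in G holds for every D; it is recorded because it is
   what makes [Delta i] determined by its values there. *)
Definition principal_minors D (omega Delta : I -> 'M[F]_(pg_dim D) -> F) : Prop :=
  dense_in (pg_G D)
    (fun g => exists um t u, [/\ pg_Um D um, pg_T D t, pg_U D u & g = um *m t *m u]) /\
  forall i, regular_on (pg_G D) (Delta i) /\
    forall um t u, pg_Um D um -> pg_T D t -> pg_U D u ->
      Delta i (um *m t *m u) = omega i t.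

Definition braid_mx D (i : I) (z : F) : 'M[F]_(pg_dim D) :=
  pg_phi D i (mx22 1 z 0 1) *m pg_phi D i (mx22 0 (-1) 1 0).

End Pinned.

End LinearAlgebraicGroups.

Arguments pg_dim {F I} p.
Arguments pg_G {F I} p.
Arguments pg_B {F I} p.
Arguments pg_Bm {F I} p.
Arguments pg_U {F I} p.
Arguments pg_Um {F I} p.
Arguments pg_T {F I} p.
Arguments pg_alpha {F I} p.
Arguments pg_phi {F I} p.
Arguments coroot {F I} D.
Arguments cartan_matrix {F I} D.
Arguments simply_connected_cover {F I} E D.
Arguments fundamental_weights {F I} D.
Arguments principal_minors {F I} D.
Arguments braid_mx {F I} D.

(** * Seeds

    [seed K r] carries the data of a seed with index set ['I_r] in the field K;
    that a cluster is a transcendence basis is not part of the record. *)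

Record seed (K : fieldType) (r : nat) := Seed {
  cluster : {ffun 'I_r -> K};
  frozen : {set 'I_r};
  exch : 'M[rat]_r;
  symd : {ffun 'I_r -> rat}
}.

Section Mutation.

Variables (K : fieldType) (r : nat).

Definition mutate_exch (k : 'I_r) (e : 'M[rat]_r) : 'M[rat]_r :=
  \matrix_(i < r, j < r)
    if (k == i) || (k == j) then - e i j
    else if (0 < e i k) && (0 < e k j) then e i j + e i k * e k j
    else if (e i k < 0) && (e k j < 0) then e i j - e i k * e k j
    else e i j.

(* Meant for non-frozen k: then every [exch s j k] is an integer, so the
   numerators below are the exponents - ε_jk and ε_jk themselves. *)
Definition mutate (k : 'I_r) (s : seed K r) : seed K r :=
  Seed
    [ffun j => if j == k then
        (\prod_(j' | exch s j' k < 0) cluster s j' ^ numq (- exch s j' k)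
         + \prod_(j' | 0 < exch s j' k) cluster s j' ^ numq (exch s j' k))
        / cluster s k
      else cluster s j]
    (frozen s)
    (mutate_exch k (exch s))
    (symd s).

End Mutation.

(** * Words

    Positions in a word are 0-based ordinals; occurrence numbers are 1-based,
    so the vertex (i, l) is the l-th occurrence of i, with 1 <= l <= n_i. *)

Section Words.

Variable I : finType.
Implicit Types (v w : seq I) (x : I * nat).

Definition letter v (j : 'I_(size v)) : I := tnth (in_tuple v) j.

(* a_j *)
Definition occ v (j : 'I_(size v)) : nat := count_mem (letter j) (take j.+1 v).

Definition vertex v (j : 'I_(size v)) : I * nat := (letter j, occ j).

(* s(j), with [size v] standing for ∞. *)
Definition next_pos v (j : 'I_(size v)) : nat :=
  \big[minn/size v]_(k < size v | (j < k)%N && (letter k == letter j)) k.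

(* p(j) + 1, with 0 standing for -∞. *)
Definition prev_pos1 v (j : 'I_(size v)) : nat :=
  \max_(k < size v | (k < j)%N && (letter k == letter j)) k.+1.

Definition word_exch (a : I -> I -> int) v : 'M[rat]_(size v) :=
  \matrix_(j < size v, k < size v)
    let c : rat := (a (letter k) (letter j))%:~R in
    if [&& k < j, j < next_pos k & next_pos k < next_pos j]%N then c
    else if [&& j < k, k < next_pos j & next_pos j < next_pos k]%N then - c
    else if [&& k < j, next_pos k == size v & next_pos j == size v]%N then c / 2
    else if [&& j < k, next_pos k == size v & next_pos j == size v]%N then - c / 2
    else if nat_of_ord j == next_pos k then 1
    else if j.+1 == prev_pos1 k then -1
    else 0.

(* The polynomials A_j, as coordinate functions of z. *)
Definition word_minors (F : fieldType) (D : pinned_group F I)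
    (Delta : I -> 'M[F]_(pg_dim D) -> F) w
    (A : 'I_(size w) -> {mpoly F[size w]}) : Prop :=
  forall (j : 'I_(size w)) (z : 'I_(size w) -> F),
    (A j).@[z] = Delta (letter j)
      (\big[mulmx/1%:M]_(k < size w | (k <= j)%N) braid_mx D (letter k) (z k)).

Definition word_seed (F : fieldType) (a : I -> I -> int) (d : I -> rat) w
    (A : 'I_(size w) -> {mpoly F[size w]}) :
    seed {fraction {mpoly F[size w]}} (size w) :=
  Seed [ffun j => tofrac (A j)]
       [set j | next_pos j == size w]
       (word_exch a w)
       [ffun j => d (letter j)].

(** ** Mutation sequences

    A mutation sequence is a list of vertices (i, l), the first one being
    mutated first, so that [L1 ++ L2] stands for L2 ∘ L1. *)

Definition mutate_vertex (K : fieldType) w (s : seed K (size w)) x :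
    seed K (size w) :=
  if [pick j : 'I_(size w) | vertex j == x] is Some j then mutate j s else s.

Definition mutate_seq (K : fieldType) w (L : seq (I * nat))
    (s : seed K (size w)) : seed K (size w) :=
  foldl (@mutate_vertex K w) s L.

Definition mu_fwd v : seq (I * nat) :=
  flatten [seq [seq (letter j, l)
                 | l <- index_iota 1 (count_mem (letter j) v - occ j).+1]
            | j <- enum 'I_(size v)].

Definition mu_bwd v : seq (I * nat) := rev (mu_fwd v).

End Words.

Arguments word_minors {I F} D Delta w A.

(** * Subexpressions

    A subexpression γ of w is encoded by its signs: [gamma j] means γ_j = i_j,
    and [~~ gamma j] means γ_j = - i_j. *)

Section Subexpressions.

Variables (I : finType) (w : seq I) (gamma : {ffun 'I_(size w) -> bool}).

(* γ^+ *)
Definition pos_word : seq I := [seq letter j | j <- enum 'I_(size w) & gamma j].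

(* j_1 < ... < j_m *)
Definition neg_pos : seq 'I_(size w) := [seq j <- enum 'I_(size w) | ~~ gamma j].

(* v_l *)
Definition partial_word (l : nat) : seq I :=
  [seq letter j | j <- enum 'I_(size w) & j \notin take l neg_pos].

(* The map ι removing an occurrence of i, on vertices. *)
Definition iota_map (i : I) (x : I * nat) : I * nat :=
  if x.1 == i then (x.1, x.2.+1) else x.

(* ι_1 ∘ ... ∘ ι_l *)
Definition iota_comp (l : nat) : I * nat -> I * nat :=
  foldr (fun j f => iota_map (letter j) \o f) id (take l neg_pos).

(* ν_(l+1), on vertices of J(v_l): for the 0-based l and position j below,
   p_(l+1) = j - l + 1. *)
Definition nu_seq (l : 'I_(size neg_pos)) : seq (I * nat) :=
  let j := tnth (in_tuple neg_pos) l in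
  let p := (j - l).+1%N in
  mu_fwd (take p (partial_word l)) ++
  map (iota_map (letter j)) (mu_bwd (take p.-1 (partial_word l))).

Definition mu_gamma : seq (I * nat) :=
  flatten [seq map (iota_comp l) (nu_seq l)
            | l : 'I_(size neg_pos) <- enum 'I_(size neg_pos)].

Definition mu_bwd_pos : seq (I * nat) :=
  map (iota_comp (size neg_pos)) (mu_bwd pos_word).

(* b_j *)
Definition neg_before (j : 'I_(size w)) : nat :=
  #|[set k : 'I_(size w) | [&& (k < j)%N, letter k == letter j & ~~ gamma k]]|.

Definition menard_seq : seq (I * nat) :=
  flatten
    [seq if gamma j && (occ j < count_mem (letter j) w)%N then
           [seq (letter j, l)
             | l <- index_iota (neg_before j).+1
                      (count_mem (letter j) w - (occ j - neg_before j)).+1]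
         else [::]
      | j <- enum 'I_(size w)].

End Subexpressions.

(* Main.v *)
(** A double word is a word V in signed letters (i, ±).  It determines an
    exchange matrix: the vertex (i, l) is the interval of V between the l-th and
    the next occurrence of i, and the entry at two vertices is a signed count of
    the crossings of their intervals, weighted by the Cartan integer.  The seed
    s(w) has the matrix of w with all signs +.  Exchanging two adjacent letters
    of opposite signs changes the matrix by the mutation at the vertex (i, l)
    that ends and begins there if both letters are i, and not at all otherwise;
    flipping the sign of the first letter changes nothing.  So every factor of
    the sequences in question moves letters through a double word: the factors
    of M(γ) move a positive letter, flipped to a negative one at the left end,
    through the letters on its right, and those of μ_γ do this within a prefix
    and then undo it for the prefix without its last letter.  Moves on disjoint
    parts of a double word are mutations at vertices joined by no arrow, hence
    they commute, and the theorem follows by induction on γ, reading one letter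
    at a time.

    The effect of exchanging two letters i of opposite signs is a mutation only
    because a_ij <= 0 for i <> j.  To see this, let P be the numerator of the
    minor of ω_i and E the bracket of root vectors e_i and f_j for α_i and -α_j.
    If E does not act on P by 0, then α_i / α_j is a root of B, contradicting
    that α_i is simple.  If it does, e_i P is invariant under the lower unipotent
    subgroup attached to j, and a_ij > 0 would give it a pole.

    That mutations are involutive and commute needs nonvanishing cluster
    variables.  There is a point z with all A_j(z) = 1, since the minor of ω_k is
    unchanged by the letters i <> k and, if it is 1 before a letter k, is a
    nonconstant polynomial in the parameter of that letter; and positivity at z
    is preserved by mutation. *)

Require Import Defs.
From mathcomp Require Import all_boot all_order all_algebra.
From mathcomp Require Import reals complex mpoly.
From HB Require Import structures.
From mathcomp Require Import ring lra zify boolp.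

Set Implicit Arguments.
Unset Strict Implicit.
Unset Printing Implicit Defensive.

Import Order.TTheory GRing.Theory Num.Theory.
Local Open Scope ring_scope.

(** * Invariant derivations on the coordinate ring of matrices *)

Lemma mpoly_ring_ind (R : nzRingType) n (P : {mpoly R[n]} -> Prop) :
  (forall c, P c%:MP) -> (forall i, P 'X_i) ->
  (forall p q, P p -> P q -> P (p + q)) ->
  (forall p q, P p -> P q -> P (p * q)) -> forall p, P p.
Proof.
move=> PC PX PD PM; elim/mpolyind => [|c m p _ _ Pp]; first exact: PC.
apply: (PD) => //; rewrite -mul_mpolyC; apply: (PM) => //.
rewrite mpolyXE_id; elim/big_ind: _ => [|p1 p2|i _]; [exact: PC | exact: PM | ].
by elim: (m i) => [|k IH]; rewrite ?expr0 ?exprS; [exact: PC | exact: PM].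
Qed.

(* Sealed copy of [eval_mx]: unification must not unfold it. *)
HB.lock Definition ev (F : fieldType) N (p : {mpoly F[N * N]}) (g : 'M[F]_N) : F :=
  eval_mx p g.

Definition genmx_ (F : fieldType) N : 'M[{mpoly F[N * N]}]_N :=
  \matrix_(i, j) 'X_(mxvec_index i j).

(* The derivation p |-> (g |-> d/dt p((1 + t x) g) at t = 0). *)
HB.lock Definition lam (F : fieldType) N (x : 'M[F]_N) (p : {mpoly F[N * N]}) :
    {mpoly F[N * N]} :=
  \sum_k p^`M(k) * mxvec (map_mx (@mpolyC _ F) x *m genmx_ F N) ord0 k.

Section Calculus.

Variables (F : fieldType) (N : nat).
Notation A := {mpoly F[N * N]}.
Notation genmx_ := (genmx_ F N).
Implicit Types (p q : A) (g h x y : 'M[F]_N).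

(** The target [S] stays general so that one set of rules covers translates (polynomials on
    matrices), restrictions to a curve ([{poly F}]) and evaluation ([F]). *)
Definition msub (S : comNzRingType) (f : {rmorphism F -> S}) (p : A)
  (B : 'M[S]_N) : S := mmap f (fun k => mxvec B ord0 k) p.

Lemma msubC S f c B : @msub S f c%:MP B = f c.
Proof. exact: mmapC. Qed.

Lemma msubX S f i j B : @msub S f 'X_(mxvec_index i j) B = B i j.
Proof. by rewrite /msub mmapX mmap1U mxvecE. Qed.

Lemma msubXk S f k B : @msub S f 'X_k B = mxvec B ord0 k.
Proof. by rewrite /msub mmapX mmap1U. Qed.

Lemma msubD S f p q B : @msub S f (p + q) B = msub f p B + msub f q B.
Proof. exact: mmapD. Qed.

Lemma msubM S f p q B : @msub S f (p * q) B = msub f p B * msub f q B.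
Proof. exact: (rmorphM (mmap f (fun k => mxvec B ord0 k))). Qed.

Lemma msub_sum S f (J : Type) (r : seq J) (P : pred J) (G : J -> A) B :
  @msub S f (\sum_(i <- r | P i) G i) B = \sum_(i <- r | P i) msub f (G i) B.
Proof.
apply: (big_morph (fun p => msub f p B)) => [p q|]; first exact: msubD.
by rewrite -mpolyC0 msubC rmorph0.
Qed.

Lemma msub_morph (S S' : comNzRingType) (f : {rmorphism F -> S})
    (f' : {rmorphism F -> S'}) (g : {rmorphism S -> S'}) p B :
  (forall c, g (f c) = f' c) -> g (msub f p B) = msub f' p (map_mx g B).
Proof.
move=> gf; elim/mpoly_ring_ind: p => [c|k|p q IHp IHq|p q IHp IHq].
- by rewrite !msubC.
- by case/mxvec_indexP: k => i j; rewrite !msubX mxE.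
- by rewrite !msubD rmorphD IHp IHq.
- by rewrite !msubM rmorphM IHp IHq.
Qed.

(** Chain rule: both sides are derivations along the substitution, kill the constants and agree on
    the generators. *)
Lemma msub_deriv (S : comNzRingType) (f : {rmorphism F -> S}) (D : S -> S) p B :
  {morph D : a b / a + b} -> (forall a b, D (a * b) = D a * b + a * D b) ->
  (forall c, D (f c) = 0) ->
  D (msub f p B) =
  \sum_k msub f p^`M(k) B * D (mxvec B ord0 k).
Proof.
move=> DD DM DC; elim/mpoly_ring_ind: p => [c|k|p q IHp IHq|p q IHp IHq].
- rewrite msubC DC big1 // => k _.
  by rewrite mderivC -mpolyC0 msubC rmorph0 mul0r.
- rewrite (bigD1 k) //= big1 ?addr0 => [|l lk].
    rewrite mderivX mnm1E eqxx scale1r.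
    have -> : (U_(k) - U_(k))%MM = 0%MM :> 'X_{1..N * N}.
      by apply/mnmP=> l; rewrite mnmBE mnm0E subnn.
    by rewrite mpolyX0 -mpolyC1 msubC rmorph1 mul1r msubXk.
  by rewrite mderivX mnm1E eq_sym (negPf lk) scale0r -mpolyC0 msubC rmorph0 mul0r.
- rewrite msubD DD IHp IHq -big_split; apply: eq_bigr => k _ /=.
  by rewrite mderivD msubD mulrDl.
- rewrite msubM DM IHp IHq mulr_suml mulr_sumr -big_split.
  apply: eq_bigr => k _ /=; rewrite mderivM msubD !msubM; ring.
Qed.

Lemma evE p g : ev p g = eval_mx p g.
Proof. by rewrite ev.unlock. Qed.

Lemma lamE x p :
  lam x p = \sum_k p^`M(k) * mxvec (map_mx (@mpolyC _ F) x *m genmx_) ord0 k.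
Proof. by rewrite lam.unlock. Qed.

Lemma lamD x : {morph lam x : p q / p + q}.
Proof.
by move=> p q; rewrite !lamE -big_split; apply: eq_bigr => k _ /=; rewrite mderivD mulrDl.
Qed.

Lemma lamZ x c p : lam x (c *: p) = c *: lam x p.
Proof.
by rewrite !lamE scaler_sumr; apply: eq_bigr => k _; rewrite mderivZ scalerAl.
Qed.

Lemma lamM x p q : lam x (p * q) = lam x p * q + p * lam x q.
Proof.
rewrite !lamE mulr_suml mulr_sumr -big_split; apply: eq_bigr => k _ /=.
by rewrite mderivM mulrDl mulrAC mulrA.
Qed.

Lemma lamC x c : lam x c%:MP = 0.
Proof. by rewrite !lamE big1 // => k _; rewrite mderivC mul0r. Qed.

Lemma lam0 x : lam x 0 = 0.
Proof. by rewrite -mpolyC0 lamC. Qed.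

Lemma lamN x p : lam x (- p) = - lam x p.
Proof. by rewrite -scaleN1r lamZ scaleN1r. Qed.

Lemma lamB x p q : lam x (p - q) = lam x p - lam x q.
Proof. by rewrite lamD lamN. Qed.

Lemma lam_sum x (J : Type) (r : seq J) P (G : J -> A) :
  lam x (\sum_(i <- r | P i) G i) = \sum_(i <- r | P i) lam x (G i).
Proof. exact: (big_morph _ (lamD x) (lam0 x)). Qed.

Lemma lam_linear c x y p : lam (c *: x + y) p = c *: lam x p + lam y p.
Proof.
rewrite !lamE scaler_sumr -big_split; apply: eq_bigr => k _ /=.
rewrite map_mxD map_mxZ mulmxDl -scalemxAl linearD linearZ /= !mxE.
by rewrite mulrDr mul_mpolyC scalerAr.
Qed.

Lemma lam0l p : lam 0 p = 0.
Proof. by have := lam_linear (-1) 0 0 p; rewrite scaler0 addr0 scaleN1r addNr. Qed.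

Lemma lam_suml (J : Type) (r : seq J) (c : J -> F) (x : J -> 'M[F]_N) p :
  lam (\sum_(i <- r) c i *: x i) p = \sum_(i <- r) c i *: lam (x i) p.
Proof.
elim: r => [|a r IH]; first by rewrite !big_nil lam0l.
by rewrite !big_cons lam_linear IH.
Qed.

Lemma evD (p q : A) (g : 'M[F]_N) : ev (p + q) g = ev p g + ev q g :> F.
Proof. rewrite !evE; exact: mevalD. Qed.
Lemma evB (p q : A) (g : 'M[F]_N) : ev (p - q) g = ev p g - ev q g :> F.
Proof. rewrite !evE; exact: mevalB. Qed.
Lemma evM (p q : A) (g : 'M[F]_N) : ev (p * q) g = ev p g * ev q g :> F.
Proof. rewrite !evE; exact: mevalM. Qed.
Lemma evX (p : A) k (g : 'M[F]_N) : ev (p ^+ k) g = ev p g ^+ k :> F.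
Proof. rewrite !evE; exact: (rmorphXn (meval (fun i => mxvec g ord0 i))). Qed.
Lemma evZ c (p : A) (g : 'M[F]_N) : ev (c *: p) g = c * ev p g :> F.
Proof. rewrite !evE; exact: mevalZ. Qed.
Lemma evC c (g : 'M[F]_N) : ev c%:MP g = c :> F.
Proof. rewrite !evE; exact: mevalC. Qed.
Lemma ev_sum (J : Type) (r : seq J) P (G : J -> A) (g : 'M[F]_N) :
  ev (\sum_(i <- r | P i) G i) g = \sum_(i <- r | P i) ev (G i) g.
Proof.
apply: (big_morph (fun p => ev p g)) => [p q|]; first exact: evD.
by rewrite -mpolyC0 evC.
Qed.

Lemma eval_genmx x (g : 'M[F]_N) k :
  ev (mxvec (map_mx (@mpolyC _ F) x *m genmx_) ord0 k) g = mxvec (x *m g) ord0 k.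
Proof.
case/mxvec_indexP: k => i j; rewrite !mxvecE !mxE ev_sum; apply: eq_bigr => l _.
by rewrite !mxE evM evC evE /eval_mx mevalXU mxvecE.
Qed.

Lemma eval_lam x p g :
  ev (lam x p) g = \sum_k ev p^`M(k) g * mxvec (x *m g) ord0 k.
Proof. by rewrite !lamE ev_sum; apply: eq_bigr => k _; rewrite evM eval_genmx. Qed.

Lemma lam_gen x i j : lam x (genmx_ i j) = (map_mx (@mpolyC _ F) x *m genmx_) i j.
Proof.
rewrite [genmx_ i j]mxE lamE (bigD1 (mxvec_index i j)) //= big1 ?addr0 => [|l lk].
  rewrite mderivX mnm1E eqxx scale1r.
  have -> : (U_(mxvec_index i j) - U_(mxvec_index i j))%MM = 0%MM :> 'X_{1..N * N}.
    by apply/mnmP=> l; rewrite mnmBE mnm0E subnn.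
  by rewrite mpolyX0 mul1r mxvecE.
by rewrite mderivX mnm1E eq_sym (negPf lk) scale0r mul0r.
Qed.

Lemma lam_unique (D : A -> A) x :
  {morph D : a b / a + b} -> (forall a b, D (a * b) = D a * b + a * D b) ->
  (forall c, D c%:MP = 0) ->
  (forall i j, D (genmx_ i j) = (map_mx (@mpolyC _ F) x *m genmx_) i j) ->
  D =1 lam x.
Proof.
move=> DD DM DC DX; elim/mpoly_ring_ind => [c|k|p q IHp IHq|p q IHp IHq].
- by rewrite DC lamC.
- by case/mxvec_indexP: k => i j; have := DX i j; rewrite -lam_gen [genmx_ i j]mxE.
- by rewrite DD lamD IHp IHq.
- by rewrite DM lamM IHp IHq.
Qed.

(** A commutator of derivations is a derivation, so the generators suffice. On these,
    [lam z' (lam z X) = z z' X]: [lam] reverses products, which fixes the sign. *)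
Lemma lam_comm x y p :
  lam y (lam x p) - lam x (lam y p) = lam (x *m y - y *m x) p.
Proof.
apply: (lam_unique (D := fun p => lam y (lam x p) - lam x (lam y p))) p.
- by move=> a b; rewrite (lamD x) (lamD y) (lamD y) (lamD x) opprD addrACA.
- move=> a b; rewrite (lamM x) (lamM y a) (lamD y) (lamD x) !lamM.
  move: (lam y (lam x a)) (lam x (lam y a)) (lam y (lam x b)) (lam x (lam y b)).
  by move: (lam x a) (lam x b) (lam y a) (lam y b) => *; ring.
- by move=> c; rewrite !lamC ?lam0 subrr.
have lamXX (z z' : 'M[F]_N) i j :
    lam z' (lam z (genmx_ i j)) = (map_mx (@mpolyC _ F) (z *m z') *m genmx_) i j.
  rewrite lam_gen mxE lam_sum map_mxM -mulmxA [RHS]mxE; apply: eq_bigr => l _.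
  by rewrite mxE lamM lamC mul0r add0r lam_gen.
by move=> i j; rewrite !lamXX map_mxB mulmxBl !mxE.
Qed.

Definition rtrans (h : 'M[F]_N) (p : A) : A :=
  msub (@mpolyC _ F) p (genmx_ *m map_mx (@mpolyC _ F) h).
Definition ltrans (h : 'M[F]_N) (p : A) : A :=
  msub (@mpolyC _ F) p (map_mx (@mpolyC _ F) h *m genmx_).

Lemma eval_msub (p : A) (B : 'M[A]_N) g :
  ev (msub (@mpolyC _ F) p B) g = ev p (map_mx (fun q => ev q g) B).
Proof.
have -> : map_mx (fun q => ev q g) B = map_mx (meval (fun k => mxvec g ord0 k)) B.
  by apply/matrixP => i j; rewrite !mxE evE.
rewrite !evE.
exact: (@msub_morph _ _ (@mpolyC _ F) idfun (meval (fun k => mxvec g ord0 k))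
          p B (mevalC _)).
Qed.

Lemma eval_gen g : map_mx (fun q => ev q g) genmx_ = g.
Proof. by apply/matrixP => i j; rewrite !mxE evE /eval_mx mevalXU mxvecE. Qed.

Lemma eval_rtrans h p g : ev (rtrans h p) g = ev p (g *m h).
Proof.
rewrite eval_msub; congr ev; apply/matrixP => i j; rewrite !mxE ev_sum.
by apply: eq_bigr => l _; rewrite !mxE evM evC evE /eval_mx mevalXU mxvecE.
Qed.

Lemma eval_ltrans h p g : ev (ltrans h p) g = ev p (h *m g).
Proof.
rewrite eval_msub; congr ev; apply/matrixP => i j; rewrite !mxE ev_sum.
by apply: eq_bigr => l _; rewrite !mxE evM evC evE /eval_mx mevalXU mxvecE.
Qed.

(** Left and right multiplication commute. This turns a derivative at [g] into the derivative at the
    identity of a right translate. *)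
Lemma lam_rtrans x h p : lam x (rtrans h p) = rtrans h (lam x p).
Proof.
have rtM (B : 'M[F]_N) i j : rtrans h ((map_mx (@mpolyC _ F) B *m genmx_) i j) =
    (map_mx (@mpolyC _ F) B *m (genmx_ *m map_mx (@mpolyC _ F) h)) i j.
  rewrite !mxE /rtrans msub_sum; apply: eq_bigr => l _.
  by rewrite msubM [map_mx _ B _ _]mxE msubC [genmx_ _ _]mxE msubX.
rewrite [in RHS]lamE /rtrans msub_sum (msub_deriv (f := @mpolyC _ F)).
- apply: eq_bigr => k _; rewrite msubM; congr (_ * _).
  case/mxvec_indexP: k => i j; rewrite !mxvecE -/(rtrans _ _) rtM.
  rewrite mxE lam_sum mulmxA [RHS]mxE; apply: eq_bigr => l _.
  by rewrite lamM [map_mx _ h _ _]mxE lamC mulr0 addr0 lam_gen.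
- exact: lamD.
- exact: lamM.
- exact: lamC.
Qed.

Definition ccomp (p : A) (B : 'M[{poly F}]_N) : {poly F} := msub (@polyC F) p B.

Definition mxeval (c : F) (B : 'M[{poly F}]_N) : 'M[F]_N := map_mx (horner_eval c) B.

Lemma horner_ccomp p B c : (ccomp p B).[c] = ev p (mxeval c B).
Proof.
rewrite evE; exact: (@msub_morph _ _ (@polyC F) idfun (horner_eval c) p B (fun a => hornerC a c)).
Qed.

Lemma deriv_ccomp p B :
  (ccomp p B)^`() = \sum_k ccomp p^`M(k) B * (mxvec B ord0 k)^`().
Proof.
apply: (msub_deriv (f := @polyC F) (D := @deriv F)).
- exact: derivD.
- exact: derivM.
- exact: derivC.
Qed.

(** The hypothesis makes [B] an integral curve of the vector field of [x], so derivatives along [B]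
    can be iterated through [lam x]. *)
Lemma deriv_ccomp_lam p B x :
  map_mx (@deriv F) B = map_mx (@polyC F) x *m B ->
  (ccomp p B)^`() = ccomp (lam x p) B.
Proof.
move=> dB; rewrite deriv_ccomp lamE /ccomp msub_sum; apply: eq_bigr => k _.
rewrite msubM; congr (_ * _); case/mxvec_indexP: k => i j; rewrite !mxvecE.
have := congr1 (fun C : 'M_N => C i j) dB; rewrite !mxE msub_sum => ->.
by apply: eq_bigr => l _; rewrite msubM !mxE msubC msubX.
Qed.

Lemma horner_deriv_ccomp p B c x :
  map_mx (horner_eval c \o @deriv F) B = x *m mxeval c B ->
  (ccomp p B)^`().[c] = ev (lam x p) (mxeval c B).
Proof.
move=> dB; rewrite deriv_ccomp horner_sum eval_lam -dB; apply: eq_bigr => k _.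
rewrite hornerM horner_ccomp; congr (_ * _).
by case/mxvec_indexP: k => i j; rewrite !mxvecE mxE.
Qed.

Lemma lie_algebraE (H : 'M[F]_N -> Prop) x :
  lie_algebra H x <->
  forall p, (forall g, H g -> ev p g = 0) -> ev (lam x p) 1%:M = 0.
Proof.
split=> Hx p Hp.
  rewrite eval_lam mulmx1; have := Hx p; under eq_bigr => k _ do rewrite -evE.
  by apply=> g Hg; rewrite -evE; exact: Hp.
have := Hx p; rewrite eval_lam mulmx1; under eq_bigr => k _ do rewrite evE.
by apply=> g Hg; rewrite evE; exact: Hp.
Qed.

End Calculus.

(** * Subspaces, dual families and kernels *)

Section LinearAlgebra.

Variable F : fieldType.

(** A vector of [S] outside the row space raises the rank when it is added, and the rank cannot
    exceed [n]. *)
Lemma subspace_mx n (S : 'rV[F]_n -> Prop) :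
  S 0 -> (forall c x y, S x -> S y -> S (c *: x + y)) ->
  exists M : 'M[F]_n, forall v, (v <= M)%MS <-> S v.
Proof.
move=> S0 Slin.
have SS (M : 'M[F]_n) : (forall i, S (row i M)) -> forall v, (v <= M)%MS -> S v.
  move=> SM v /submxP[c ->]; rewrite mulmx_sum_row.
  elim/big_ind: _ => [//|x y Sx Sy|i _]; first by rewrite -[x]scale1r; exact: Slin.
  by rewrite -[_ *: _]addr0; exact: Slin.
have step k : (exists2 M : 'M[F]_n, (k <= \rank M)%N & forall v, (v <= M)%MS -> S v) \/
    exists M : 'M[F]_n, forall v, (v <= M)%MS <-> S v.
  elim: k => [|k [[M rM SM]|]]; last by right.
    by left; exists 0 => // v; rewrite submx0 => /eqP ->.
  have [h|/existsNP[v /not_implyP[Sv /negP vM]]] := pselect (forall v, S v -> (v <= M)%MS).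
    by right; exists M => v; split; [exact: SM | exact: h].
  left; exists (M + <<v>>)%MS; last first.
    move=> y /sub_addsmxP[[y1 y2] ->].
    rewrite -[y1 *m M]scale1r; apply: (Slin); first by apply: SM; rewrite submxMl.
    have : (y2 *m <<v>> <= v)%MS by rewrite (submx_trans (submxMl _ _)) ?genmxE.
    case/sub_rVP => c ->; rewrite -[_ *: _]addr0; exact: Slin.
  apply: leq_ltn_trans rM _; rewrite ltn_neqAle mxrankS ?addsmxSl // andbT.
  apply/negP => /eqP e; move/negP: vM; apply.
  have := mxrank_leqif_sup (addsmxSl M <<v>>%MS); rewrite e => -[_].
  rewrite eqxx => /esym vM'; apply: (submx_trans _ vM').
  by rewrite (submx_trans _ (addsmxSr _ _)) ?genmxE.
case: (step n.+1) => // -[M]; rewrite ltnNge rank_leq_row //.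
Qed.

(** The vectors of values of the [phi i] at points of [S] span the whole space: a nonzero column of
    the cokernel of their span would be a linear relation between the [phi i] on [S]. Hence every
    unit vector is a combination of them. *)
Lemma eval_dual (T : Type) (S : T -> Prop) r (phi : 'I_r -> T -> F) :
  (forall c : 'I_r -> F,
     (forall t, S t -> \sum_i c i * phi i t = 0) -> forall i, c i = 0) ->
  forall j, exists m (h : 'I_m -> T) (b : 'I_m -> F),
    (forall k, S (h k)) /\ forall i, \sum_k b k * phi i (h k) = (i == j)%:R.
Proof.
move=> indep.
pose Q (v : 'rV[F]_r) := exists m (h : 'I_m -> T) (b : 'I_m -> F),
    (forall k, S (h k)) /\ forall i, \sum_k b k * phi i (h k) = v ord0 i.
have [||M HM] := @subspace_mx r Q.
- by exists 0%N, (fun i : 'I_0 => match i with Ordinal _ h => match notF h with end end), (fun _ => 0);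
    split=> [[]|i] //; rewrite big_ord0 mxE.
- move=> c x y [m [h [b [Sh hx]]]] [m' [h' [b' [Sh' hy]]]].
  exists (m + m')%N, (fun k => match split k with inl i => h i | inr i => h' i end),
    (fun k => match split k with inl i => c * b i | inr i => b' i end).
  split=> [k|i]; first by case: (split k).
  rewrite big_split_ord !mxE -hx -hy mulr_sumr; congr (_ + _); apply: eq_bigr => k _ /=.
    by rewrite (unsplitK (inl k)) mulrA.
  by rewrite (unsplitK (inr k)).
move=> j; suff : Q (delta_mx ord0 j).
  by case=> m [h [b [Sh hb]]]; exists m, h, b; split=> // i; rewrite hb mxE eqxx.
apply/HM; suff -> : (M :=: 1%:M)%MS by exact: submx1.
apply/eqmxP; rewrite submx1 sub1mx; apply/contraT => nf.
have : cokermx M != 0.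
  by rewrite -mxrank_eq0 mxrank_coker subn_eq0 -ltnNge ltn_neqAle nf rank_leq_col.
have MK : M *m cokermx M = 0 by exact: mulmx_coker.
move=> /matrix0Pn[i [k]] /eqP; case.
apply: (indep (fun i => cokermx M i k)) => t St.
have Qt : Q (\row_i phi i t).
  exists 1%N, (fun _ => t), (fun _ => 1); split=> // i'.
  by rewrite big_ord1 mul1r mxE.
have /HM/submxP[d hd] := Qt.
have := congr1 (fun C : 'rV_r => C ord0 k) (congr1 (mulmx d) MK).
rewrite mulmxA -hd mulmx0 !mxE => e; rewrite -[RHS]e; apply: eq_bigr => l _.
by rewrite [X in _ = X * _]mxE mulrC.
Qed.

Lemma nz_left_kernel m n (M : 'M[F]_(m, n)) :
  (n < m)%N -> exists2 v : 'rV_m, v != 0 & v *m M = 0.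
Proof.
move=> nm; have : kermx M != 0.
  by rewrite -mxrank_eq0 mxrank_ker subn_eq0 -ltnNge (leq_ltn_trans (rank_leq_col M)).
by case/rowV0Pn => v /sub_kermxP vM v0; exists v.
Qed.

End LinearAlgebra.

(** * Powers of a unipotent matrix as a polynomial curve *)

Lemma poly_eq_nat (F : numFieldType) (p q : {poly F}) :
  (forall k : nat, p.[k%:R] = q.[k%:R]) -> p = q.
Proof.
move=> pq; apply/eqP; rewrite -subr_eq0; apply/contraT => nz.
have := @max_poly_roots _ (p - q) [seq k%:R | k <- iota 0 (size (p - q))] nz.
rewrite size_map size_iota ltnn; apply.
  by apply/allP => _ /mapP[k _ ->]; rewrite rootE hornerD hornerN pq subrr.
by rewrite map_inj_uniq ?iota_uniq // => k l /eqP; rewrite eqr_nat => /eqP.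
Qed.

Section UnipotentCurve.

Variables (F : numFieldType) (N : nat).

(** The binomial coefficient of t over [l], as a polynomial in t. *)
Definition binpoly l : {poly F} := (l`!%:R^-1)%:P * \prod_(m < l) ('X - m%:R%:P).

Lemma horner_binpoly l k : (binpoly l).[k%:R] = 'C(k, l)%:R.
Proof.
rewrite hornerM hornerC horner_prod.
have -> : \prod_(m < l) ('X - m%:R%:P).[k%:R] = (k ^_ l)%:R :> F.
  elim: l => [|l IH]; first by rewrite big_ord0.
  rewrite big_ord_recr /= IH !hornerE ffactnSr natrM.
  have [lk|kl] := leqP l k; first by rewrite natrB.
  by rewrite ffact_small // !mul0r.
by rewrite -bin_ffact natrM mulrC mulfK // pnatr_eq0 -lt0n fact_gt0.
Qed.

Lemma size_binpoly l : (size (binpoly l) <= l.+1)%N.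
Proof.
rewrite /binpoly mul_polyC (leq_trans (size_scale_leq _ _)) // size_prod_XsubC.
by rewrite [index_enum _]unlock -enumT size_enum_ord.
Qed.

(** For unipotent [u], the power [u^t] with a formal exponent, by the binomial series in [u - 1]. *)
Definition upow_curve (u : 'M[F]_N) : 'M[{poly F}]_N :=
  \sum_(l < N) binpoly l *: map_mx (@polyC F) ((u - 1%:M) ^+ l).

Lemma size_upow_curve u i j : (size (upow_curve u i j) <= N.+1)%N.
Proof.
rewrite summxE (leq_trans (size_sum _ _ _)) //; apply/bigmax_leqP => l _.
rewrite !mxE mulrC mul_polyC (leq_trans (size_scale_leq _ _)) //.
by rewrite (leq_trans (size_binpoly _)) // ltnS ltnW.
Qed.

Variables (u : 'M[F]_N) (u_nilp : (u - 1%:M) ^+ N = 0).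

Lemma upow_curveE k : mxeval k%:R (upow_curve u) = u ^+ k.
Proof.
have uE : u = 1 + (u - 1%:M) by rewrite addrC subrK.
rewrite [in RHS]uE exprDn_comm; last by rewrite /GRing.comm mul1r mulr1.
under eq_bigr => l _ do rewrite expr1n mul1r.
transitivity (\sum_(l < N) (u - 1%:M) ^+ l *+ 'C(k, l)).
  apply/matrixP => i j; rewrite mxE /horner_eval !summxE horner_sum.
  apply: eq_bigr => l _; rewrite mxE hornerM horner_binpoly mxE hornerC.
  by rewrite mulmxnE mulr_natl.
rewrite -(big_mkord xpredT (fun l => (u - 1%:M) ^+ l *+ 'C(k, l))).
rewrite -(big_mkord xpredT (fun l => (u - 1%:M) ^+ l *+ 'C(k, l))).
(* Nilpotency cuts the sum at [N], vanishing binomials cut it after [k]; the two are compared inside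
   a common longer range. *)
have ex n : (N <= n)%N -> \sum_(0 <= l < n) (u - 1%:M) ^+ l *+ 'C(k, l) =
    \sum_(0 <= l < N) (u - 1%:M) ^+ l *+ 'C(k, l).
  move=> Nn; rewrite (big_cat_nat (leq0n _) Nn) //= [X in _ + X]big_nat_cond.
  rewrite [X in _ + X]big1 ?addr0 // => l /andP[/andP[Nl _] _].
  by rewrite -(subnKC Nl) exprD u_nilp mul0r mul0rn.
have ex' n : (k.+1 <= n)%N -> \sum_(0 <= l < n) (u - 1%:M) ^+ l *+ 'C(k, l) =
    \sum_(0 <= l < k.+1) (u - 1%:M) ^+ l *+ 'C(k, l).
  move=> Nn; rewrite (big_cat_nat (leq0n _) Nn) //= [X in _ + X]big_nat_cond.
  rewrite [X in _ + X]big1 ?addr0 // => l /andP[/andP[Nl _] _].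
  by rewrite bin_small ?mulr0n.
by rewrite -(ex (maxn N k.+1)) ?leq_maxl // ex' ?leq_maxr.
Qed.

Definition upow_log : 'M[F]_N := mxeval 0 (map_mx (@deriv F) (upow_curve u)).

(** Differentiating [u^(t+k) = u^t u^k] at t = 0 gives the identity at the point [k], and natural
    points suffice. *)
Lemma upow_curve_deriv :
  map_mx (@deriv F) (upow_curve u) = map_mx (@polyC F) upow_log *m upow_curve u.
Proof.
set B := upow_curve u.
have shift k : map_mx (fun p : {poly F} => p \Po ('X + k%:R%:P)) B =
    B *m map_mx (@polyC F) (u ^+ k).
  apply/matrixP => i j; apply: poly_eq_nat => m.
  rewrite mxE horner_comp !hornerE -natrD.
  have := congr1 (fun C : 'M_N => C i j) (upow_curveE (m + k)).
  rewrite mxE /horner_eval => ->; rewrite exprD -upow_curveE.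
  rewrite mxE [in RHS]mxE horner_sum; apply: eq_bigr => l _.
  by rewrite !mxE hornerM hornerC.
apply/matrixP => i j; apply: poly_eq_nat => k.
have := congr1 (fun C : 'M_N => (C i j)^`().[0]) (shift k).
rewrite !mxE deriv_comp derivD derivX derivC addr0 mulr1 horner_comp !hornerE => ->.
rewrite (raddf_sum (@deriv F)) !horner_sum; apply: eq_bigr => l _.
rewrite /= derivM [map_mx _ (u ^+ k) _ _]mxE derivC mulr0 addr0 !hornerM hornerC.
rewrite [map_mx _ upow_log _ _]mxE hornerC; congr (_ * _); first by rewrite !mxE.
by rewrite -upow_curveE mxE.
Qed.

End UnipotentCurve.

Lemma size_ccomp (F : fieldType) N (p : {mpoly F[N * N]}) (B : 'M[{poly F}]_N) e :
  (forall i j, (size (B i j) <= e.+1)%N) ->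
  (size (ccomp p B) <= (msize p * e).+1)%N.
Proof.
move=> Be; rewrite /ccomp /msub /mmap big_seq.
rewrite (leq_trans (size_sum _ _ _)) //; apply/bigmax_leqP_seq => m _ /msize_mdeg_lt mp.
rewrite mul_polyC (leq_trans (size_scale_leq _ _)) //.
rewrite (@leq_trans (mdeg m * e).+1) //; last by rewrite ltnS leq_mul2r (ltnW mp) orbT.
rewrite mdegE /mmap1; elim/big_ind2: _ => [|a b c d Ha Hb|k _].
- by rewrite size_poly1.
- by rewrite (leq_trans (size_polyMleq _ _)) // mulnDl; move: Ha Hb; lia.
- rewrite (leq_trans (size_poly_exp_leq _ _)) // ltnS mulnC leq_mul2l.
  by case/mxvec_indexP: k => i j; rewrite mxvecE -subn1 leq_subLR add1n Be orbT.
Qed.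

(** * Lie algebras acting on a semi-invariant *)

Section LieAlgebra.

Variables (F : fieldType) (N : nat).
Implicit Types (G H : 'M[F]_N -> Prop) (x y : 'M[F]_N) (p q : {mpoly F[N * N]}).

Definition vanishes H p := forall g, H g -> ev p g = 0.

Definition lams (ys : seq 'M[F]_N) p := foldr (@lam F N) p ys.

(** At [g], [lam x p] is the derivative at the identity of the right translate of [p] by [g], and
    this translate vanishes on [H]. *)
Lemma lie_vanishes H G x p : (forall h g, H h -> G g -> G (h *m g)) ->
  lie_algebra H x -> vanishes G p -> vanishes G (lam x p).
Proof.
move=> HG /lie_algebraE Hx Gp g Gg.
rewrite -[g]mul1mx -eval_rtrans -lam_rtrans; apply: Hx => h Hh.
by rewrite eval_rtrans; apply: Gp; exact: HG.
Qed.

Lemma lie_lin H c x y :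
  lie_algebra H x -> lie_algebra H y -> lie_algebra H (c *: x + y).
Proof.
move=> /lie_algebraE Hx /lie_algebraE Hy; apply/lie_algebraE => p Hp.
by rewrite lam_linear evD evZ Hx // Hy // mulr0 addr0.
Qed.

Lemma lie0 H : lie_algebra H 0.
Proof.
apply/lie_algebraE => p _.
by rewrite eval_lam big1 // => k _; rewrite mul0mx linear0 mxE mulr0.
Qed.

Lemma lie_bracket H x y : (forall g h, H g -> H h -> H (g *m h)) -> H 1%:M ->
  lie_algebra H x -> lie_algebra H y -> lie_algebra H (x *m y - y *m x).
Proof.
move=> HM H1 Hx Hy; apply/lie_algebraE => p Hp.
rewrite -lam_comm evB !(lie_vanishes (H := H) (G := H)) ?subrr //;
  exact: (lie_vanishes (H := H)).
Qed.

Lemma lams_cat a b p : lams (a ++ b) p = lams a (lams b p).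
Proof. exact: foldr_cat. Qed.

Lemma lamsD ys : {morph lams ys : p q / p + q}.
Proof. by elim: ys => [|y ys IH] // p q; rewrite /lams /= -!/(lams ys _) IH lamD. Qed.

Lemma lamsZ ys c p : lams ys (c *: p) = c *: lams ys p.
Proof. by elim: ys => // y ys; rewrite /lams /= => ->; rewrite lamZ. Qed.

Lemma lamsB ys p q : lams ys (p - q) = lams ys p - lams ys q.
Proof. by rewrite lamsD -scaleN1r lamsZ scaleN1r. Qed.

Lemma lams0 ys : lams ys 0 = 0.
Proof. by elim: ys => // y ys; rewrite /lams /= => ->; rewrite lam0. Qed.

Lemma lams_sum ys (J : Type) (r : seq J) (P : pred J) (f : J -> {mpoly F[N * N]}) :
  lams ys (\sum_(i <- r | P i) f i) = \sum_(i <- r | P i) lams ys (f i).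
Proof. exact: (big_morph _ (lamsD ys) (lams0 ys)). Qed.

End LieAlgebra.

(** * Reordering iterated derivatives, in the manner of Poincare-Birkhoff-Witt *)

Section Jets.

Variables (F : fieldType) (N : nat) (G u kap : 'M[F]_N -> Prop).
Variables (s : nat) (xb : 'I_s -> 'M[F]_N).
Variables (f : {mpoly F[N * N]}) (K : nat).
Hypothesis G1 : G 1%:M.
Hypothesis u_xb : forall a, u (xb a).
Hypothesis u_bracket : forall y z, u y -> u z -> u (y *m z - z *m y).
Hypothesis u_dec : forall y, u y ->
  exists c z, [/\ kap z, u z & y = \sum_a c a *: xb a + z].
Hypothesis u_lam : forall y p, u y -> vanishes G p -> vanishes G (lam y p).
Hypothesis kap_f : forall z, kap z -> vanishes G (lam z f).
Hypothesis sorted_jets : forall e : 'I_s -> nat, (\sum_a e a <= K)%N ->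
  ev (lams (flatten [seq nseq (e a) (xb a) | a <- enum 'I_s]) f) 1%:M = 0.

Let val ys := ev (lams ys f) 1%:M.
Let inu (ys : seq 'M[F]_N) := forall y, y \in ys -> u y.

(** Exchanging two neighbours costs a bracket, that is, a shorter word, which gives 0 by induction
    on the length. So letters may be permuted freely; expanding them by [u_dec] leaves sorted words
    in [xb] and words containing an element that kills [f]. *)
Lemma jets_vanish ys : inu ys -> (size ys <= K)%N -> val ys = 0.
Proof.
have [k] := ubnP (size ys); elim: k ys => // k IHk ys.
rewrite ltnS leq_eqVlt => /orP[/eqP|]; last exact: IHk.
have inu_cat a b : inu (a ++ b) <-> inu a /\ inu b.
  split=> [h|[ha hb] y]; last by rewrite mem_cat => /orP[/ha|/hb].
  by split=> y hy; apply: h; rewrite mem_cat hy ?orbT.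
have inu_cons y b : inu (y :: b) <-> u y /\ inu b.
  split=> [h|[hy hb] z]; last by rewrite inE => /orP[/eqP->|/hb].
  by split=> [|z zb]; apply: h; rewrite inE ?eqxx ?zb ?orbT.
move=> sys uys skK.
have swap a y z b : inu (a ++ y :: z :: b) -> size (a ++ y :: z :: b) = k ->
    val (a ++ y :: z :: b) = val (a ++ z :: y :: b).
  move=> /inu_cat[ua /inu_cons[uy /inu_cons[uz ub]]] sz.
  apply/eqP; rewrite -subr_eq0 /val !lams_cat -evB -lamsB /= lam_comm.
  rewrite -[lam _ _]/(lams ((z *m y - y *m z) :: b) f) -lams_cat.
  apply/eqP/IHk.
  - by move: sz; rewrite !size_cat /=; lia.
  - by apply/inu_cat; split=> //; apply/inu_cons; split=> //; exact: u_bracket.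
  - by move: sz skK sys; rewrite !size_cat /=; lia.
have front a b y c : inu (a ++ b ++ y :: c) -> size (a ++ b ++ y :: c) = k ->
    val (a ++ b ++ y :: c) = val (a ++ y :: b ++ c).
  elim: b a => [|z b IHb] a //= uz sz.
  rewrite -cat_rcons IHb ?cat_rcons // swap // => [x|].
    have := uz x; rewrite !(mem_cat, inE) => h h'; apply: h; move: h'.
    by do ![case: (x \in _) => //=]; case: eqP => //=; case: eqP => //=.
  by move: sz; rewrite !size_cat /= !size_cat /=; lia.
have basis (is_ : seq 'I_s) : size is_ = k -> val (map xb is_) = 0.
  move=> sis.
  have uxb t : inu (map xb t) by move=> y /mapP[i _ ->].
  have perm (t t' pre : seq 'I_s) : size (pre ++ t) = k -> perm_eq t t' ->
      val (map xb (pre ++ t)) = val (map xb (pre ++ t')).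
    elim: t t' pre => [|i t IHt] t' pre st; first by rewrite perm_sym => /perm_nilP ->.
    move=> pt; have it' : i \in t' by rewrite -(perm_mem pt) mem_head.
    case/splitPr: it' pt => t1 t2 pt.
    have pt2 : perm_eq t (t1 ++ t2).
      by rewrite -(perm_cons i) (perm_trans pt) // -cat1s perm_catCA.
    have spt : size (pre ++ t1 ++ i :: t2) = k.
      by rewrite -st !size_cat /= (perm_size pt2) size_cat addnS.
    rewrite -cat_rcons (IHt (t1 ++ t2)) ?cat_rcons // !map_cat /= map_cat.
    by rewrite front // -?map_cons -?map_cat ?size_map.
  pose e a := count_mem a is_.
  have pis : perm_eq is_ (flatten [seq nseq (e a) a | a <- enum 'I_s]).
    apply/allP => i _ /=; rewrite count_flatten -map_comp sumnE big_map.
    rewrite (eq_bigr (fun a => (e a * (a == i))%N)); last first.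
      by move=> a _; rewrite /= count_nseq mulnC.
    rewrite big_enum (bigD1 i) //= eqxx muln1 big1 ?addn0 // => a /negPf ->.
    by rewrite muln0.
  have := perm is_ _ [::] sis pis; rewrite /= => ->.
  rewrite map_flatten -map_comp.
  rewrite (eq_map (g := fun a => nseq (e a) (xb a))) => [|a]; last exact: map_nseq.
  apply: sorted_jets; move/perm_size: pis; rewrite sis size_flatten /shape -map_comp.
  rewrite sumnE big_map big_enum /= => ks.
  apply: leq_trans skK; rewrite sys ks; apply: leq_sum => a _.
  by rewrite /= size_nseq.
(* Letters are expanded one at a time; [is_] lists the basis indices replacing those already
   treated. *)
suff main m : forall is_ ys', size ys' = m -> inu ys' -> (size is_ + m)%N = k ->
    val (map xb is_ ++ ys') = 0.
  by apply: (main (size ys) [::] ys).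
elim: m => [|m IHm] is_ [|y ys'] //= => [_ _|[sm] /inu_cons[uy uys']] sk.
  by rewrite cats0 basis // -sk addn0.
have uxb t : inu (map xb t) by move=> z /mapP[i _ ->].
have [c [z [kz uz ->]]] := u_dec uy.
rewrite /val lams_cat /= -[X in X + z]scale1r lam_linear scale1r lam_suml.
rewrite lamsD lams_sum evD ev_sum.
rewrite -[lam z _]/(lams (z :: ys') f) -lams_cat.
rewrite big1 ?add0r => [|a _]; last first.
  rewrite lamsZ evZ -[lam _ _]/(lams (xb a :: ys') f) -lams_cat -cat_rcons -map_rcons.
  by rewrite -/(val _) IHm ?mulr0 // size_rcons addSnnS.
(* The remainder [z] is moved to the front and from there to the end, where it acts first and kills
   [f] on [G]. *)
rewrite -/(val _) -[map _ _ ++ _]/([::] ++ map xb is_ ++ z :: ys').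
have uzs : inu (map xb is_ ++ ys') by apply/inu_cat.
have := @front [::] (map xb is_) z ys'; rewrite /= => ->; first last.
- by rewrite size_cat /= size_map sm.
- by apply/inu_cat; split=> //; apply/inu_cons.
have := @front [::] (map xb is_ ++ ys') z [::]; rewrite /= cats0 => <-; first last.
- by rewrite !size_cat /= size_map; lia.
- by apply/inu_cat; split=> //; apply/inu_cons; split.
rewrite /val lams_cat; elim: (map xb is_ ++ ys') uzs 1%:M G1 => [_|b bs IHb /inu_cons[ub ubs]] /=.
  exact: kap_f.
by apply: u_lam => // g Gg; exact: IHb.
Qed.

End Jets.

(** * Derivatives of monomials in functions vanishing at the identity *)

Section Monomials.

Variables (F : fieldType) (N r : nat).
Variables (f : 'I_r -> {mpoly F[N * N]}) (y : 'I_r -> 'M[F]_N).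

Definition monom (a : 'I_r -> nat) := \prod_b f b ^+ a b.

Definition decr (a : 'I_r -> nat) b : 'I_r -> nat := fun b' => (a b' - (b' == b))%N.

Lemma lam_exp x (p : {mpoly F[N * N]}) k :
  lam x (p ^+ k) = k%:R *: (lam x p * p ^+ k.-1).
Proof.
elim: k => [|k IH]; first by rewrite expr0 scale0r -[1]/(1%:MP) lamC.
rewrite exprS lamM IH -scalerAr mulrCA -exprS.
case: k {IH} => [|k] /=; first by rewrite scale0r addr0 scale1r.
by rewrite -[X in X + _]scale1r -scalerDl nat1r.
Qed.

Lemma monomD1 a b : monom a = f b ^+ a b * \prod_(b' | b' != b) f b' ^+ a b'.
Proof. by rewrite /monom (bigD1 b). Qed.

Lemma lam_monom x a :
  lam x (monom a) = \sum_b (a b)%:R *: (lam x (f b) * monom (decr a b)).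
Proof.
have lam_prod (s : seq 'I_r) : uniq s ->
    lam x (\prod_(b <- s) f b ^+ a b) = \sum_(b <- s) (a b)%:R *:
      (lam x (f b) * (f b ^+ (a b).-1 * \prod_(b' <- s | b' != b) f b' ^+ a b')).
  elim: s => [|b s IH] /=; first by rewrite !big_nil -[1]/(1%:MP) lamC.
  case/andP => bs us; rewrite !big_cons lamM IH // lam_exp eqxx /=.
  rewrite -scalerAl -mulrA; congr (_ *: (_ * (_ * _)) + _).
    rewrite big_seq [RHS]big_seq_cond; apply: eq_bigl => b'.
    by case b's: (b' \in s) => //=; apply/esym/eqP => e; rewrite -e b's in bs.
  rewrite mulr_sumr big_seq [RHS]big_seq; apply: eq_bigr => b' b's.
  rewrite big_cons ifT; last by apply/eqP => e; rewrite e b's in bs.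
  by rewrite -scalerAr; congr (_ *: _); rewrite mulrCA; congr (_ * _); rewrite mulrCA.
rewrite /monom lam_prod ?index_enum_uniq //; apply: eq_bigr => b _.
congr (_ *: (_ * _)); rewrite [RHS](bigD1 b) //= /decr eqxx subn1.
by congr (_ * _); apply: eq_bigr => b' /negPf ->; rewrite subn0.
Qed.

Hypothesis f1 : forall b, ev (f b) 1%:M = 0.
Hypothesis fdual : forall b b', ev (lam (y b) (f b')) 1%:M = (b' == b)%:R.

(** Every [f b] vanishes at the identity, so each factor must be consumed by a derivation of its
    own. With no more derivations than factors this requires the two multisets to match, and the
    factorials count the ways to match them. *)
Lemma lams_monom w a q : (size w <= \sum_b a b)%N ->
  ev (lams (map y w) (q * monom a)) 1%:M =
  ev q 1%:M * (if [forall b, a b == count_mem b w] then \prod_b (a b)`!%:R else 0).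
Proof.
elim/last_ind: w a q => [|w b IH] a q.
  move=> _ /=; rewrite evM; congr (_ * _).
  case: ifP => [/forallP a0|/negbT/forallPn[b ab]].
    rewrite /monom !big1 => [|b _|b _]; rewrite ?(eqP (a0 b)) //.
    by rewrite -[1]/(1%:MP) evC.
  by rewrite (monomD1 _ b) evM evX f1 expr0n
    (negPf ab) mul0r.
rewrite size_rcons => sw.
have count_rc b' : count_mem b' (rcons w b) = (count_mem b' w + (b == b'))%N.
  by rewrite -cats1 count_cat /= addn0.
rewrite map_rcons -cats1 lams_cat /= lamM lamsD evD IH ?(ltnW sw) //.
have sumc (w' : seq 'I_r) : (\sum_b count_mem b w')%N = size w'.
  elim: w' => [|i w' IHw]; first by rewrite big1.
  by rewrite /= big_split /= IHw (bigD1 i) //= eqxx big1 // => j; rewrite eq_sym => /negPf ->.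
(* The term in which [y b] hits [q] vanishes: fewer derivations than factors remain. *)
rewrite ifF ?mulr0 ?add0r; last first.
  apply/negP => /forallP h; move: sw.
  by rewrite (eq_bigr (fun b => count_mem b w)) ?sumc ?ltnn // => i _; apply/eqP.
rewrite lam_monom mulr_sumr lams_sum ev_sum.
have termE b' : ev (lams (map y w)
     (q * ((a b')%:R *: (lam (y b) (f b') * monom (decr a b'))))) 1%:M =
   (a b')%:R * (ev q 1%:M * (b' == b)%:R *
     (if [forall i, decr a b' i == count_mem i w] then \prod_i (decr a b' i)`!%:R else 0)).
  rewrite -scalerAr (mulrA q) lamsZ evZ.
  have [->|ab] := eqVneq (a b') 0%N; first by rewrite !mul0r.
  congr (_ * _); rewrite IH ?evM ?fdual //.
  rewrite -ltnS (leq_trans sw) // (bigD1 b') //= [in X in (_ <= X)%N](bigD1 b') //=.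
  rewrite /decr eqxx -addSn subn1 prednK ?lt0n // leq_add2l.
  by apply: leq_sum => i /negPf ->; rewrite subn0.
rewrite (eq_bigr _ (fun b' _ => termE b')).
rewrite (bigD1 b) //= [X in _ + X]big1; last first.
  by move=> b' /negPf hb; rewrite hb mulr0 mul0r mulr0.
rewrite addr0.
rewrite eqxx mulr1 mulrCA; congr (_ * _).
have [ab|ab] := eqVneq (a b) 0%N.
  rewrite ab mul0r ifF //; apply/negP => /forallP/(_ b).
  by rewrite ab count_rc eqxx addn1.
have -> : [forall i, decr a b i == count_mem i w] =
          [forall i, a i == count_mem i (rcons w b)].
  apply/eq_forallb => i; rewrite count_rc /decr /=.
  have [->|ib] := eqVneq i b; first by rewrite -(eqn_add2r 1) subnK ?lt0n.
  by rewrite subn0 addn0.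
case: ifP => _; last by rewrite mulr0.
rewrite (bigD1 b) //= [in RHS](bigD1 b) //= mulrA; congr (_ * _).
  by rewrite /decr eqxx subn1 -natrM -[in RHS](prednK (n := a b)) ?lt0n // factS prednK ?lt0n.
by apply: eq_bigr => i /negPf ib; rewrite /decr ib subn0.
Qed.

End Monomials.

(** * Tangent vectors acting on a semi-invariant of the big cell *)

Section TangentSpace.

Variables (F : numFieldType) (N : nat) (G U M : 'M[F]_N -> Prop).
Variables (ch : 'M[F]_N -> F) (E : 'M[F]_N) (P : {mpoly F[N * N]}).
Hypothesis G1 : G 1%:M.
Hypothesis GM : forall g h, G g -> G h -> G (g *m h).
Hypothesis UG : sub_mx U G.
Hypothesis U1 : U 1%:M.
Hypothesis UM : forall g h, U g -> U h -> U (g *m h).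
Hypothesis U_unip : unipotent U.
Hypothesis P_M : forall b g, M b -> G g -> ev P (b *m g) = ch b * ev P g.
Hypothesis P_U : forall u, U u -> ev P u = 1.
Hypothesis MU_dense : forall p,
  (forall b u, M b -> U u -> ev p (b *m u) = 0) -> vanishes G p.
Hypothesis E_lam : forall p, vanishes G p -> vanishes G (lam E p).

Let P1 : ev P 1%:M = 1. Proof. exact: P_U. Qed.

Let u_lam y p : lie_algebra U y -> vanishes G p -> vanishes G (lam y p).
Proof. by apply: lie_vanishes => h g Uh Gg; apply: GM => //; exact: UG. Qed.

(** Elements of Lie(U) that kill [P] on [G] also kill its right translates, so functions built from
    these cannot detect them. Hence [xb] spans only a complement. *)
Lemma lie_basis : exists s (xb : 'I_s -> 'M[F]_N),
  [/\ forall a, lie_algebra U (xb a),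
      forall y, lie_algebra U y -> exists c z, [/\ vanishes G (lam z P),
        lie_algebra U z & y = \sum_a c a *: xb a + z]
    & forall c : 'I_s -> F, vanishes G (lam (\sum_a c a *: xb a) P) -> forall a, c a = 0].
Proof.
have [||Um HU] := @subspace_mx F (N * N) (fun v => lie_algebra U (vec_mx v)).
- by rewrite linear0; exact: lie0.
- by move=> c x y ux uy; rewrite linearP; exact: lie_lin.
have [||Km HK] := @subspace_mx F (N * N) (fun v => vanishes G (lam (vec_mx v) P)).
- move=> g _; rewrite linear0 eval_lam big1 // => k _.
  by rewrite mul0mx linear0 mxE mulr0.
- move=> c x y ux uy g Gg; rewrite linearP lam_linear evD evZ.
  by rewrite ux // uy // mulr0 addr0.
pose D := (Um :\: Km)%MS; pose R := row_base D.
have RU a : (row a R <= Um)%MS.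
  by rewrite (submx_trans (row_sub _ _)) // eq_row_base diffmxSl.
exists (\rank D), (fun a => vec_mx (row a R)).
have sumE (c : 'I_(\rank D) -> F) :
    \sum_a c a *: vec_mx (row a R) = vec_mx (\row_a c a *m R).
  rewrite mulmx_sum_row linear_sum; apply: eq_bigr => a _.
  by rewrite linearZ mxE.
split=> [a|y uy|c cK a]; first exact/HU.
- have : (mxvec y <= Um)%MS by apply/HU; rewrite mxvecK.
  rewrite -(addsmx_diff_cap_eq Um Km) => /sub_addsmxP[[y1 y2] /= yE].
  have : (y1 *m (Um :\: Km) <= R)%MS by rewrite eq_row_base submxMl.
  case/submxP => c cE; exists (fun a => c ord0 a), (vec_mx (y2 *m (Um :&: Km)%MS)).
  split; first by apply/HK; rewrite (submx_trans (submxMl _ _)) ?capmxSr.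
    by apply/HU; rewrite (submx_trans (submxMl _ _)) ?capmxSl.
  rewrite sumE -linearD /=; have -> : \row_a c ord0 a = c.
    by apply/rowP => i; rewrite mxE.
  by rewrite -cE -yE mxvecK.
- move: cK; rewrite sumE => cK.
  have : (\row_a c a *m R <= D :&: Km)%MS.
    by rewrite sub_capmx -[X in (_ <= X)%MS && _]/D -(eq_row_base D) submxMl; apply/HK.
  rewrite capmx_diff submx0 => /eqP c0.
  have : \row_a c a == 0 by rewrite -(mulmx_free_eq0 _ (row_base_free D)) c0.
  by move=> /eqP/rowP/(_ a); rewrite !mxE.
Qed.

(* Polynomials behaving like the translates P(. h), to first degree. *)
Let transl (f : {mpoly F[N * N]}) :=
  [/\ forall b g, M b -> G g -> ev f (b *m g) = ch b * ev f g,
      forall z, vanishes G (lam z P) -> vanishes G (lam z f)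
    & forall (B : 'M[{poly F}]_N) e, (forall i j, (size (B i j) <= e.+1)%N) ->
        (size (ccomp f B) <= (msize P * e).+1)%N].

Let translP m (h : 'I_m -> 'M[F]_N) (b : 'I_m -> F) : (forall k, G (h k)) ->
  transl (\sum_k b k *: rtrans (h k) P).
Proof.
move=> Gh; split=> [c g Mc Gg|z zP g Gg|B e Be].
- rewrite !ev_sum mulr_sumr; apply: eq_bigr => k _.
  by rewrite 2!evZ 2!eval_rtrans -mulmxA (P_M Mc (GM Gg (Gh k))) mulrCA.
- rewrite lam_sum ev_sum big1 // => k _.
  by rewrite lamZ evZ lam_rtrans eval_rtrans (zP _ (GM Gg (Gh k))) mulr0.
- have ccD : {morph (fun p : {mpoly F[N * N]} => ccomp p B) : p q / p + q}.
    by move=> p q; exact: msubD.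
  have cc0 : ccomp (0 : {mpoly F[N * N]}) B = 0 by rewrite -mpolyC0 /ccomp msubC.
  rewrite (big_morph _ ccD cc0) (leq_trans (size_sum _ _ _)) //.
  apply/bigmax_leqP => k _.
  have -> : ccomp (b k *: rtrans (h k) P) B =
      b k *: ccomp P (B *m map_mx (@polyC F) (h k)).
    rewrite -mul_mpolyC -mul_polyC /ccomp msubM msubC; congr (_ * _).
    apply: poly_eq_nat => l; rewrite -!/(ccomp _ _) !horner_ccomp eval_rtrans.
    congr ev; apply/matrixP => i j; rewrite !mxE /horner_eval horner_sum.
    by apply: eq_bigr => t _; rewrite !mxE hornerM hornerC.
  rewrite (leq_trans (size_scale_leq _ _)) //; apply: size_ccomp => i j.
  rewrite mxE (leq_trans (size_sum _ _ _)) //; apply/bigmax_leqP => t _.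
  by rewrite mxE mulrC mul_polyC (leq_trans (size_scale_leq _ _)) ?Be.
Qed.

Let transl_P : transl P.
Proof. by split=> // B e; exact: size_ccomp. Qed.

(* The tangent vector E of G is, up to the action on P, a tangent vector of U:
   otherwise products of translates of P would outnumber their jets along U. *)
Lemma lie_transversal : exists x c c', [/\ lie_algebra U x, c != 0
  & forall g, G g ->
      ev (lam x P) g = c * ev (lam E P) g + c' * ev P g].
Proof.
apply: contrapT => nex.
have key x c c' : lie_algebra U x -> (forall g, G g ->
    ev (lam x P) g = c * ev (lam E P) g + c' * ev P g) -> c = 0.
  by move=> ux h; apply/eqP/contraT => c0; case: nex; exists x, c, c'.
have [s [xb [u_xb u_dec xb_free]]] := lie_basis.
pose y (b : 'I_s.+1) := if unlift ord0 b is Some a then xb a else E.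
pose phi (i : 'I_s.+2) := if unlift ord0 i is Some b then lam (y b) P else P.
have y_lam b p : vanishes G p -> vanishes G (lam (y b) p).
  by rewrite /y; case: unliftP => [a _|_]; [exact: u_lam | exact: E_lam].
(* The functions [phi i] turn out to be independent on [G], so [eval_dual] yields combinations of
   right translates of [P] that vanish at 1 and are dual to [y]. *)
have [f fP] : exists f : 'I_s.+1 -> {mpoly F[N * N]}, forall b,
    [/\ transl (f b), ev (f b) 1%:M = 0
      & forall b', ev (lam (y b') (f b)) 1%:M = (b == b')%:R].
  suff /choice[f fP] : forall b : 'I_s.+1, exists fb : {mpoly F[N * N]},
      [/\ transl fb, ev fb 1%:M = 0
      & forall b', ev (lam (y b') fb) 1%:M = (b == b')%:R] by exists f.
  move=> b.
  have [|m [h [d [Gh hd]]]] := @eval_dual F _ G s.+2 (fun i g => ev (phi i) g) _ (lift ord0 b).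
    move=> c c0; pose x := \sum_a c (lift ord0 (lift ord0 a)) *: xb a.
    have ux : lie_algebra U x.
      rewrite /x; elim/big_ind: _ => [|z z' uz uz'|a _]; first exact: lie0.
        by rewrite -[z]scale1r; exact: lie_lin.
      by rewrite -[_ *: _]addr0; apply: lie_lin => //; exact: lie0.
    have cE g : G g -> ev (lam x P) g =
        - c (lift ord0 ord0) * ev (lam E P) g + - c ord0 * ev P g.
      move=> Gg; have := c0 g Gg; rewrite !big_ord_recl /phi unlift_none !liftK /y unlift_none.
      rewrite (eq_bigr (fun a => c (lift ord0 (lift ord0 a)) * ev (lam (xb a) P) g)); last first.
        by move=> a _; rewrite !liftK.
      have -> : ev (lam x P) g = \sum_a c (lift ord0 (lift ord0 a)) * ev (lam (xb a) P) g.
        by rewrite lam_suml ev_sum; apply: eq_bigr => a _; rewrite evZ.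
      rewrite addrA => /eqP; rewrite addrC addr_eq0 => /eqP -> ; ring.
    have c1 : c (lift ord0 ord0) = 0.
      by apply/eqP; rewrite -oppr_eq0; apply/eqP; exact: (key _ _ _ ux cE).
    (* At the identity [lam x P] vanishes, because [P] is constantly 1 on [U]. *)
    have cz : c ord0 = 0.
      have := cE _ G1; rewrite c1 oppr0 mul0r add0r P1 mulr1.
      have /lie_algebraE/(_ (P - 1%:MP)) := ux; rewrite lamB lamC subr0 => -> //.
        by move=> /eqP; rewrite eq_sym oppr_eq0 => /eqP.
      by move=> u Uu; rewrite evB evC P_U ?subrr.
    have ca : forall a, c (lift ord0 (lift ord0 a)) = 0.
      by apply: xb_free => g Gg; rewrite (cE g Gg) c1 cz oppr0 !mul0r addr0.
    move=> i; case: (unliftP ord0 i) => [b' ->|-> //].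
    by case: (unliftP ord0 b') => [a ->|->].
  exists (\sum_k d k *: rtrans (h k) P); split; first exact: translP.
    have := hd ord0; rewrite /phi unlift_none (negPf (neq_lift _ _)) => h0; rewrite -[RHS]h0.
    rewrite ev_sum; apply: eq_bigr => k _.
    by rewrite evZ eval_rtrans mul1mx.
  move=> b'; have := hd (lift ord0 b'); rewrite /phi liftK (inj_eq lift_inj) eq_sym => <-.
  rewrite lam_sum ev_sum; apply: eq_bigr => k _.
  by rewrite lamZ evZ lam_rtrans eval_rtrans mul1mx.
have f1 b : ev (f b) 1%:M = 0 by case: (fP b).
have fdual b b' : ev (lam (y b) (f b')) 1%:M = (b' == b)%:R by case: (fP b').
have ftr b : transl (f b) by case: (fP b).
(* [D] bounds the degree of a translate of [P] along [u^t], and [K = n * D] that of a product of [n]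
   of them. There are [(n' + 1)^(s + 1)] monomials against [(K + 1)^s] jets; since
   [K + 1 <= C * (n' + 1)] and [n' = C^s], the monomials are more numerous. *)
pose D := (msize P * N)%N; pose C := (s.+1 * D).+1.
pose n' := (C ^ s)%N; pose n := (s.+1 * n')%N; pose K := (n * D)%N.
pose rows : finType := {ffun 'I_s.+1 -> 'I_n'.+1}.
pose cols : finType := {ffun 'I_s -> 'I_K.+1}.
pose deg (a : rows) := (\sum_b a b)%N.
(* The power of [P] gives all these products the same weight [ch ^+ n]. *)
pose mon (a : rows) := P ^+ (n - deg a) * monom f (fun b => a b).
have degn a : (deg a <= n)%N.
  rewrite /deg /n -[X in (_ <= X * _)%N]card_ord -sum_nat_const.
  by apply: leq_sum => b _; rewrite -ltnS.
pose word (e : 'I_s -> nat) := flatten [seq nseq (e a) (xb a) | a <- enum 'I_s].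
pose Mx := \matrix_(i < #|rows|, j < #|cols|)
   ev (lams (word (fun a => enum_val j a)) (mon (enum_val i))) 1%:M.
have [|v v0 vM] := @nz_left_kernel F _ _ Mx.
  rewrite !card_ffun !card_ord.
  apply: (@leq_ltn_trans ((C * n'.+1) ^ s)); last first.
    by rewrite expnMn expnS ltn_pmul2r ?expn_gt0.
  have aux t u d : ((t * u * d).+1 <= (t * d).+1 * u.+1)%N by nia.
  by have [-> //|s0] := posnP s; rewrite leq_exp2r //; exact: aux.
(* A combination with nonzero coefficient vector whose sorted jets along [U] vanish up to order
   [K]. *)
pose f0 := \sum_i v ord0 i *: mon (enum_val i).
have mon_semi b g a : M b -> G g ->
    ev (mon a) (b *m g) = ch b ^+ n * ev (mon a) g.
  move=> Mb Gg; rewrite /mon !evM !evX P_M // exprMn.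
  rewrite -[X in _ = ch b ^+ X * _](subnK (degn a)) exprD -!mulrA; congr (_ * _).
  rewrite mulrCA; congr (_ * _); rewrite /deg -prodrXr /monom.
  have evalp h : ev (\prod_b' f b' ^+ a b') h = \prod_b' ev (f b') h ^+ a b'.
    rewrite (big_morph (fun p : {mpoly F[N * N]} => ev p h)
      (fun p q => evM p q h) (evC 1 h)).
    by apply: eq_bigr => b' _; rewrite evX.
  rewrite !evalp -big_split; apply: eq_bigr => b' _ /=.
  by have [-> // _ _] := ftr b'; rewrite exprMn.
have lamz_mon z a : vanishes G (lam z P) -> vanishes G (lam z (mon a)).
  move=> zP; have lM p q : vanishes G (lam z p) -> vanishes G (lam z q) ->
      vanishes G (lam z (p * q)).
    by move=> zp zq g Gg; rewrite lamM evD !evM zp // zq // mul0r mulr0 addr0.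
  have l1 : vanishes G (lam z 1) by move=> g Gg; rewrite -[1]/(1%:MP) lamC -mpolyC0 evC.
  have lX p k : vanishes G (lam z p) -> vanishes G (lam z (p ^+ k)).
    by move=> zp; elim: k => [|k IH]; rewrite ?expr0 // exprS; exact: lM.
  apply: (lM); first exact: lX.
  rewrite /monom; elim/big_ind: _ => [//|p q|b _]; [exact: lM|apply: lX].
  by have [_ h _] := ftr b; exact: h.
have f0_word e : (\sum_a e a <= K)%N -> ev (lams (word e) f0) 1%:M = 0.
  move=> eK; have ea a : (e a < K.+1)%N.
    by rewrite ltnS (leq_trans _ eK) // (bigD1 a) //= leq_addr.
  pose e' : cols := [ffun a => inord (e a)].
  have wE : word e = word (fun a => e' a).
    congr flatten; apply: eq_map => a; rewrite ffunE inordK //.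
  have := congr1 (fun A : 'rV_#|cols| => A ord0 (enum_rank e')) vM.
  rewrite !mxE => <-; rewrite lams_sum ev_sum; apply: eq_bigr => i _.
  by rewrite lamsZ evZ !mxE enum_rankK wE.
have f0_kap z : vanishes G (lam z P) -> vanishes G (lam z f0).
  move=> zP g Gg; rewrite lam_sum ev_sum big1 // => i _.
  by rewrite lamZ evZ lamz_mon ?mulr0.
have jets ys : (forall x, x \in ys -> lie_algebra U x) -> (size ys <= K)%N ->
    ev (lams ys f0) 1%:M = 0.
  exact: (@jets_vanish F N G (lie_algebra U) (fun z => vanishes G (lam z P)) s xb f0 K G1
    u_xb (fun x z => @lie_bracket F N U x z UM U1) u_dec u_lam f0_kap f0_word ys).
(* Along [u^t] the function [f0] is a polynomial of degree at most [K], and all its derivatives at 0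
   up to order [K] vanish. *)
have f0_U u : U u -> ev f0 u = 0.
  move=> Uu; have nu := U_unip Uu; pose B := upow_curve u.
  have BU k : U (mxeval k%:R B).
    rewrite upow_curveE //; elim: k => [|k IH]; first by rewrite expr0.
    by rewrite exprS; exact: UM.
  have B0 : mxeval 0 B = 1%:M by rewrite -[0]/(0%:R) upow_curveE.
  have dB := upow_curve_deriv nu.
  have ul : lie_algebra U (upow_log u).
    apply/lie_algebraE => p Up; rewrite -B0 -horner_ccomp -(deriv_ccomp_lam _ dB).
    have -> : ccomp p B = 0.
      by apply: poly_eq_nat => k; rewrite horner_ccomp horner0 Up.
    by rewrite deriv0 horner0.
  have sB : (size (ccomp f0 B) <= K.+1)%N.
    have sp p : transl p -> (size (ccomp p B) <= D.+1)%N.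
      by case=> _ _; apply=> i j; exact: size_upow_curve.
    have cc0 : ccomp (0 : {mpoly F[N * N]}) B = 0 by rewrite -mpolyC0 /ccomp msubC.
    have ccD : {morph (fun p : {mpoly F[N * N]} => ccomp p B) : p q / p + q}.
      by move=> p q; exact: msubD.
    have ccM : {morph (fun p : {mpoly F[N * N]} => ccomp p B) : p q / p * q}.
      by move=> p q; exact: msubM.
    have cc1 : ccomp (1 : {mpoly F[N * N]}) B = 1 by rewrite -[1]/(1%:MP) /ccomp msubC.
    have ccX p k : ccomp (p ^+ k) B = ccomp p B ^+ k :> {poly F}.
      by elim: k => [|k IH]; rewrite ?expr0 // !exprS ccM IH.
    have sX p k : transl p -> (size (ccomp (p ^+ k) B) <= (k * D).+1)%N.
      move=> /sp tp; rewrite ccX (leq_trans (size_poly_exp_leq _ _)) // ltnS mulnC leq_mul2l.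
      by rewrite -subn1 leq_subLR add1n tp orbT.
    rewrite /f0 (big_morph _ ccD cc0) (leq_trans (size_sum _ _ _)) //.
    apply/bigmax_leqP => i _; rewrite -mul_mpolyC ccM [ccomp _%:MP _]msubC mul_polyC.
    rewrite (leq_trans (size_scale_leq _ _)) // /mon ccM.
    have sm : (size (ccomp (monom f (fun b => enum_val i b)) B) <= (deg (enum_val i) * D).+1)%N.
      rewrite /monom (big_morph _ ccM cc1) /deg big_distrl /=.
      elim/big_ind2: _ => [|q1 k1 q2 k2 h1 h2|b _]; first by rewrite size_poly1.
        by rewrite (leq_trans (size_polyMleq _ _)) //; move: (size k1) (size k2) h1 h2 => *; lia.
      exact: sX.
    have -> : K = ((n - deg (enum_val i)) * D + deg (enum_val i) * D)%N.
      by rewrite -mulnDl subnK.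
    rewrite (leq_trans (size_polyMleq _ _)) //.
    move: sm (sX _ (n - deg (enum_val i))%N transl_P).
    by move: (size _) (size _) (_ * D)%N (_ * D)%N => *; lia.
  have dk k : (ccomp f0 B)^`(k) = ccomp (lams (nseq k (upow_log u)) f0) B.
    elim: k => [|k IH] //; rewrite derivnS IH /= (deriv_ccomp_lam _ dB) //.
  have c0 : ccomp f0 B = 0.
    apply/polyP => k; rewrite coef0; have [Kk|kK] := leqP K.+1 k.
      by rewrite nth_default // (leq_trans sB).
    have := congr1 (fun p : {poly F} => p.[0]) (dk k).
    rewrite horner_ccomp B0 jets ?size_nseq // => [|x]; last first.
      by rewrite mem_nseq => /andP[_ /eqP->].
    rewrite horner_coef0 coef_derivn addn0 ffactnn => /eqP.
    by rewrite mulrn_eq0 (gtn_eqF (fact_gt0 _)) => /eqP.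
  have := congr1 (fun p : {poly F} => p.[1]) c0; rewrite horner0 horner_ccomp.
  by rewrite -[1]/(1%:R) upow_curveE // expr1.
have f0_G : vanishes G f0.
  apply: MU_dense => b u Mb Uu; rewrite /f0 ev_sum.
  rewrite (eq_bigr (fun i => ch b ^+ n * ev (v ord0 i *: mon (enum_val i)) u)); last first.
    by move=> i _; rewrite !evZ (mon_semi _ _ _ Mb (UG Uu)) mulrCA.
  by rewrite -mulr_sumr -ev_sum (f0_U u Uu) mulr0.
have /matrix0Pn[i0 [j0 vj0]] := v0.
(* Differentiating as prescribed by a monomial of least degree isolates its nonzero coefficient,
   although [f0] vanishes on [G]. *)
pose i1 := [arg min_(i < j0 | v ord0 i != 0) deg (enum_val i)].
have [vi1 i1min] : v ord0 i1 != 0 /\ forall i, v ord0 i != 0 ->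
    (deg (enum_val i1) <= deg (enum_val i))%N.
  by rewrite /i1; case: arg_minnP => [|i vi hi]; [rewrite ord1 in vj0 | split].
pose a1 := enum_val i1; pose w := flatten [seq nseq (a1 b) b | b <- enum 'I_s.+1].
have wc b : count_mem b w = a1 b.
  rewrite /w count_flatten -map_comp sumnE big_map.
  rewrite (eq_bigr (fun i => (a1 i * (i == b))%N)); last first.
    by move=> i _; rewrite /= count_nseq mulnC.
  rewrite big_enum (bigD1 b) //= eqxx muln1 big1 ?addn0 // => i /negPf ->.
  by rewrite muln0.
have sw : size w = deg a1.
  rewrite /w size_flatten /shape -map_comp sumnE big_map big_enum /=.
  by apply: eq_bigr => b _; rewrite size_nseq.
have : ev (lams (map y w) f0) 1%:M = 0.
  elim: w {wc sw} 1%:M G1 => [|b w IH] g Gg /=; first exact: f0_G.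
  by apply: y_lam => // h Gh; exact: IH.
rewrite lams_sum ev_sum (bigD1 i1) //= [X in _ + X]big1 => [|i ii1]; last first.
  rewrite lamsZ evZ; have [->|vi] := eqVneq (v ord0 i) 0; first by rewrite mul0r.
  rewrite (lams_monom f1 fdual) ?sw ?i1min // ifF ?mulr0 //.
  apply/negP => /forallP h; move/eqP: ii1; apply; apply: enum_val_inj.
  by apply/ffunP => b; apply: ord_inj; rewrite (eqP (h b)) wc.
rewrite addr0 lamsZ evZ (lams_monom f1 fdual) ?sw // evX P1 expr1n mul1r.
rewrite ifT; last by apply/forallP => b; rewrite wc.
move/eqP; rewrite mulf_eq0 (negPf vi1) /=; apply/negP.
by apply/prodf_neq0 => b _; rewrite pnatr_eq0 -lt0n fact_gt0.
Qed.

End TangentSpace.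

(** * Polynomial identities between z and 1/z *)

Section PolynomialsAtInfinity.

Variable F : numFieldType.

Lemma poly_eq_nz (p q : {poly F}) : (forall z, z != 0 -> p.[z] = q.[z]) -> p = q.
Proof.
move=> pq; apply: (mulfI (negbT (polyX_eq0 F))); apply: poly_eq_nat => k.
by rewrite !hornerM hornerX; have [->|/pq ->//] := eqVneq (k%:R : F) 0; rewrite !mul0r.
Qed.

(** The right-hand side stays bounded as z tends to infinity, so the polynomial on the left has
    degree at most 0; multiplying by a power of z makes this a comparison of degrees. *)
Lemma size_inv_pole m (A B : {poly F}) : A != 0 ->
  (forall z, z != 0 -> z ^+ m * A.[z] = B.[z^-1]) -> (size A + m <= 1)%N.
Proof.
move=> A0 AB; set n := size B.
have E : 'X^(m + n) * A = \sum_(k < n) B`_k *: 'X^(n - k).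
  apply: poly_eq_nz => z z0; rewrite hornerM hornerXn exprD mulrAC AB //.
  rewrite horner_coef mulr_suml horner_sum; apply: eq_bigr => k _.
  by rewrite hornerZ hornerXn -mulrA exprVn [_^-1 * _]mulrC -expfB_cond // (negPf z0) add0n ltnW.
have : (size ('X^(m + n) * A)%R <= n.+1)%N.
  rewrite E (leq_trans (size_sum _ _ _)) //; apply/bigmax_leqP => k _.
  by rewrite (leq_trans (size_scale_leq _ _)) // size_polyXn ltnS leq_subr.
by rewrite mulrC size_mulXn //; lia.
Qed.

Lemma zero_of_inv_pole m (A B : {poly F}) :
  (forall z, z != 0 -> z ^+ m.+1 * A.[z] = B.[z^-1]) -> B = 0.
Proof.
move=> AB; have A0 : A = 0.
  apply/eqP/contraT => A0; have := size_inv_pole A0 AB.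
  by rewrite -size_poly_gt0 in A0; lia.
apply: poly_eq_nz => z z0; rewrite horner0.
by have := AB z^-1; rewrite invr_eq0 invrK A0 horner0 mulr0 => ->.
Qed.

Lemma const_of_inv_pole (A B : {poly F}) :
  (forall z, z != 0 -> A.[z] = B.[z^-1]) -> forall c, A.[c] = B.[0].
Proof.
move=> AB c; have BA z : z != 0 -> B.[z] = A.[z^-1].
  by move=> z0; rewrite AB ?invr_eq0 // invrK.
have [A0|A0] := eqVneq A 0.
  have -> : B = 0 by apply: poly_eq_nz => z /BA ->; rewrite A0 !horner0.
  by rewrite A0 !horner0.
have := @size_inv_pole 0 A B A0; rewrite addn0 => h.
have /size1_polyC AC : (size A <= 1)%N by apply: h => z z0; rewrite mul1r AB.
have -> : B = (A`_0)%:P by apply: poly_eq_nz => z /BA ->; rewrite AC !hornerC coefC.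
by rewrite AC !hornerC coefC.
Qed.

Lemma deriv0_const (p : {poly F}) : p^`() = 0 -> forall c, p.[c] = p.[0].
Proof.
move=> dp c; suff /size1_polyC -> : (size p <= 1)%N by rewrite !hornerC.
apply/leq_sizeP => -[|k] // _; have := congr1 (fun q : {poly F} => q`_k) dp.
by rewrite coef_deriv coef0 => /eqP; rewrite mulrn_eq0 /= => /eqP.
Qed.

End PolynomialsAtInfinity.

(** * Polynomial curves in matrix groups and their derivations *)

Section OneParameter.

Variables (F : numFieldType) (N : nat).
Implicit Types (p : {mpoly F[N * N]}) (g : 'M[F]_N) (Phi : 'M[{poly F}]_N).

Lemma mxevalC c g : mxeval c (map_mx (@polyC F) g) = g.
Proof. by apply/matrixP => i j; rewrite !mxE /horner_eval hornerC. Qed.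

Lemma mxevalM c Phi Psi : mxeval c (Phi *m Psi) = mxeval c Phi *m mxeval c Psi.
Proof. exact: map_mxM. Qed.

(** The determinant of [u^t] is a nonzero polynomial [q] with [q(t+1) = det(u) q(t)], and a shift
    preserves the leading coefficient. *)
Lemma unipotent_det (u : 'M[F]_N) : (u - 1%:M) ^+ N = 0 -> \det u = 1.
Proof.
move=> nu; pose q := \det (upow_curve u).
have qk k : q.[k%:R] = \det u ^+ k.
  rewrite -[LHS]/(horner_eval k%:R q) -det_map_mx -/(mxeval _ _) upow_curveE //.
  by elim: k => [|k IH]; rewrite ?expr0 ?det1 // !exprS det_mulmx IH.
have q0 : q != 0.
  by apply/eqP => q0; have := qk 0%N; rewrite q0 horner0 => /eqP; rewrite eq_sym oner_eq0.
have qS : q \Po ('X + 1%:P) = (\det u)%:P * q.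
  apply: poly_eq_nat => k; rewrite horner_comp !hornerE natr1 !qk exprS //.
have sX : size ('X + 1%:P : {poly F}) = 2 by rewrite size_XaddC.
have := congr1 lead_coef qS; rewrite lead_coef_comp ?sX // lead_coefXaddC expr1n mulr1.
rewrite lead_coefM lead_coefC => /eqP; rewrite -{1}[lead_coef q]mul1r.
by rewrite (inj_eq (mulIf _)) ?lead_coef_eq0 // => /eqP.
Qed.

Variables (Phi : 'M[{poly F}]_N).
Hypothesis PhiD : forall c d, mxeval (c + d) Phi = mxeval c Phi *m mxeval d Phi.

Lemma one_param_deriv :
  map_mx (@deriv F) Phi = map_mx (@polyC F) (mxeval 0 (map_mx (@deriv F) Phi)) *m Phi.
Proof.
apply/matrixP => i j; apply: poly_eq_nat => k.
have shift : map_mx (fun p : {poly F} => p \Po ('X + k%:R%:P)) Phi =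
    Phi *m map_mx (@polyC F) (mxeval k%:R Phi).
  apply/matrixP => i' j'; apply: poly_eq_nat => m.
  rewrite mxE horner_comp !hornerE.
  have := congr1 (fun C : 'M_N => C i' j') (PhiD m%:R k%:R).
  rewrite [in X in X -> _]mxE /horner_eval => ->.
  rewrite -{1}(mxevalC m%:R (mxeval k%:R Phi)) -mxevalM.
  by rewrite [LHS]mxE.
have := congr1 (fun C : 'M_N => (C i j)^`().[0]) shift.
rewrite !mxE deriv_comp derivD derivX derivC addr0 mulr1 horner_comp !hornerE => ->.
rewrite (raddf_sum (@deriv F)) !horner_sum; apply: eq_bigr => l _.
rewrite /= derivM [map_mx _ (mxeval _ _) _ _]mxE derivC mulr0 addr0 !hornerM hornerC.
by rewrite [in RHS]mxE hornerC; congr (_ * _); rewrite !mxE.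
Qed.

End OneParameter.

Section CurveDerivative.

Variables (F : numFieldType) (N : nat).
Implicit Types (p : {mpoly F[N * N]}) (g : 'M[F]_N) (Phi : 'M[{poly F}]_N).

Lemma deriv_curve p g Phi x : mxeval 0 Phi = 1%:M ->
  x = mxeval 0 (map_mx (@deriv F) Phi) ->
  (ccomp p (Phi *m map_mx (@polyC F) g))^`().[0] = ev (lam x p) g.
Proof.
move=> Phi0 xE; rewrite (@horner_deriv_ccomp _ _ p _ 0 x); first by rewrite mxevalM mxevalC Phi0 mul1mx.
rewrite mxevalM mxevalC Phi0 mul1mx xE.
apply/matrixP => i j; rewrite !mxE /= (raddf_sum (@deriv F)) horner_evalE horner_sum.
apply: eq_bigr => l _; rewrite /= derivM [map_mx _ g _ _]mxE derivC mulr0 addr0 hornerM hornerC.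
by rewrite !mxE.
Qed.

Lemma curve_lam (G : 'M[F]_N -> Prop) p Phi :
  (forall g h, G g -> G h -> G (g *m h)) -> mxeval 0 Phi = 1%:M ->
  (forall c, G (mxeval c Phi)) ->
  vanishes G p -> vanishes G (lam (mxeval 0 (map_mx (@deriv F) Phi)) p).
Proof.
move=> GM Phi0 GPhi Gp g Gg; rewrite -(deriv_curve _ _ Phi0 erefl).
rewrite (_ : ccomp _ _ = 0) ?deriv0 ?horner0 //.
apply: poly_eq_nat => k; rewrite horner0 horner_ccomp mxevalM mxevalC.
by apply: Gp; exact: GM.
Qed.

Lemma lam_conj (t x g : 'M[F]_N) p : t \in unitmx ->
  ev (lam (t *m x *m invmx t) p) g = ev (lam x (ltrans t p)) (invmx t *m g).
Proof.
(* The line [1 + t y] need not lie in any group: only its tangent vector at the identity matters. *)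
move=> tu; pose C (y : 'M[F]_N) : 'M[{poly F}]_N := 1%:M + 'X *: map_mx (@polyC F) y.
have Cc y c : mxeval c (C y) = 1%:M + c *: y.
  by rewrite /mxeval map_mxD map_mx1 map_mxZ /= horner_evalE hornerX -/(mxeval _ _) mxevalC.
have C0 y : mxeval 0 (C y) = 1%:M by rewrite Cc scale0r addr0.
have dC y : y = mxeval 0 (map_mx (@deriv F) (C y)).
  apply/matrixP => i j; rewrite !mxE /horner_eval derivD derivM derivX derivC mulr0 addr0 mul1r.
  by rewrite raddfMn /= derivC mul0rn add0r hornerC.
rewrite -(deriv_curve p g (C0 _) (dC _)) -(deriv_curve (ltrans t p) (invmx t *m g) (C0 x) (dC x)).
congr (_^`().[0]); apply: poly_eq_nat => k; rewrite !horner_ccomp eval_ltrans !mxevalM !mxevalC !Cc.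
rewrite mulmxA; congr (ev p _); rewrite mulmxA; congr (_ *m g).
by rewrite mulmxDr mulmx1 mulmxDl mulmxV // -scalemxAr -scalemxAl.
Qed.

End CurveDerivative.

(** * Pinned groups *)

Section SL2.

Variable F : fieldType.
Implicit Types (x y z b c : F).

Lemma mx22M (a b c d a' b' c' d' : F) :
  mx22 a b c d *m mx22 a' b' c' d' =
  mx22 (a * a' + b * c') (a * b' + b * d') (c * a' + d * c') (c * b' + d * d').
Proof.
apply/matrixP => i j; rewrite !mxE !big_ord_recl big_ord0 !mxE /= addr0.
by case: i => [[|[|i]]] //= hi; case: j => [[|[|j]]].
Qed.

Lemma mx22_id : mx22 1 0 0 1 = 1%:M :> 'M[F]_2.
Proof.
apply/matrixP => i j; rewrite !mxE.
by case: i => [[|[|i]]] //= hi; case: j => [[|[|j]]].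
Qed.

Lemma SL2P (a b c d : F) : a * d - b * c = 1 -> SL2 (mx22 a b c d).
Proof.
rewrite /SL2 (expand_det_row _ ord0) !big_ord_recl big_ord0 /cofactor !det_mx11 !mxE /=.
by move=> h; rewrite -[RHS]h expr0 expr1; ring.
Qed.

Definition up z : 'M[F]_2 := mx22 1 z 0 1.
Definition lo z : 'M[F]_2 := mx22 1 0 z 1.
Definition dg x : 'M[F]_2 := mx22 x 0 0 x^-1.
Definition wx z : 'M[F]_2 := mx22 z (-1) 1 0.

Lemma SL2_up z : SL2 (up z). Proof. by apply: SL2P; ring. Qed.
Lemma SL2_lo z : SL2 (lo z). Proof. by apply: SL2P; ring. Qed.
Lemma SL2_wx z : SL2 (wx z). Proof. by apply: SL2P; ring. Qed.
Lemma SL2_dg x : x != 0 -> SL2 (dg x).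
Proof. by move=> x0; apply: SL2P; rewrite mulr0 subr0 mulfV. Qed.

Lemma loD x y : lo (x + y) = lo x *m lo y.
Proof. by rewrite /lo mx22M; congr mx22; ring. Qed.

Lemma wx_up z : up z *m mx22 0 (-1) 1 0 = wx z.
Proof. by rewrite mx22M; congr mx22; ring. Qed.

Lemma wx_decomp z : z != 0 -> wx z = lo z^-1 *m dg z *m up (- z^-1).
Proof. by move=> z0; rewrite !mx22M; congr mx22; field. Qed.

Lemma dg_decomp z : z != 0 -> dg z = lo (- z^-1) *m wx z *m up z^-1.
Proof. by move=> z0; rewrite !mx22M; congr mx22; field. Qed.

Lemma wx0_decomp : wx 0 = up (-1) *m lo 1 *m up (-1).
Proof. by rewrite !mx22M; congr mx22; ring. Qed.

Lemma up_lo b c : 1 + b * c != 0 ->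
  up b *m lo c = lo (c / (1 + b * c)) *m dg (1 + b * c) *m up (b / (1 + b * c)).
Proof. by move=> bc0; rewrite !mx22M; congr mx22; field. Qed.

End SL2.

(** * Root subgroups and principal minors of a pinned group *)

Section PinnedGroup.

Variables (F : numClosedFieldType) (I : finType) (D : pinned_group F I).
Notation N := (pg_dim D).
Notation G := (pg_G D).
Notation T := (pg_T D).
Notation U := (pg_U D).
Notation Um := (pg_Um D).
Notation phi := (pg_phi D).
Implicit Types (g h t u : 'M[F]_N) (i j k : I).

Lemma pg_alg : algebraic_group G. Proof. by case: (pg_simple D). Qed.

Lemma alg_unit (H : 'M[F]_N -> Prop) g : algebraic_group H -> H g -> g \in unitmx.
Proof. by case=> -[S HS] _ _ _ /HS[]. Qed.

Lemma pg_unit g : G g -> g \in unitmx. Proof. exact: alg_unit pg_alg. Qed.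
Lemma pg_1 : G 1%:M. Proof. by case: pg_alg. Qed.
Lemma pg_mul g h : G g -> G h -> G (g *m h). Proof. by case: pg_alg => _ _ GM _; exact: GM. Qed.

Lemma pg_BG : sub_mx (pg_B D) G. Proof. by case: (pg_borel D). Qed.
Lemma pg_BmG : sub_mx (pg_Bm D) G. Proof. by case: (pg_borelm D). Qed.
Lemma pg_TG : sub_mx T G. Proof. by move=> t [/pg_BG]. Qed.
Lemma pg_UB : sub_mx U (pg_B D). Proof. by case: (pg_radical D). Qed.
Lemma pg_UmB : sub_mx Um (pg_Bm D). Proof. by case: (pg_radicalm D). Qed.
Lemma pg_UG : sub_mx U G. Proof. by move=> u /pg_UB/pg_BG. Qed.
Lemma pg_UmG : sub_mx Um G. Proof. by move=> u /pg_UmB/pg_BmG. Qed.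
Lemma pg_U1 : U 1%:M. Proof. by case: (pg_radical D) => -[[]]. Qed.
Lemma pg_Um1 : Um 1%:M. Proof. by case: (pg_radicalm D) => -[[]]. Qed.
Lemma pg_Umul u v : U u -> U v -> U (u *m v).
Proof. by case: (pg_radical D) => -[[_ _ h _] _] _ _ _ _; exact: h. Qed.
Lemma pg_Ummul u v : Um u -> Um v -> Um (u *m v).
Proof. by case: (pg_radicalm D) => -[[_ _ h _] _] _ _ _ _; exact: h. Qed.
Lemma pg_Uunip : unipotent U. Proof. by case: (pg_radical D). Qed.
Lemma pg_Umunip : unipotent Um. Proof. by case: (pg_radicalm D). Qed.
Lemma pg_T1 : T 1%:M.
Proof. by split; [case: (pg_borel D) => -[] | case: (pg_borelm D) => -[]]. Qed.
Lemma pg_Tmul s t : T s -> T t -> T (s *m t).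
Proof.
case=> sB sBm [tB tBm]; split.
  by case: (pg_borel D) => -[_ _ h _] _ _ _ _; exact: h.
by case: (pg_borelm D) => -[_ _ h _] _ _ _ _; exact: h.
Qed.
Lemma pg_TV t : T t -> T (invmx t).
Proof.
case=> tB tBm; split.
  by case: (pg_borel D) => -[_ _ _ h] _ _ _ _; exact: h.
by case: (pg_borelm D) => -[_ _ _ h] _ _ _ _; exact: h.
Qed.
Lemma pg_UJ t u : T t -> U u -> U (t *m u *m invmx t).
Proof. by case=> tB _ Uu; case: (pg_radical D) => _ _ _ h _; exact: h. Qed.
Lemma pg_UmJ t u : T t -> Um u -> Um (t *m u *m invmx t).
Proof. by case=> _ tB Uu; case: (pg_radicalm D) => _ _ _ h _; exact: h. Qed.

Lemma phiG i (g : 'M[F]_2) : SL2 g -> G (phi i g).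
Proof. by case: (pg_phi_morph D i) => h _ _; exact: h. Qed.
Lemma phiM i (g h : 'M[F]_2) : SL2 g -> SL2 h -> phi i (g *m h) = phi i g *m phi i h.
Proof. by case: (pg_phi_morph D i) => _ H _; exact: H. Qed.

Lemma SL2M (g h : 'M[F]_2) : SL2 g -> SL2 h -> SL2 (g *m h).
Proof. by rewrite /SL2 det_mulmx => -> ->; rewrite mulr1. Qed.

Lemma phi1 i : phi i 1%:M = 1%:M.
Proof.
have S1 : SL2 (1%:M : 'M[F]_2) by exact: det1.
have := phiM i S1 S1; rewrite mulmx1 => /(congr1 (mulmx (invmx (phi i 1%:M)))).
by rewrite mulmxA mulVmx ?mul1mx // pg_unit //; exact: phiG.
Qed.

(** The determinant is 1 on [SL2], so the entries of [phi i] are given there by polynomials without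
    denominator. *)
Lemma phi_curve i (S : 'M[{poly F}]_2) : (forall c, SL2 (mxeval c S)) ->
  exists Phi : 'M[{poly F}]_N, forall c, mxeval c Phi = phi i (mxeval c S).
Proof.
move=> SS; case: (pg_phi_morph D i) => _ _ reg.
have [p hp] : exists p : 'I_N * 'I_N -> {mpoly F[2 * 2]},
    forall a (g : 'M[F]_2), SL2 g -> phi i g a.1 a.2 = ev (p a) g.
  suff /choice[p hp] : forall a : 'I_N * 'I_N, exists p : {mpoly F[2 * 2]},
      forall g : 'M[F]_2, SL2 g -> phi i g a.1 a.2 = ev p g by exists p.
  move=> a; have [p [n hp]] := reg a.1 a.2; exists p => g Sg.
  by rewrite hp // (Sg : \det g = 1) expr1n divr1 evE.
exists (\matrix_(a, b) ccomp (p (a, b)) S) => c.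
by apply/matrixP => a b; rewrite !mxE /horner_eval horner_ccomp (hp (a, b)).
Qed.

Definition mx22p (a b c d : {poly F}) : 'M[{poly F}]_2 :=
  \matrix_(i < 2, j < 2)
    if i == ord0 then (if j == ord0 then a else b)
    else (if j == ord0 then c else d).

Lemma mxeval22 c (a b a' b' : {poly F}) :
  mxeval c (mx22p a b a' b') = mx22 a.[c] b.[c] a'.[c] b'.[c].
Proof. by apply/matrixP => i j; rewrite !mxE /horner_eval; case: ifP => _; case: ifP. Qed.

Lemma up_curve i : exists Phi : 'M[{poly F}]_N, forall c, mxeval c Phi = phi i (up c).
Proof.
have e c : mxeval c (mx22p 1 'X 0 1) = up c by rewrite mxeval22 !hornerE.
have [|Phi hP] := @phi_curve i (mx22p 1 'X 0 1); first by move=> c; rewrite e; exact: SL2_up.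
by exists Phi => c; rewrite hP e.
Qed.

Lemma lo_curve i : exists Phi : 'M[{poly F}]_N, forall c, mxeval c Phi = phi i (lo c).
Proof.
have e c : mxeval c (mx22p 1 0 'X 1) = lo c by rewrite mxeval22 !hornerE.
have [|Phi hP] := @phi_curve i (mx22p 1 0 'X 1); first by move=> c; rewrite e; exact: SL2_lo.
by exists Phi => c; rewrite hP e.
Qed.

Lemma wx_curve i : exists Phi : 'M[{poly F}]_N, forall c, mxeval c Phi = phi i (wx c).
Proof.
have e c : mxeval c (mx22p 'X (-1)%:P 1 0) = wx c by rewrite mxeval22 !hornerE.
have [|Phi hP] := @phi_curve i (mx22p 'X (-1)%:P 1 0); first by move=> c; rewrite e; exact: SL2_wx.
by exists Phi => c; rewrite hP e.
Qed.

Lemma det_phi_up i z : \det (phi i (up z)) = 1.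
Proof. exact/unipotent_det/pg_Uunip/pg_phi_upper. Qed.

Lemma det_phi_lo i z : \det (phi i (lo z)) = 1.
Proof. exact/unipotent_det/pg_Umunip/pg_phi_lower. Qed.

Lemma det_phi_wx i z : \det (phi i (wx z)) = 1.
Proof.
have -> : wx z = up z *m (up (-1) *m lo 1 *m up (-1)).
  by rewrite -wx0_decomp !mx22M; congr mx22; ring.
have Su x := @SL2_up F x; have Sl x := @SL2_lo F x.
rewrite !phiM //; try by do ?apply: SL2M.
by rewrite !det_mulmx !det_phi_up det_phi_lo !mulr1.
Qed.

Lemma det_coroot i z : z != 0 -> \det (coroot D i z) = 1.
Proof.
move=> z0; rewrite /coroot -/(dg z) dg_decomp //.
have Su x := @SL2_up F x; have Sl x := @SL2_lo F x; have Sw x := @SL2_wx F x.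
rewrite !phiM //; try by do ?apply: SL2M.
by rewrite !det_mulmx det_phi_up det_phi_lo det_phi_wx !mulr1.
Qed.

(* P is the numerator of a principal minor: it transforms under the two Borel
   subgroups like the minor times a power of det. *)
Definition semi_invariant (k : I) (P : {mpoly F[N * N]}) (chi : 'M[F]_N -> F) :=
  [/\ forall u g, Um u -> G g -> ev P (u *m g) = ev P g,
      forall u g, U u -> G g -> ev P (g *m u) = ev P g,
      forall t g, T t -> G g -> ev P (t *m g) = chi t * ev P g /\ ev P (g *m t) = chi t * ev P g,
      ev P 1%:M = 1
    & forall j x, x != 0 -> chi (coroot D j x) = if j == k then x else 1].

(** [P] is the numerator of the regular function [Delta k], and [chi] is [omega k] times the
    matching power of the determinant. The transformation rules are checked on the cell [U^- T U]
    and extend to [G] by density. *)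
Lemma minor_semi_invariant omega Delta : fundamental_weights D omega ->
  principal_minors D omega Delta -> forall k, exists P chi,
  semi_invariant k P chi /\ forall g, G g -> \det g = 1 -> Delta k g = ev P g.
Proof.
move=> hom [[_ dens] hDel] k; have [[P [n DP]] DT] := hDel k.
have [[_ om1 omM] omk] := hom k.
pose chi t := omega k t * \det t ^+ n; exists P, chi.
have Pb um t u : Um um -> T t -> U u -> ev P (um *m t *m u) = chi t.
  move=> umU tT uU; have gG : G (um *m t *m u).
    by do 2?apply: pg_mul; [exact: pg_UmG | exact: pg_TG | exact: pg_UG].
  have := DP _ gG; rewrite DT // !det_mulmx.
  rewrite (unipotent_det (pg_Umunip umU)) (unipotent_det (pg_Uunip uU)) mulr1 mul1r.
  rewrite /chi evE => ->; rewrite divfK // expf_neq0 //.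
  by have := pg_unit (pg_TG tT); rewrite unitmxE unitfE.
have chiM s t : T s -> T t -> chi (s *m t) = chi s * chi t.
  by move=> sT tT; rewrite /chi omM // det_mulmx exprMn; ring.
have cell p : (forall um t u, Um um -> T t -> U u -> ev p (um *m t *m u) = 0) ->
    forall g, G g -> ev p g = 0.
  move=> h g Gg; rewrite evE; apply: dens Gg => g' [um [t [u [umU tT uU ->]]]].
  by rewrite -evE; exact: h.
have tV t : T t -> t \in unitmx by move=> tT; exact/pg_unit/pg_TG.
split; last by move=> g Gg dg1; rewrite DP // dg1 expr1n divr1 evE.
split.
- move=> v g Uv Gg; apply/eqP; rewrite -subr_eq0 -eval_ltrans -evB; apply/eqP.
  apply: cell Gg => um t u umU tT uU; rewrite evB eval_ltrans !mulmxA.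
  by rewrite !Pb ?subrr //; exact: pg_Ummul.
- move=> v g Uv Gg; apply/eqP; rewrite -subr_eq0 -eval_rtrans -evB; apply/eqP.
  apply: cell Gg => um t u umU tT uU; rewrite evB eval_rtrans -mulmxA.
  by rewrite !Pb ?subrr //; exact: pg_Umul.
- move=> s g sT Gg; split; apply/eqP.
    rewrite -subr_eq0 -eval_ltrans -evZ -evB; apply/eqP; apply: cell Gg => um t u umU tT uU; rewrite evB evZ eval_ltrans.
    have -> : s *m (um *m t *m u) = (s *m um *m invmx s) *m (s *m t) *m u.
      by rewrite !mulmxA mulmxKV ?tV.
    by rewrite !Pb ?chiM ?subrr //; [exact: pg_UmJ | exact: pg_Tmul].
  rewrite -subr_eq0 -eval_rtrans -evZ -evB; apply/eqP.
  apply: cell Gg => um t u umU tT uU; rewrite evB evZ eval_rtrans.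
  have -> : um *m t *m u *m s = um *m (t *m s) *m (invmx s *m u *m invmx (invmx s)).
    by rewrite invmxK !mulmxA mulmxK ?tV.
  rewrite !Pb ?chiM ?[_ * chi s]mulrC ?subrr //; first exact: pg_Tmul.
  by apply: pg_UJ => //; exact: pg_TV.
- have := Pb _ _ _ pg_Um1 pg_T1 pg_U1; rewrite !mul1mx => ->.
  by rewrite /chi om1 det1 expr1n mulr1.
- by move=> j x x0; rewrite /chi omk // det_coroot // expr1n mulr1.
Qed.

(** In the Gauss decomposition of [wx z] the upper factor is absorbed by invariance and the torus
    factor comes out as its weight. *)
Lemma semi_wx k P chi i z g : semi_invariant k P chi -> z != 0 -> G g ->
  ev P (g *m phi i (wx z)) = (if i == k then z else 1) * ev P (g *m phi i (lo z^-1)).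
Proof.
case=> [_ PU PT _ chiE] z0 Gg; rewrite wx_decomp //.
have [Sl [Sd Su]] := (SL2_lo z^-1, (SL2_dg z0, SL2_up (- z^-1))).
rewrite !phiM //; last exact: SL2M.
have GT : T (phi i (dg z)) by exact: pg_phi_diag.
have Gl := phiG i Sl; have Gd := phiG i Sd.
rewrite !mulmxA PU; [|exact: pg_phi_upper|by do 2?apply: pg_mul].
by have [_ ->] := PT _ _ GT (pg_mul Gg Gl); rewrite -(chiE i z z0).
Qed.

(** By [semi_wx] a polynomial in z equals a polynomial in 1/z, hence is constant; its value is read
    off at 1/z = 0. *)
Lemma semi_wx_neq k P chi i z g : semi_invariant k P chi -> i != k -> G g ->
  ev P (g *m phi i (wx z)) = ev P g.
Proof.
move=> hP ik Gg; have [W hW] := wx_curve i; have [L hL] := lo_curve i.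
have hA : forall c, (ccomp P (map_mx (@polyC F) g *m W)).[c] =
    (ccomp P (map_mx (@polyC F) g *m L)).[0].
  apply: const_of_inv_pole => c c0; rewrite !horner_ccomp !mxevalM !mxevalC hW hL.
  by rewrite (semi_wx _ hP) // (negPf ik) mul1r.
have := hA z; rewrite !horner_ccomp !mxevalM !mxevalC hW hL => ->.
by rewrite /lo mx22_id phi1 mulmx1.
Qed.

(** For nonzero z the value at z is [z Q(1/z)] with [Q(0) = 1]. If it were constant in z, then
    [Q(0)] would be 0; a nonconstant polynomial takes the value 1 over a closed field. *)
Lemma semi_wx_eq k P chi g : semi_invariant k P chi -> G g -> ev P g = 1 ->
  exists z, ev P (g *m phi k (wx z)) = 1.
Proof.
move=> hP Gg Pg; have [W hW] := wx_curve k; have [L hL] := lo_curve k.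
pose A := ccomp P (map_mx (@polyC F) g *m W); pose Q := ccomp P (map_mx (@polyC F) g *m L).
have AQ c : c != 0 -> A.[c] = c * Q.[c^-1].
  move=> c0; rewrite /A /Q !horner_ccomp !mxevalM !mxevalC hW hL.
  by rewrite (semi_wx _ hP) // eqxx.
have Q0 : Q.[0] = 1.
  by rewrite /Q horner_ccomp mxevalM mxevalC hL /lo mx22_id phi1 mulmx1.
have [/size1_polyC A1|sA] := leqP (size A) 1.
  have QX : Q = A`_0 *: 'X.
    apply: poly_eq_nz => c c0; have := AQ c^-1; rewrite invr_eq0 invrK => /(_ c0).
    by rewrite A1 hornerC hornerZ hornerX coefC /= => ->; rewrite mulrAC mulVf ?mul1r.
  by move: Q0; rewrite QX hornerZ hornerX mulr0 => /eqP; rewrite eq_sym oner_eq0.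
have /closed_rootP[z] : size (A - 1) != 1%N.
  by rewrite size_addl ?size_opp ?size_poly1 // gtn_eqF.
rewrite rootE hornerD hornerN hornerC subr_eq0 => /eqP Az.
by exists z; rewrite -Az /A horner_ccomp mxevalM mxevalC hW.
Qed.

End PinnedGroup.

(** * Nonpositivity of the Cartan integers *)

Section CartanSign.

Variables (F : numClosedFieldType) (I : finType) (D : pinned_group F I).
Notation N := (pg_dim D).
Notation G := (pg_G D).
Notation T := (pg_T D).
Notation U := (pg_U D).
Notation Um := (pg_Um D).
Notation phi := (pg_phi D).
Notation alpha := (pg_alpha D).

Lemma alpha_char i : group_character T (alpha i).
Proof. by case: (pg_alpha_simple D i) => -[]. Qed.

Lemma alpha_neq0 i t : T t -> alpha i t != 0.
Proof.
move=> tT; have [_ a1 aM] := alpha_char i.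
have : alpha i (t *m invmx t) != 0.
  by rewrite mulmxV ?a1 ?oner_eq0 //; exact/pg_unit/pg_TG.
by rewrite aM ?mulf_eq0 ?negb_or; [case/andP| |exact: pg_TV].
Qed.

Variables (i j : I) (P : {mpoly F[N * N]}) (chi : 'M[F]_N -> F).
Hypothesis ij : i != j.
Hypothesis hP : semi_invariant i P chi.
Hypothesis cell_dense : forall p,
  (forall g, (exists um t u, [/\ Um um, T t, U u & g = um *m t *m u]) -> eval_mx p g = 0) ->
  forall g, G g -> eval_mx p g = 0.

Let beta t := alpha i t / alpha j t.

(** Conjugation by [t] rescales the parameter of a root subgroup; the derivative at 0 of this
    reparametrisation is the weight. *)
Lemma tangent_weights : exists e f Phi Psi,
  [/\ [/\ forall c, mxeval c Phi = phi i (up c), forall c, mxeval c Psi = phi j (lo c),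
        e = mxeval 0 (map_mx (@deriv F) Phi) & f = mxeval 0 (map_mx (@deriv F) Psi)],
      forall t, T t -> t *m e *m invmx t = alpha i t *: e
    & forall t, T t -> t *m f *m invmx t = (alpha j t)^-1 *: f].
Proof.
have [Phi hPhi] := up_curve D i; have [Psi hPsi] := lo_curve D j.
exists (mxeval 0 (map_mx (@deriv F) Phi)), (mxeval 0 (map_mx (@deriv F) Psi)), Phi, Psi.
have scale (C : 'M[{poly F}]_N) t a :
    (forall c : F, t *m mxeval c C *m invmx t = mxeval (a * c) C) ->
    t *m mxeval 0 (map_mx (@deriv F) C) *m invmx t = a *: mxeval 0 (map_mx (@deriv F) C).
  move=> h; have E : map_mx (@polyC F) t *m C *m map_mx (@polyC F) (invmx t) =
      map_mx (fun p : {poly F} => p \Po (a%:P * 'X)) C.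
    apply/matrixP => k l; apply: poly_eq_nat => m.
    have := congr1 (fun B : 'M_N => B k l) (h m%:R).
    rewrite -{1}(mxevalC m%:R t) -{1}(mxevalC m%:R (invmx t)) -!mxevalM mxE /horner_eval => ->.
    by rewrite !mxE /horner_eval horner_comp !hornerE.
  have dC (B : 'M[{poly F}]_N) (x y : 'M[F]_N) :
      mxeval 0 (map_mx (@deriv F) (map_mx (@polyC F) x *m B *m map_mx (@polyC F) y)) =
      x *m mxeval 0 (map_mx (@deriv F) B) *m y.
    apply/matrixP => k l; rewrite !mxE /horner_eval (raddf_sum (@deriv F)) horner_sum.
    apply: eq_bigr => m _; rewrite /= derivM [map_mx _ y _ _]mxE derivC mulr0 addr0.
    rewrite hornerM hornerC; congr (_ * _); rewrite !mxE (raddf_sum (@deriv F)) horner_sum.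
    apply: eq_bigr => n _; rewrite /= derivM [map_mx _ x _ _]mxE derivC mul0r add0r.
    by rewrite hornerM hornerC !mxE.
  rewrite -dC E; apply/matrixP => k l; rewrite !mxE /horner_eval deriv_comp.
  by rewrite derivM derivC derivX mul0r add0r mulr1 !hornerE horner_comp !hornerE ?mulr0 mulrC.
split; first by [].
- by move=> t tT; apply: scale => c; rewrite !hPhi; exact: pg_phi_upperJ.
- by move=> t tT; apply: scale => c; rewrite !hPsi; exact: pg_phi_lowerJ.
Qed.

Lemma beta_nontrivial : exists2 t, T t & beta t != 1.
Proof.
apply: contrapT => h; move/eqP: ij; apply; apply: (pg_alpha_inj (p := D)) => t tT.
apply/eqP/contraT => nt; case: h; exists t => //.
apply: contra nt => /eqP b1; rewrite -[alpha i t](divfK (alpha_neq0 j tT)).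
by rewrite -/(beta t) b1 mul1r.
Qed.

(** The point is that [beta] is regular: at a nonzero entry of [x] it is an entry of [t x \adj t]
    divided by [\det t] and a constant. *)
Lemma weight_vector_root x : lie_algebra (pg_B D) x -> x != 0 ->
  (forall t, T t -> t *m x *m invmx t = beta t *: x) -> root_in (pg_B D) T beta.
Proof.
move=> xB x0 xw; have [_ ai1 aiM] := alpha_char i; have [_ aj1 ajM] := alpha_char j.
split; [split=> [||s t sT tT] | exact: beta_nontrivial | by exists x].
- have /matrix0Pn[k [l xkl]] := x0.
  pose A := {mpoly F[N * N]}.
  pose B : 'M[A]_N := genmx_ F N *m map_mx (@mpolyC _ F) x *m \adj (genmx_ F N).
  exists ((x k l)^-1 *: B k l), 1%N => t tT; rewrite -evE evZ expr1.
  have -> : ev (B k l) t = (t *m x *m \adj t) k l.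
    have mapM (A1 A2 : 'M[A]_N) : map_mx (fun q => ev q t) (A1 *m A2) =
        map_mx (fun q => ev q t) A1 *m map_mx (fun q => ev q t) A2.
      apply/matrixP => a b; rewrite !mxE ev_sum; apply: eq_bigr => m _.
      by rewrite evM !mxE.
    have e : map_mx (fun q => ev q t) B = t *m x *m \adj t.
      rewrite !mapM eval_gen.
      have -> : map_mx (fun q => ev q t) (map_mx (@mpolyC _ F) x) = x.
        by apply/matrixP => a b; rewrite !mxE evC.
      congr (_ *m _).
      have -> : map_mx (fun q => ev q t) (\adj (genmx_ F N)) =
          map_mx (meval (fun m => mxvec t ord0 m)) (\adj (genmx_ F N)).
        by apply/matrixP => a b; rewrite !mxE evE.
      rewrite map_mx_adj; congr (\adj _); rewrite -[RHS](eval_gen t).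
      by apply/matrixP => a b; rewrite !mxE evE.
    by rewrite -e [RHS]mxE.
  have tu : t \in unitmx by exact/pg_unit/pg_TG.
  have := congr1 (fun C : 'M_N => C k l) (xw t tT).
  rewrite /invmx tu -scalemxAr !mxE => h.
  apply: (mulIf xkl); rewrite -h mulrAC [in RHS]mulrAC.
  rewrite -mulrA mulrCA; congr (_ * _).
  by rewrite [RHS]mulrAC mulVf ?mul1r.
- by rewrite /beta ai1 aj1 divr1.
- by rewrite /beta aiM // ajM // invfM mulrACA.
Qed.

(* A tangent vector x of U with the fewest entries, in a basis diagonalising T,
   among those acting on P like c E + c' (c != 0) is a weight vector. *)
Lemma weight_component E : (forall p, vanishes G p -> vanishes G (lam E p)) ->
  (forall t, T t -> t *m E *m invmx t = beta t *: E) ->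
  ~ vanishes G (lam E P) -> root_in (pg_B D) T beta.
Proof.
case: hP => PUm PU PT P1 _ E_lam E_w nE.
have P_U u : U u -> ev P u = 1.
  by move=> Uu; rewrite -[u]mul1mx PU //; exact: pg_1.
pose M b := exists um t, [/\ Um um, T t & b = um *m t].
have P_M b g : M b -> G g -> ev P (b *m g) = ev P b * ev P g.
  move=> [um [t [Uu Tt ->]]] Gg; have Gt := pg_TG Tt.
  rewrite -mulmxA (PUm _ _ Uu (pg_mul Gt Gg)) (PUm _ _ Uu Gt).
  have [-> _] := PT _ _ Tt Gg; rewrite -[X in ev P X * _]mulmx1.
  by have [-> _] := PT _ _ Tt (@pg_1 _ _ D); rewrite P1 mulr1.
have dens p : (forall b u, M b -> U u -> ev p (b *m u) = 0) -> vanishes G p.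
  move=> pMU g Gg; rewrite evE; apply: cell_dense Gg => _ [um [t [u [Uum Tt Uu ->]]]].
  by rewrite -evE; apply: pMU => //; exists um, t.
have [x0 [c0 [c0' [ux0 c00 x0E]]]] := @lie_transversal F N G U M (ev P) E P
   (@pg_1 _ _ D) (@pg_mul _ _ D) (@pg_UG _ _ D) (@pg_U1 _ _ D) (@pg_Umul _ _ D)
   (@pg_Uunip _ _ D) P_M P_U dens E_lam.
have [_ _ [Q Qu Qdiag]] : torus T by case: (pg_opposite D).
pose good x := lie_algebra U x /\ exists c c', c != 0 /\ forall g, G g ->
  ev (lam x P) g = c * ev (lam E P) g + c' * ev P g.
pose nz (x : 'M[F]_N) := #|[set a : 'I_N * 'I_N | (Q *m x *m invmx Q) a.1 a.2 != 0]|.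
have [x [gx xmin]] : exists x, good x /\ forall y, good y -> (nz x <= nz y)%N.
  have : good x0 by split=> //; exists c0, c0'.
  have [m] := ubnP (nz x0); elim: m (x0) => // m IH y; rewrite ltnS => ym gy.
  have [[z [gz zy]]|h] := pselect (exists z, good z /\ (nz z < nz y)%N).
    by apply: (IH z) => //; exact: leq_trans zy ym.
  exists y; split=> // z gz; rewrite leqNgt; apply/negP => zy; apply: h.
  by exists z.
have conjP y t g : (lie_algebra U y \/ y = E) -> T t -> G g ->
    ev (lam (t *m y *m invmx t) P) g = chi t * ev (lam y P) (invmx t *m g).
  move=> hy tT Gg; have tu : t \in unitmx by exact/pg_unit/pg_TG.
  rewrite lam_conj //; have Gt : G (invmx t *m g) by apply: pg_mul => //; exact/pg_TG/pg_TV.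
  have : vanishes G (lam y (ltrans t P - chi t *: P)).
    have v : vanishes G (ltrans t P - chi t *: P).
      move=> h Gh; rewrite evB evZ eval_ltrans; have [-> _] := PT _ _ tT Gh.
      by rewrite subrr.
    case: hy => [uy|->]; last exact: E_lam.
    by apply: (lie_vanishes (H := U)) => // u h Uu Gh; apply: pg_mul => //; exact: pg_UG.
  by move=> /(_ _ Gt); rewrite lamB lamZ evB evZ => /eqP; rewrite subr_eq0 => /eqP.
have lieJ y t : lie_algebra U y -> T t -> lie_algebra U (t *m y *m invmx t).
  move=> /lie_algebraE uy tT; have tu : t \in unitmx by exact/pg_unit/pg_TG.
  apply/lie_algebraE => p pU; rewrite lam_conj // mulmx1 -[invmx t]mul1mx -eval_rtrans.
  rewrite -lam_rtrans; apply: uy => u Uu; rewrite eval_rtrans eval_ltrans mulmxA.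
  by apply: pU; exact: pg_UJ.
have conjx y c c' t : lie_algebra U y -> T t -> (forall g, G g ->
     ev (lam y P) g = c * ev (lam E P) g + c' * ev P g) -> forall g, G g ->
     ev (lam (t *m y *m invmx t) P) g = c * beta t * ev (lam E P) g + c' * ev P g.
  move=> uy tT yE g Gg; rewrite conjP //; last by left.
  have Gt : G (invmx t *m g) by apply: pg_mul => //; exact/pg_TG/pg_TV.
  have tu : t \in unitmx by exact/pg_unit/pg_TG.
  have := @conjP E t g (or_intror erefl) tT Gg; rewrite E_w // -[beta t *: E]addr0 lam_linear.
  rewrite lam0l addr0 evZ => e1; have [e2 _] := PT _ _ tT Gt.
  by rewrite yE // mulrDr mulrCA -e1 [chi t * (c' * _)]mulrCA -e2 mulmxA mulmxV // mul1mx mulrA.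
have [ux [c [c' [cn0 xE]]]] := gx.
have xw t : T t -> t *m x *m invmx t = beta t *: x.
  move=> tT; have tu : t \in unitmx by exact/pg_unit/pg_TG.
  pose X := Q *m x *m invmx Q.
  pose dt := Q *m t *m invmx Q; pose dti := Q *m invmx t *m invmx Q.
  have /is_diag_mxP dtP := Qdiag t tT.
  have /is_diag_mxP dtiP := Qdiag (invmx t) (pg_TV tT).
  have conjE y : Q *m (t *m y *m invmx t) *m invmx Q = dt *m (Q *m y *m invmx Q) *m dti.
    by rewrite /dt /dti !mulmxA !mulmxKV.
  have entry (Y : 'M[F]_N) a b : (dt *m Y *m dti) a b = dt a a * dti b b * Y a b.
    rewrite mxE (bigD1 b) //= big1 ?addr0 => [|m mb]; last first.
      by rewrite [dti m b]dtiP ?mulr0.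
    rewrite mxE (bigD1 a) //= big1 ?addr0 => [|m ma]; last first.
      by rewrite [dt a m]dtP ?mul0r // eq_sym.
    by rewrite mulrAC.
  have wX a b : X a b != 0 -> dt a a * dti b b = beta t.
    (* Subtracting [s] times [x] from its conjugate removes the entry [(a, b)] and creates none. As
       [s] differs from [beta t], the coefficient of [E] stays nonzero, against minimality. *)
    move=> Xab; apply/eqP/contraT => nb; pose s := dt a a * dti b b.
    pose y := - s *: x + t *m x *m invmx t.
    have gy : good y.
      split; first by apply: lie_lin => //; exact: lieJ.
      exists (c * (beta t - s)), (c' * (1 - s)); split.
        by rewrite mulf_neq0 // subr_eq0 eq_sym.
      move=> g Gg; rewrite lam_linear evD evZ (conjx x c c' t ux tT xE g Gg) (xE g Gg).
      by ring.
    have := xmin y gy; rewrite leqNgt => /negP[]; apply: proper_card.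
    have yE k l : (Q *m y *m invmx Q) k l = (dt k k * dti l l - s) * X k l.
      rewrite /y mulmxDr mulmxDl conjE -scalemxAr -scalemxAl mxE entry mxE -/X.
      by ring.
    apply/properP; split.
      apply/subsetP => -[k l]; rewrite !inE /= yE -/X => h; apply: contra h => /eqP ->.
      by rewrite mulr0.
    by exists (a, b); rewrite !inE /= ?yE -/X // subrr mul0r eqxx.
  apply: (can_inj (mulKmx Qu)); apply: (can_inj (mulmxK (_ : invmx Q \in unitmx))).
    by rewrite unitmx_inv.
  rewrite conjE; apply/matrixP => a b; rewrite entry -scalemxAr -scalemxAl [RHS]mxE -/X.
  by have [->|/wX ->] := eqVneq (X a b) 0; rewrite ?mulr0.
apply: (weight_vector_root (x := x)) => //.
  apply/lie_algebraE => p pB; move/lie_algebraE: ux; apply=> u Uu.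
  by apply: pB; exact: pg_UB.
(* With [x = 0], the relations for [x] and for its conjugate by some [t] with [beta t != 1] differ
   by a nonzero multiple of [lam E P], which must then vanish. *)
apply/eqP => x_0; apply: nE => g Gg.
have [t tT bt] := beta_nontrivial.
have := conjx x c c' t ux tT xE g Gg; have := xE g Gg.
rewrite x_0 mulmx0 mul0mx => -> /eqP; rewrite (inj_eq (addIr _)) -subr_eq0 -mulrBl.
rewrite mulf_eq0 -[X in X - _]mulr1 -mulrBr mulf_eq0 (negPf cn0) subr_eq0 eq_sym.
by rewrite (negPf bt) => /eqP.
Qed.

Lemma cartan_nonpos (a : int) :
  (forall x, x != 0 -> alpha i (coroot D j x) = x ^ a) -> a <= 0.
Proof.
move=> aE; rewrite leNgt; apply/negP => a0.
have [n an] : exists n, a = n.+1%:Z by case: a a0 {aE} => [[|n]|] // _; exists n.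
move: aE; rewrite {a a0}an => aE.
case: (hP) => PUm PU PT P1 chiE.
have [e [f [Phi [Psi [[hPhi hPsi eE fE] eJ fJ]]]]] := tangent_weights.
have Sup x := @SL2_up F x; have Slo x := @SL2_lo F x; have Swx x := @SL2_wx F x.
have Gup k x : G (phi k (up x)) by exact: phiG.
have Glo k x : G (phi k (lo x)) by exact: phiG.
have Phi0 : mxeval 0 Phi = 1%:M by rewrite hPhi /up mx22_id phi1.
have Psi0 : mxeval 0 Psi = 1%:M by rewrite hPsi /lo mx22_id phi1.
have e_lam p : vanishes G p -> vanishes G (lam e p).
  by rewrite eE; apply: curve_lam => //; [exact: pg_mul | move=> c; rewrite hPhi].
have f_lam p : vanishes G p -> vanishes G (lam f p).
  by rewrite fE; apply: curve_lam => //; [exact: pg_mul | move=> c; rewrite hPsi].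
pose E := e *m f - f *m e; pose l := lam e P.
have lamE p : lam E p = lam f (lam e p) - lam e (lam f p) by rewrite lam_comm.
have fP0 : vanishes G (lam f P).
  move=> g Gg; rewrite -(deriv_curve _ _ Psi0 fE).
  rewrite (_ : ccomp _ _ = (ev P g)%:P) ?derivC ?horner0 //.
  apply: poly_eq_nat => k; rewrite hornerC horner_ccomp mxevalM mxevalC hPsi.
  by rewrite PUm //; exact: pg_phi_lower.
have lT t g : T t -> G g -> ev l (t *m g) = chi t / alpha i t * ev l g.
  move=> tT Gg; have tu : t \in unitmx by exact/pg_unit/pg_TG.
  have Gtg : G (t *m g) by apply: pg_mul => //; exact: pg_TG.
  have := lam_conj e (t *m g) P tu; rewrite eJ // -[alpha i t *: e]addr0 lam_linear lam0l addr0 evZ.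
  rewrite mulKmx // => h; apply: (mulfI (alpha_neq0 i tT)); rewrite h.
  have : vanishes G (lam e (ltrans t P - chi t *: P)).
    apply: e_lam => h' Gh; rewrite evB evZ eval_ltrans.
    by have [-> _] := PT _ _ tT Gh; rewrite subrr.
  move=> /(_ _ Gg); rewrite lamB lamZ evB evZ => /eqP; rewrite subr_eq0 => /eqP ->.
  by rewrite mulrA [_ * (_ / _)]mulrC divfK ?alpha_neq0.
have EJ t : T t -> t *m E *m invmx t = beta t *: E.
  move=> tT; have tu : t \in unitmx by exact/pg_unit/pg_TG.
  have conjM (x y : 'M[F]_N) : t *m (x *m y) *m invmx t =
      (t *m x *m invmx t) *m (t *m y *m invmx t) by rewrite !mulmxA mulmxKV.
  rewrite /E mulmxBr mulmxBl !conjM eJ // fJ // -!scalemxAl -!scalemxAr !scalerA.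
  by rewrite [_^-1 * _]mulrC -scalerBr.
have E_lam p : vanishes G p -> vanishes G (lam E p).
  by move=> pG g Gg; rewrite lamE evB f_lam ?e_lam ?subrr //; [exact: f_lam|exact: e_lam].
have [EP|nE] := pselect (vanishes G (lam E P)); last first.
  (* Here [beta] is a root of [B], so [alpha i = alpha j * beta] would be decomposable. *)
  have b_root := weight_component E_lam EJ nE.
  have [_ /(_ _ _ (proj1 (pg_alpha_simple D j)) b_root)] := pg_alpha_simple D i.
  by apply=> t tT; rewrite /beta mulrC divfK // alpha_neq0.
have lf0 : vanishes G (lam f l).
  by move=> g Gg; have := EP g Gg; rewrite lamE evB (e_lam _ fP0) // subr0.
have PsiD c d : mxeval (c + d) Psi = mxeval c Psi *m mxeval d Psi.
  by rewrite !hPsi loD phiM.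
have lY c g : G g -> ev l (phi j (lo c) *m g) = ev l g.
  move=> Gg; have dPsi := one_param_deriv PsiD.
  have := deriv0_const (p := ccomp l (Psi *m map_mx (@polyC F) g)).
  rewrite (@deriv_ccomp_lam _ _ l _ f); last first.
    rewrite mulmxA fE -dPsi; apply/matrixP => k m.
    rewrite !mxE (raddf_sum (@deriv F)); apply: eq_bigr => q _.
    by rewrite /= derivM !mxE derivC mulr0 addr0.
  have -> : ccomp (lam f l) (Psi *m map_mx (@polyC F) g) = 0.
    apply: poly_eq_nat => k; rewrite horner0 horner_ccomp mxevalM mxevalC hPsi.
    by apply: lf0; exact: pg_mul.
  by move=> /(_ erefl c); rewrite !horner_ccomp !mxevalM !mxevalC hPsi Psi0 mul1mx.
have l0 g : G g -> ev l g = 0.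
  move=> Gg; have [W hW] := wx_curve D j; have [V hV] := up_curve D j.
  pose A := ccomp l (W *m map_mx (@polyC F) g).
  pose B := ccomp l (V *m map_mx (@polyC F) g).
  (* The factor [dg z] acts on [l] through [chi / alpha i], that is, by [z^-(n+1)], because [chi] is
     trivial on the coroot of [j != i]. *)
  have AB z : z != 0 -> z ^+ n.+1 * A.[z] = (B \Po (- 'X)).[z^-1].
    move=> z0; rewrite horner_comp hornerN hornerX /A /B !horner_ccomp !mxevalM !mxevalC hW hV.
    have Sdg := SL2_dg z0.
    rewrite wx_decomp // !phiM //; last exact: SL2M.
    have Gu : G (phi j (up (- z^-1)) *m g) by exact: pg_mul.
    have Td : T (phi j (dg z)) by exact: pg_phi_diag.
    rewrite -!mulmxA lY; last by apply: pg_mul => //; exact: pg_TG.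
    rewrite lT // [chi _](chiE j z z0) [alpha i _](aE z z0) eq_sym (negPf ij) div1r.
    by rewrite mulrA mulfV ?mul1r // expf_neq0.
  have B0 := zero_of_inv_pole AB.
  have := congr1 (fun p : {poly F} => p.[0]) B0.
  rewrite horner_comp hornerN hornerX oppr0 horner0 /B horner_ccomp mxevalM mxevalC hV.
  by rewrite /up mx22_id phi1 mul1mx.
(* But the value of [P] at [phi i (up t *m lo 1)] is [t + 1], whose derivative at 0 is 1. *)
have := deriv_curve P (phi i (lo 1)) Phi0 eE; rewrite -/l l0 //.
suff -> : ccomp P (Phi *m map_mx (@polyC F) (phi i (lo 1))) = 'X + 1%:P.
  by rewrite derivD derivX derivC addr0 hornerC => /eqP; rewrite oner_eq0.
apply: poly_eq_nat => k; rewrite horner_ccomp mxevalM mxevalC hPhi !hornerE -phiM //.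
have k1 : 1 + k%:R * 1 != 0 :> F by rewrite mulr1 nat1r pnatr_eq0.
rewrite up_lo // !phiM //; try by do ?apply: SL2M => //; exact: SL2_dg.
have Td : T (phi i (dg (1 + k%:R * 1))) by exact: pg_phi_diag.
rewrite PU; [|exact: pg_phi_upper|by apply: pg_mul => //; exact: pg_TG].
rewrite PUm; [|exact: pg_phi_lower|exact: pg_TG].
rewrite -[phi i (dg _)]mulmx1; have [-> _] := PT _ _ Td (@pg_1 _ _ D).
by rewrite [chi _](chiE i _ k1) eqxx P1 !mulr1 addrC.
Qed.

End CartanSign.

(** * Mutation of positive seeds *)

Section PositiveSeeds.

Variables (K : fieldType) (r : nat) (pos : K -> Prop).
Implicit Types (s : seed K r) (j k : 'I_r).

(** Models positivity at a point: closed under the operations of a mutation and avoiding 0, such a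
    set keeps all cluster variables invertible. *)
Definition positive_cone :=
  [/\ pos 1, forall x y, pos x -> pos y -> pos (x + y),
      forall x y, pos x -> pos y -> pos (x * y), forall x, pos x -> pos x^-1
    & ~ pos 0].

Definition good_seed s :=
  [/\ forall j, pos (cluster s j), forall j, 0 < symd s j
    & forall j k, symd s j * exch s j k = - (symd s k * exch s k j)].

(** The usual correction term [(|a| b + a |b|) / 2] of matrix mutation. *)
Definition exch_term (a b : rat) : rat :=
  if (0 < a) && (0 < b) then a * b else if (a < 0) && (b < 0) then - (a * b) else 0.

Lemma mutate_exchE k (e : 'M[rat]_r) i j : mutate_exch k e i j =
  if (k == i) || (k == j) then - e i j else e i j + exch_term (e i k) (e k j).
Proof. by rewrite mxE /exch_term; do ![case: ifP => _] => //; rewrite addr0. Qed.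

Lemma exch_term0r a : exch_term a 0 = 0.
Proof. by rewrite /exch_term ltxx !andbF. Qed.

Lemma exch_term0l b : exch_term 0 b = 0.
Proof. by rewrite /exch_term ltxx. Qed.

Lemma exch_termN a b : exch_term (- a) (- b) = - exch_term a b.
Proof.
rewrite /exch_term !oppr_gt0 !oppr_lt0 mulrNN.
by case: ltgtP => _; case: ltgtP => _ //=; rewrite ?opprK ?oppr0.
Qed.

(* Both sides vanish unless a and b are nonzero of the same sign. *)
Lemma exch_term_skew (a b a' b' x y z : rat) : 0 < x -> 0 < y -> 0 < z ->
  x * a = - (z * a') -> z * b = - (y * b') ->
  x * exch_term a b = - (y * exch_term b' a').
Proof.
move=> x0 y0 z0 ha hb; have nx := lt0r_neq0 x0; have ny := lt0r_neq0 y0.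
have aE : a = - (z / x * a') by rewrite -[a](mulKf nx) ha mulrN mulrCA mulrA.
have bE : b' = - (z / y * b).
  by rewrite -[b'](mulKf ny) -[y * b']opprK -hb mulrN mulrCA mulrA.
have zx : 0 < z / x by rewrite divr_gt0.
have zy : 0 < z / y by rewrite divr_gt0.
rewrite /exch_term aE bE !oppr_gt0 !oppr_lt0.
rewrite (pmulr_rlt0 _ zx) (pmulr_rlt0 _ zy) (pmulr_rgt0 _ zx) (pmulr_rgt0 _ zy).
have e : x * (z / x * a' * b) = y * (z / y * b * a').
  by field; rewrite nx ny.
by case: (ltgtP a' 0) => _ //=; case: (ltgtP b 0) => _ //=;
  rewrite ?mulr0 ?oppr0 // !mulNr ?opprK ?mulrN ?opprK e.
Qed.

Lemma exch_diag0 s k : good_seed s -> exch s k k = 0.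
Proof.
case=> _ d0 sk; have := sk k k; move/eqP; rewrite -addr_eq0 -mulr2n mulrn_eq0 /=.
by rewrite mulf_eq0 gt_eqF //= => /eqP.
Qed.

Lemma exch0_sym s j k : good_seed s -> exch s j k = 0 -> exch s k j = 0.
Proof.
case=> _ d0 sk e0; have := sk j k; rewrite e0 mulr0 => /eqP.
by rewrite eq_sym oppr_eq0 mulf_eq0 gt_eqF //= => /eqP.
Qed.

Definition exch_poly s k : K :=
  \prod_(j | exch s j k < 0) cluster s j ^ numq (- exch s j k)
  + \prod_(j | 0 < exch s j k) cluster s j ^ numq (exch s j k).

Lemma cluster_mutate k s j :
  cluster (mutate k s) j = if j == k then exch_poly s k / cluster s k else cluster s j.
Proof. by rewrite ffunE. Qed.

Lemma exch_poly_eq s s' k : (forall x, exch s' x k = exch s x k) ->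
  (forall x, exch s x k != 0 -> cluster s' x = cluster s x) -> exch_poly s' k = exch_poly s k.
Proof.
move=> hE hA; rewrite /exch_poly; congr (_ + _); apply: eq_big => x; rewrite ?hE //.
  by move=> xk; rewrite hA // lt_eqF.
by move=> xk; rewrite hA // gt_eqF.
Qed.

(** A sign change of the column swaps the two monomials of the exchange polynomial. *)
Lemma exch_poly_opp s s' k : (forall x, exch s' x k = - exch s x k) ->
  (forall x, exch s x k != 0 -> cluster s' x = cluster s x) -> exch_poly s' k = exch_poly s k.
Proof.
move=> hE hA; rewrite /exch_poly addrC; congr (_ + _); apply: eq_big => x;
  rewrite ?hE ?oppr_gt0 ?oppr_lt0 // => xk; rewrite hA ?opprK //.
  by rewrite lt_eqF.
by rewrite gt_eqF.
Qed.

Lemma seed_eq s s' : cluster s = cluster s' -> frozen s = frozen s' ->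
  exch s = exch s' -> symd s = symd s' -> s = s'.
Proof. by case: s s' => [A f e d] [A' f' e' d'] /= -> -> -> ->. Qed.

Hypothesis cone : positive_cone.

Lemma pos_neq0 x : pos x -> x != 0.
Proof. by case: cone => _ _ _ _ n0 px; apply/eqP => x0; apply: n0; rewrite -x0. Qed.

Lemma pos_exprz x (z : int) : pos x -> pos (x ^ z).
Proof.
case: cone => p1 _ pM pV _ px.
have pn n : pos (x ^+ n) by elim: n => [|n IH]; rewrite ?expr0 // exprS; exact: pM.
by case: z => n; [exact: pn | apply: pV; exact: pn].
Qed.

Lemma pos_exch_poly s k : good_seed s -> pos (exch_poly s k).
Proof.
case: cone => p1 pD pM _ _ [pA _ _]; apply: pD; elim/big_ind: _ => // j _; exact: pos_exprz.
Qed.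

Lemma mutate_good k s : good_seed s -> good_seed (mutate k s).
Proof.
move=> gs; case: (gs) => pA d0 sk; split=> [j|//|i j].
  rewrite cluster_mutate; case: ifP => // _; case: cone => _ _ pM pV _.
  by apply: pM; [exact: pos_exch_poly | exact: pV].
rewrite /= !mutate_exchE [(k == j) || _]orbC; case: ifP => _.
  by rewrite !mulrN sk.
by rewrite !mulrDr opprD sk; congr (_ + _); exact: (exch_term_skew (z := symd s k)).
Qed.

(** Mutation negates column [k] and keeps the neighbours of [k], so the exchange polynomial [p] is
    the same both times and [A_k] becomes [p / (p / A_k)], with nonzero denominators by
    positivity. *)
Lemma mutate_involutive k s : good_seed s -> mutate k (mutate k s) = s.
Proof.
move=> gs; have ek := exch_diag0 k gs.
have colk x : exch (mutate k s) x k = - exch s x k by rewrite /= mutate_exchE eqxx orbT.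
have pE : exch_poly (mutate k s) k = exch_poly s k.
  apply: exch_poly_opp => // x; rewrite cluster_mutate.
  by have [->|//] := eqVneq x k; rewrite ek eqxx.
case: (gs) => pA _ _.
suff [hA hE] : cluster (mutate k (mutate k s)) = cluster s /\ exch (mutate k (mutate k s)) = exch s.
  exact: seed_eq.
split.
  apply/ffunP => j; rewrite cluster_mutate pE !cluster_mutate eqxx.
  have [->|//] := eqVneq j k.
  by rewrite invfM invrK mulrA mulfV ?mul1r // pos_neq0 //; exact: pos_exch_poly.
apply/matrixP => i j; rewrite /= !mutate_exchE !eqxx ?orbT /=.
have [->|ki] := eqVneq k i; first by rewrite /= opprK.
have [->|kj] /= := eqVneq k j; first by rewrite opprK.
by rewrite exch_termN addrK.
Qed.

(** Without an arrow between them, each mutation preserves the row, the column and the exchange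
    polynomial of the other vertex, so the matrix corrections simply add up. *)
Lemma mutate_commute j k s : good_seed s -> exch s j k = 0 ->
  mutate j (mutate k s) = mutate k (mutate j s).
Proof.
move=> gs jk0; have kj0 := exch0_sym gs jk0.
have [->//|jk] := eqVneq j k.
have col (x y : 'I_r) : x != y -> exch s x y = 0 -> exch s y x = 0 ->
    (forall z, exch (mutate x s) z y = exch s z y) /\
    (forall z, exch (mutate x s) y z = exch s y z).
  move=> /negPf xy exy eyx; split=> z; rewrite /= mutate_exchE xy ?orbF.
    by case: eqVneq => [<-|_]; rewrite exy ?oppr0 // exch_term0r addr0.
  by case: eqVneq => [<-|_]; rewrite eyx ?oppr0 // exch_term0l addr0.
have kj : k != j by rewrite eq_sym.
suff [hA hE] : cluster (mutate j (mutate k s)) = cluster (mutate k (mutate j s)) /\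
               exch (mutate j (mutate k s)) = exch (mutate k (mutate j s)).
  exact: seed_eq.
have pj : exch_poly (mutate k s) j = exch_poly s j.
  apply: exch_poly_eq => [z|z]; first by have [-> _] := col _ _ kj kj0 jk0.
  by rewrite cluster_mutate; have [->|//] := eqVneq z k; rewrite kj0 eqxx.
have pk : exch_poly (mutate j s) k = exch_poly s k.
  apply: exch_poly_eq => [z|z]; first by have [-> _] := col _ _ jk jk0 kj0.
  by rewrite cluster_mutate; have [->|//] := eqVneq z j; rewrite jk0 eqxx.
split.
  apply/ffunP => x; rewrite !cluster_mutate pj pk (negPf jk) (negPf kj).
  by have [->|//] := eqVneq x j; rewrite (negPf jk).
apply/matrixP => x y.
have [cj rj] := col _ _ jk jk0 kj0; have [ck rk] := col _ _ kj kj0 jk0.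
rewrite [LHS]mutate_exchE [RHS]mutate_exchE !cj !rj !ck !rk /= !mutate_exchE.
case: ifP => hj; case: ifP => hk //=; last by ring.
  by case/orP: hj => /eqP <-; rewrite ?jk0 ?kj0 ?exch_term0l ?exch_term0r !addr0.
by case/orP: hk => /eqP <-; rewrite ?jk0 ?kj0 ?exch_term0l ?exch_term0r !addr0.
Qed.

End PositiveSeeds.

(** * Double words *)

Section Vertices.

Variables (I : finType) (w : seq I).
Implicit Types (j k : 'I_(size w)).

Lemma take_letter j : take j.+1 w = rcons (take j w) (letter j).
Proof.
by rewrite (take_nth (letter j)) //; congr rcons; rewrite [RHS](tnth_nth (letter j)).
Qed.

Lemma occE j : occ j = (count_mem (letter j) (take j w)).+1.
Proof. by rewrite /occ take_letter -cats1 count_cat /= eqxx addn0 addn1. Qed.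

Lemma count_take_le (p : pred I) m n : (m <= n)%N -> (count p (take m w) <= count p (take n w))%N.
Proof. by move=> mn; rewrite -(subnKC mn) takeD count_cat leq_addr. Qed.

Lemma vertex_inj : injective (@vertex I w).
Proof.
have lt j k : (j < k)%N -> vertex j <> vertex k.
  move=> jk [lE]; rewrite (occE k) /occ lE => e.
  by have := count_take_le (pred1 (letter k)) jk; rewrite e ltnn.
move=> j k e; apply/val_inj/eqP; case: ltngtP => // jk; first by case: (lt _ _ jk).
by case: (lt _ _ jk).
Qed.

Lemma vertex_ex i l : (0 < l <= count_mem i w)%N -> exists j, vertex j = (i, l).
Proof.
move=> /andP[l0 lw]; have ex : exists n, (l <= count_mem i (take n w))%N.
  by exists (size w); rewrite take_size.
case: (ex_minnP ex) => n ln nmin; case: n ln nmin => [|n] ln nmin.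
  by rewrite take0 /= leqNgt l0 in ln.
have nw : (n < size w)%N.
  rewrite ltnNge; apply/negP => wn; have := nmin n; rewrite ltnn.
  by rewrite !take_oversize // in ln *; [move=> /(_ ln) | exact: leqW].
pose j := Ordinal nw; exists j.
have lj : (count_mem i (take j w) < l)%N.
  by rewrite ltnNge; apply/negP => /nmin; rewrite ltnn.
move: ln; rewrite (take_letter j) -cats1 count_cat /= addn0.
have [e|_] := eqVneq (letter j) i; last by rewrite addn0 leqNgt lj.
rewrite /vertex occE e /= addn1 => ln; congr pair.
by apply/eqP; rewrite eqn_leq lj ln.
Qed.

Variable K : fieldType.
Implicit Types (s : seed K (size w)) (x : I * nat) (L : seq (I * nat)).

Lemma mutate_vertexE s j : mutate_vertex s (vertex j) = mutate j s.
Proof.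
rewrite /mutate_vertex; case: pickP => [k /eqP/vertex_inj -> //|/(_ j)].
by rewrite eqxx.
Qed.

(** A label that is no vertex of [w] acts as the identity, so labels can be handled without checking
    that they occur. *)
Lemma mutate_vertexP s x : (exists2 j, vertex j = x & mutate_vertex s x = mutate j s) \/
  forall s', mutate_vertex s' x = s'.
Proof.
have [[j <-]|nj] := pselect (exists j, vertex j = x).
  by left; exists j; rewrite ?mutate_vertexE.
right=> s'; rewrite /mutate_vertex; case: pickP => // j /eqP e.
by case: nj; exists j.
Qed.

Lemma mutate_seq_cat L1 L2 s : mutate_seq (L1 ++ L2) s = mutate_seq L2 (mutate_seq L1 s).
Proof. exact: foldl_cat. Qed.

Variable pos : K -> Prop.
Hypothesis cone : positive_cone pos.

Lemma mutate_vertex_good s x : good_seed pos s -> good_seed pos (mutate_vertex s x).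
Proof.
by move=> gs; case: (mutate_vertexP s x) => [[j _ ->]|->] //; exact: mutate_good.
Qed.

Lemma mutate_seq_good L s : good_seed pos s -> good_seed pos (mutate_seq L s).
Proof. by elim: L s => //= x L IH s gs; apply: IH; exact: mutate_vertex_good. Qed.

Lemma mutate_vertexK s x : good_seed pos s -> mutate_vertex (mutate_vertex s x) x = s.
Proof.
move=> gs; case: (mutate_vertexP s x) => [[j <- _]|h]; last by rewrite !h.
by rewrite !mutate_vertexE (mutate_involutive cone).
Qed.

Lemma mutate_seqK L s : good_seed pos s -> mutate_seq (rev L) (mutate_seq L s) = s.
Proof.
elim: L s => //= x L IH s gs; rewrite rev_cons -cats1 mutate_seq_cat.
rewrite -/(mutate_seq L _) IH; last exact: mutate_vertex_good.
exact: mutate_vertexK.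
Qed.

Lemma mutate_seqVK L s : good_seed pos s -> mutate_seq L (mutate_seq (rev L) s) = s.
Proof. by move=> gs; rewrite -{1}(revK L) mutate_seqK. Qed.

End Vertices.

(** * Signed crossings of intervals *)

Section DoubleWords.

Variables (I : finType) (a : I -> I -> int).
Hypothesis a_nonpos : forall i j, i != j -> a i j <= 0.

Definition add_occ (b : I -> nat) (i : I) : I -> nat := fun k => (b k + (i == k))%N.

Definition occs (b : I -> nat) (V : seq (I * bool)) : I -> nat :=
  fun i => (b i + count_mem i (map fst V))%N.

Definition sgr (sigma : bool) : rat := if sigma then 1 else -1.

(* The vertex (i, l) is viewed as the interval of gaps of V between the l-th and
   the next occurrence of i; b counts the letters already read. *)
Definition ind (b : I -> nat) (x : I * nat) : rat := (b x.1 == x.2)%:R.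

(** Each letter contributes, with its sign, the determinant of the two indicators before and after
    it; hence skewness and additivity under concatenation. *)
Fixpoint crossing (b : I -> nat) (V : seq (I * bool)) (x y : I * nat) : rat :=
  if V is (i, sigma) :: V' then
    sgr sigma * (ind (add_occ b i) x * ind b y - ind b x * ind (add_occ b i) y)
    + crossing (add_occ b i) V' x y
  else 0.

(** The 2 is the diagonal Cartan integer; the swapped arguments of [a] follow the convention in the
    entries of [word_exch]. *)
Definition weight (x y : I * nat) : rat :=
  if x.1 == y.1 then 2 else (a y.1 x.1)%:~R.

Lemma occs_cons b l V : occs b (l :: V) = occs (add_occ b l.1) V.
Proof. by apply: funext => i; rewrite /occs /add_occ /= addnA. Qed.

Lemma occs_cat b X Y : occs b (X ++ Y) = occs (occs b X) Y.
Proof. by apply: funext => i; rewrite /occs map_cat count_cat addnA. Qed.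

Lemma occs_le b V i : (b i <= occs b V i)%N.
Proof. exact: leq_addr. Qed.

Lemma crossing_cat b X Y x y :
  crossing b (X ++ Y) x y = crossing b X x y + crossing (occs b X) Y x y.
Proof.
elim: X b => [|[i sigma] X IH] b /=.
  by rewrite add0r; congr (crossing _ Y x y); apply: funext => k; rewrite /occs addn0.
by rewrite IH occs_cons addrA.
Qed.

Lemma crossing_skew b V x y : crossing b V y x = - crossing b V x y.
Proof.
elim: V b => [|[i sigma] V IH] b /=; first by rewrite oppr0.
by rewrite IH; ring.
Qed.

Lemma ind0 b x : b x.1 != x.2 -> ind b x = 0.
Proof. by rewrite /ind => /negPf ->. Qed.

Lemma crossing_low b V x y : (x.2 < b x.1)%N -> crossing b V x y = 0.
Proof.
elim: V b => // -[i sigma] V IH b xb /=.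
have xb' : (x.2 < add_occ b i x.1)%N by rewrite (leq_trans xb) // leq_addr.
by rewrite IH // !(@ind0 _ x) ?gtn_eqF // !mul0r subrr mulr0 addr0.
Qed.

Lemma crossing_high b V x y : (occs b V x.1 < x.2)%N -> crossing b V x y = 0.
Proof.
elim: V b => // -[i sigma] V IH b; rewrite occs_cons => xb /=.
have xb' : (add_occ b i x.1 < x.2)%N by rewrite (leq_ltn_trans (occs_le _ _ _) xb).
have xb2 : (b x.1 < x.2)%N by rewrite (leq_ltn_trans _ xb') // leq_addr.
by rewrite IH // !(@ind0 _ x) ?ltn_eqF // !mul0r subrr mulr0 addr0.
Qed.

Lemma occs_swap b l l' Y : occs b (l :: l' :: Y) = occs b (l' :: l :: Y).
Proof. by apply: funext => i; rewrite /occs /=; lia. Qed.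

(** If [x] and [y] carry the letters [i] and [k], the middle gap cancels in either order because the
    signs are opposite, and only the products of indicators at the two outer gaps remain. In all
    other cases the two letters do not interact. *)
Lemma crossing_swap_neq b i k sigma x y : i != k ->
  crossing b [:: (i, sigma); (k, ~~ sigma)] x y =
  crossing b [:: (k, ~~ sigma); (i, sigma)] x y.
Proof.
move=> ik /=; rewrite !addr0.
have -> : sgr (~~ sigma) = - sgr sigma by case: (sigma) => /=; rewrite ?opprK.
have indE (z : I * nat) : ind (add_occ (add_occ b i) k) z = ind (add_occ (add_occ b k) i) z.
  by rewrite /ind /add_occ addnAC.
have ci (z : I * nat) : z.1 != i -> ind (add_occ b i) z = ind b z /\
    ind (add_occ (add_occ b k) i) z = ind (add_occ b k) z.
  by move=> zi; rewrite /ind /add_occ [i == _]eq_sym (negPf zi) !addn0.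
have ck (z : I * nat) : z.1 != k -> ind (add_occ b k) z = ind b z /\
    ind (add_occ (add_occ b k) i) z = ind (add_occ b i) z.
  by move=> zk; rewrite -indE /ind /add_occ [k == _]eq_sym (negPf zk) !addn0.
rewrite !indE.
have [xi|xi] := eqVneq x.1 i; have [yi|yi] := eqVneq y.1 i.
- have [-> ->] := ck x (eq_ind_r (fun z => z != k) ik xi).
  by have [-> ->] := ck y (eq_ind_r (fun z => z != k) ik yi); ring.
- have [-> ->] := ck x (eq_ind_r (fun z => z != k) ik xi).
  by have [-> ->] := ci y yi; ring.
- have [-> ->] := ck y (eq_ind_r (fun z => z != k) ik yi).
  by have [-> ->] := ci x xi; ring.
- by have [-> ->] := ci x xi; have [-> ->] := ci y yi; ring.
Qed.

Lemma exch_term_opp sigma (A B : rat) : 0 <= A -> 0 <= B ->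
  exch_term (sgr sigma * A) (- (sgr sigma * B)) = 0.
Proof.
move=> A0 B0; rewrite /exch_term; case: sigma; rewrite /sgr ?mulN1r ?mul1r ?opprK ?oppr_gt0 ?oppr_lt0.
  by rewrite [B < 0]ltNge B0 andbF [A < 0]ltNge A0.
by rewrite [A < 0]ltNge A0 [B < 0]ltNge B0 andbF.
Qed.

Lemma exch_term_same sigma (A B : rat) : 0 <= A -> 0 <= B ->
  exch_term (sgr sigma * A) (sgr sigma * B) = sgr sigma * (A * B).
Proof.
move=> A0 B0; rewrite /exch_term.
have [A_eq|Ap] := eqVneq A 0; first by rewrite A_eq mulr0 ltxx !mul0r mulr0.
have [B_eq|Bp] := eqVneq B 0; first by rewrite B_eq !mulr0 ltxx !andbF.
have {Ap}A1 : 0 < A by rewrite lt0r Ap.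
have {Bp}B1 : 0 < B by rewrite lt0r Bp.
case: sigma; rewrite /sgr ?mulN1r ?mul1r ?A1 ?B1 //.
by rewrite !oppr_gt0 !oppr_lt0 A1 B1 [A < 0]ltNge A0 mulrNN.
Qed.

(* Local form of the mutation at the short interval p between two adjacent
   occurrences of i with opposite signs. *)
Lemma crossing_mutate b i sigma x y (p := (i, (b i).+1)) :
  let V := [:: (i, sigma); (i, ~~ sigma)] in x <> p -> y <> p ->
  exch_term (weight x p / 2 * crossing b V x p) (weight p y / 2 * crossing b V p y) =
  - (weight x y * crossing b V x y).
Proof.
move=> V xp yp; rewrite /V /= !addr0.
have -> : sgr (~~ sigma) = - sgr sigma by case: (sigma) => /=; rewrite ?opprK.
have p0 : ind b p = 0 by rewrite ind0 //= ltn_eqF.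
have p1 : ind (add_occ b i) p = 1 by rewrite /ind /add_occ /= eqxx addn1 eqxx.
have p2 : ind (add_occ (add_occ b i) i) p = 0 by rewrite ind0 //= /add_occ eqxx !addn1 gtn_eqF.
rewrite p0 p1 p2 !mulr0 !mulr1 !mul0r !mul1r !sub0r !subr0.
(* Among the intervals of letter [i], only [p] contains the middle gap; intervals of other letters
   do not see the two occurrences. *)
have same (z : I * nat) : z.1 = i -> z <> p -> ind (add_occ b i) z = 0.
  case: z => z1 z2 /= -> zp; rewrite /ind /add_occ /= eqxx addn1; case: eqP => // e.
  by case: zp; rewrite /p e.
have other (z : I * nat) : z.1 <> i -> ind (add_occ b i) z = ind b z /\
    ind (add_occ (add_occ b i) i) z = ind b z.
  by move=> /eqP zi; rewrite /ind /add_occ [i == _]eq_sym (negPf zi) !addn0.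
have ind_ge0 c (z : I * nat) : 0 <= ind c z by rewrite /ind ler0n.
have [xi|xi] := eqVneq x.1 i; have [yi|yi] := eqVneq y.1 i.
- rewrite (same x) // (same y) // /weight xi yi /= eqxx mulfV // !mul1r.
  rewrite [LHS](_ : _ = exch_term (sgr (~~ sigma) * (ind b x + ind (add_occ (add_occ b i) i) x))
    (- (sgr (~~ sigma) * (ind b y + ind (add_occ (add_occ b i) i) y)))).
    by rewrite exch_term_opp ?addr_ge0 //; ring.
  by case: (sigma); rewrite /sgr /=; congr exch_term; ring.
- have [y1 y2] := other y (elimN eqP yi); rewrite y1 y2 (same x) //.
  rewrite /weight xi /= eqxx [i == _]eq_sym (negPf yi) mulfV // !mul1r.
  rewrite [LHS](_ : _ = exch_term (sgr (~~ sigma) * (ind b x + ind (add_occ (add_occ b i) i) x))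
    (sgr (~~ sigma) * (- (a y.1 i)%:~R * ind b y))); last first.
    by case: (sigma); rewrite /sgr /=; congr exch_term; field.
  (* Nonpositivity of the Cartan integer shows that both factors carry the same sign, so the product
     survives in [exch_term]. *)
  rewrite exch_term_same ?addr_ge0 ?mulr_ge0 ?oppr_ge0 ?lerz0 ?a_nonpos //.
  by case: (sigma); rewrite /sgr /=; ring.
- have [x1 x2] := other x (elimN eqP xi); rewrite x1 x2 (same y) //.
  rewrite /weight yi /= eqxx (negPf xi) mulfV // !mul1r.
  rewrite [LHS](_ : _ = exch_term (sgr sigma * (- (a i x.1)%:~R * ind b x))
    (sgr sigma * (ind b y + ind (add_occ (add_occ b i) i) y))); last first.
    by case: (sigma); rewrite /sgr /=; congr exch_term; field.
  rewrite exch_term_same ?addr_ge0 ?mulr_ge0 ?oppr_ge0 ?lerz0 ?a_nonpos // 1?eq_sym //.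
  by case: (sigma); rewrite /sgr /=; ring.
- have [x1 x2] := other x (elimN eqP xi); have [y1 y2] := other y (elimN eqP yi).
  rewrite x1 x2 y1 y2 /weight /= (negPf xi) [i == _]eq_sym (negPf yi).
  rewrite [LHS](_ : _ = exch_term (sgr sigma * (- (a i x.1)%:~R * ind b x))
    (- (sgr sigma * (- (a y.1 i)%:~R * ind b y)))); last first.
    by case: (sigma); rewrite /sgr /=; congr exch_term; field.
  rewrite exch_term_opp ?mulr_ge0 ?oppr_ge0 ?lerz0 ?a_nonpos // 1?eq_sym //.
  by ring.
Qed.

Lemma crossing_opp b i sigma x y :
  crossing b [:: (i, ~~ sigma); (i, sigma)] x y =
  - crossing b [:: (i, sigma); (i, ~~ sigma)] x y.
Proof. by case: sigma => /=; ring. Qed.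

End DoubleWords.

(** * Moves of letters and the mutations they induce *)

Section Moves.

Variables (I : finType) (a : I -> I -> int) (K : fieldType) (w : seq I) (pos : K -> Prop).
Hypothesis a_nonpos : forall i j, i != j -> a i j <= 0.
Hypothesis cone : positive_cone pos.
Notation dword := (seq (I * bool)).
Implicit Types (s : seed K (size w)) (c b : I -> nat) (V A B X Y : dword).

(* The exchange matrix of s is that of the double word V, on the vertices
   (i, l) with l > c i. *)
Definition double_seed c V s :=
  (forall j k : 'I_(size w), (c (letter j) < occ j)%N -> (c (letter k) < occ k)%N ->
     exch s j k = weight a (vertex j) (vertex k) / 2 * crossing c V (vertex j) (vertex k)) /\
  (forall i, occs c V i = count_mem i w).

Definition cross_label b (i k : I) : seq (I * nat) :=
  if i == k then [:: (i, (b i).+1)] else [::].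

(** Negative letters travel to the right past positive ones. The flag allows sign changes of the
    leftmost letter; it must be off when the move takes place behind a prefix. *)
Inductive moves (flips : bool) b : dword -> dword -> seq (I * nat) -> Prop :=
| moves_nil V : moves flips b V V [::]
| moves_cross X i k Y V L :
    moves flips b (X ++ (k, true) :: (i, false) :: Y) V L ->
    moves flips b (X ++ (i, false) :: (k, true) :: Y) V (cross_label (occs b X) i k ++ L)
| moves_flip k Y V L : flips ->
    moves flips b ((k, false) :: Y) V L -> moves flips b ((k, true) :: Y) V L.

(** In front of the first letter no interval of a vertex [(i, l)] with [l > c i] is open, so the
    term of this letter is 0 whatever its sign. *)
Lemma double_seed_flip c k sigma tau Y s :
  double_seed c ((k, sigma) :: Y) s -> double_seed c ((k, tau) :: Y) s.
Proof.
case=> hE hn; split=> // j j' cj cj'; rewrite hE //=; congr (_ * (_ + _)).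
by rewrite (@ind0 _ c (vertex j)) ?(@ind0 _ c (vertex j')) ?ltn_eqF // !mulr0 mul0r subrr !mulr0.
Qed.

Lemma double_seed_drop c k sigma Y s :
  double_seed c ((k, sigma) :: Y) s -> double_seed (add_occ c k) Y s.
Proof.
case=> hE hn; split=> [j j' cj cj'|i]; last by rewrite -hn occs_cons.
have lt_c l (m : nat) : (add_occ c k l < m)%N -> (c l < m)%N.
  by apply: leq_ltn_trans; rewrite leq_addr.
rewrite hE ?lt_c //=; congr (_ * _); rewrite -[RHS]add0r; congr (_ + _).
rewrite (@ind0 _ c (vertex j)) ?(@ind0 _ c (vertex j')) ?ltn_eqF ?lt_c //.
by rewrite !mulr0 mul0r subrr mulr0.
Qed.

Lemma crossing_mid c X l1 l2 Y x y : crossing c (X ++ l1 :: l2 :: Y) x y =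
  crossing c X x y + (crossing (occs c X) [:: l1; l2] x y +
                      crossing (occs c (X ++ [:: l1; l2])) Y x y).
Proof. by rewrite -[l1 :: _]/([:: l1; l2] ++ Y) !crossing_cat occs_cat. Qed.

(** For equal letters the interval of [p] is the gap between them, so the row and column of [p] come
    from these two letters alone and [crossing_mutate] supplies the correction elsewhere. *)
Lemma double_seed_cross c X i k sigma Y s :
  double_seed c (X ++ (i, sigma) :: (k, ~~ sigma) :: Y) s ->
  double_seed c (X ++ (k, ~~ sigma) :: (i, sigma) :: Y)
    (mutate_seq (cross_label (occs c X) i k) s).
Proof.
case=> hE hn; rewrite /cross_label.
have swapE l l' : occs c (X ++ [:: l; l']) = occs c (X ++ [:: l'; l]).
  by rewrite !occs_cat occs_swap.
have hn' l : occs c (X ++ (k, ~~ sigma) :: (i, sigma) :: Y) l = count_mem l w.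
  by rewrite -hn !occs_cat occs_swap.
have [ik|ik] := eqVneq i k; last first.
  split=> // j j' cj cj'.
  by rewrite hE // !crossing_mid (swapE (i, sigma)) crossing_swap_neq.
move: hE hn hn'; rewrite -{k}ik => hE hn hn'.
set b := occs c X; pose p := (i, (b i).+1).
have bp : (c i <= b i)%N by exact: occs_le.
have [j0 j0p] : exists j : 'I_(size w), vertex j = p.
  apply: vertex_ex; rewrite /= -hn occs_cat -/b /occs /= eqxx; lia.
have [lj0 oj0] : letter j0 = i /\ occ j0 = (b i).+1 by case: j0p.
have cj0 : (c (letter j0) < occ j0)%N by rewrite lj0 oj0 ltnS.
have low x : crossing (occs c (X ++ [:: (i, sigma); (i, ~~ sigma)])) Y p x = 0.
  by rewrite crossing_low //= occs_cat -/b /occs /= eqxx; lia.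
have high x : crossing c X p x = 0 by rewrite crossing_high.
have midl x : crossing c (X ++ (i, sigma) :: (i, ~~ sigma) :: Y) x p =
    crossing b [:: (i, sigma); (i, ~~ sigma)] x p.
  by rewrite crossing_mid -/b (crossing_skew c X p x) high (crossing_skew _ Y p x) low
    !oppr0 addr0 add0r.
have midr x : crossing c (X ++ (i, sigma) :: (i, ~~ sigma) :: Y) p x =
    crossing b [:: (i, sigma); (i, ~~ sigma)] p x.
  by rewrite crossing_mid -/b high low add0r addr0.
rewrite /= -/p -j0p mutate_vertexE.
split=> // j j' cj cj'; rewrite /= mutate_exchE !hE // j0p.
rewrite [in RHS]crossing_mid -/b crossing_opp (swapE (i, ~~ sigma)).
have [<-|nj] := eqVneq j0 j.
  by rewrite orTb j0p midr high low add0r addr0; ring.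
have [<-|nj'] := eqVneq j0 j'.
  rewrite orbT j0p midl (crossing_skew c X p) high (crossing_skew _ Y p) low !oppr0 addr0 add0r.
  by ring.
rewrite orbF midl midr crossing_mutate //; first by rewrite crossing_mid -/b; field.
  by rewrite -/p -j0p => /vertex_inj e; rewrite e eqxx in nj.
by rewrite -/p -j0p => /vertex_inj e; rewrite e eqxx in nj'.
Qed.

Lemma moves_cat fl b V V' L Y : moves fl b V V' L -> moves fl b (V ++ Y) (V' ++ Y) L.
Proof.
elim=> {V V' L} [V|X i k Z V L _ IH|k Z V L flT _ IH]; first exact: moves_nil.
  by move: IH; rewrite -!catA; exact: moves_cross.
exact: moves_flip.
Qed.

Lemma moves_prefix fl b V V' L X : moves false (occs b X) V V' L ->
  moves fl b (X ++ V) (X ++ V') L.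
Proof.
elim=> {V V' L} [V|Z i k Y V L _ IH|//]; first exact: moves_nil.
by rewrite catA -occs_cat; apply: moves_cross; rewrite -catA.
Qed.

Lemma moves_trans fl b V1 V2 V3 L1 L2 : moves fl b V1 V2 L1 -> moves fl b V2 V3 L2 ->
  moves fl b V1 V3 (L1 ++ L2).
Proof.
elim=> {V1 V2 L1} [//|X i k Y V L _ IH|k Y V L flT _ IH] h.
  by rewrite -catA; apply: moves_cross; exact: IH.
by apply: moves_flip => //; exact: IH.
Qed.

Lemma double_seed_moves fl c V V' L s : moves fl c V V' L ->
  double_seed c V s -> double_seed c V' (mutate_seq L s).
Proof.
move=> m; elim: m s => {V V' L} [//|X i k Y V L _ IH|k Y V L _ _ IH] s hs.
  by rewrite mutate_seq_cat; apply: IH; exact: (double_seed_cross (sigma := false)).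
by apply: IH; exact: double_seed_flip hs.
Qed.

Lemma double_seed_rev fl c V V' L s : moves fl c V V' L ->
  double_seed c V' s -> double_seed c V (mutate_seq (rev L) s).
Proof.
move=> m; elim: m s => {V V' L} [//|X i k Y V L _ IH|k Y V L _ _ IH] s hs.
  rewrite rev_cat mutate_seq_cat.
  have -> : rev (cross_label (occs c X) i k) = cross_label (occs c X) k i.
    by rewrite /cross_label eq_sym; case: eqP => [->|].
  by apply: (double_seed_cross (sigma := true)); exact: IH.
by apply: (@double_seed_flip _ _ false); exact: IH.
Qed.

(** The interval mutated on the left ends before the one on the right begins, so no arrow joins the
    two vertices. *)
Lemma cross_commute c X i k Y Z m n R s : good_seed pos s ->
  double_seed c (X ++ (i, false) :: (k, true) :: Y ++ Z ++ (m, false) :: (n, true) :: R) s ->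
  let L1 := cross_label (occs c X) i k in
  let L2 := cross_label (occs c (X ++ (i, false) :: (k, true) :: Y ++ Z)) m n in
  mutate_seq L2 (mutate_seq L1 s) = mutate_seq L1 (mutate_seq L2 s).
Proof.
move=> gs [hE hn] /=; rewrite /cross_label.
have [ik|//] := eqVneq i k; have [mn|//] := eqVneq m n; rewrite /=.
set p := (i, _); set q := (m, _).
case: (mutate_vertexP s p) => [[j jp _]|h]; last by rewrite !h.
case: (mutate_vertexP s q) => [[j' jq _]|h]; last by rewrite !h.
rewrite -jp -jq !mutate_vertexE; apply: esym; apply: (mutate_commute gs).
have [[lj oj] [lj' oj']] : (letter j = i /\ occ j = (occs c X i).+1) /\
   (letter j' = m /\ occ j' = (occs c (X ++ (i, false) :: (k, true) :: Y ++ Z) m).+1).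
  by case: jp; case: jq.
rewrite hE ?lj ?oj ?lj' ?oj' ?ltnS ?occs_le // jp jq.
rewrite -[X ++ _](_ : (X ++ (i, false) :: (k, true) :: Y ++ Z) ++ (m, false) :: (n, true) :: R = _);
  last by rewrite -!catA /= -!catA.
rewrite crossing_cat crossing_skew crossing_high // crossing_low ?oppr0 ?addr0 ?mulr0 //.
by rewrite /p -ik occs_cat /occs /= eqxx; lia.
Qed.

(** Both sequences are cut into single crossings, which commute by [cross_commute]; flips produce no
    mutation. *)
Lemma moves_commute c A A' B B' La Lb s : good_seed pos s -> double_seed c (A ++ B) s ->
  moves true c A A' La -> moves false (occs c A) B B' Lb ->
  mutate_seq Lb (mutate_seq La s) = mutate_seq La (mutate_seq Lb s).
Proof.
move=> gs hs ma; elim: ma s gs hs => {A A' La} [//|X i k Y V L _ IH|k Y V L _ _ IH] s gs hs mb.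
  set l := cross_label (occs c X) i k.
  have -> : mutate_seq (l ++ L) s = mutate_seq L (mutate_seq l s) by exact: mutate_seq_cat.
  rewrite IH; first last.
  - by move: mb; rewrite !occs_cat occs_swap.
  - rewrite -catA /=; apply: (double_seed_cross (sigma := false)).
    by move: hs; rewrite -catA.
  - exact: mutate_seq_good.
  rewrite mutate_seq_cat; congr (mutate_seq L _); clear IH.
  elim: mb s gs hs => {B B' Lb} [//|Z m n R V' L' _ IHb|//] s gs hs.
  set l' := cross_label _ m n.
  have e : mutate_seq l' (mutate_seq l s) = mutate_seq l (mutate_seq l' s).
    move: (hs); rewrite -catA /= => hs'; have := cross_commute gs hs'.
    by rewrite /l' -occs_cat -catA.
  rewrite !mutate_seq_cat e IHb //; first exact: mutate_seq_good.
  move: hs; rewrite !(catA _ Z) /l' -occs_cat => hs.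
  exact: (double_seed_cross (sigma := false)).
by apply: IH => //; exact: double_seed_flip hs.
Qed.

Definition run (i : I) (n m : nat) : seq (I * nat) := map (pair i) (iota n.+1 m).

Definition positive (u : seq I) : dword := [seq (i, true) | i <- u].
Definition negative (u : seq I) : dword := [seq (i, false) | i <- u].

Lemma positive_cat u v : positive (u ++ v) = positive u ++ positive v.
Proof. exact: map_cat. Qed.

Lemma occs_positive c u i : occs c (positive u) i = (c i + count_mem i u)%N.
Proof. by rewrite /occs -map_comp map_id. Qed.

Lemma runD i n m1 m2 : run i n (m1 + m2) = run i n m1 ++ run i (n + m1) m2.
Proof. by rewrite /run iotaD map_cat addSn. Qed.

Lemma occs1 b l : occs b [:: l] = add_occ b l.1.
Proof. by apply: funext => i; rewrite /occs /add_occ /= addn0. Qed.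

Lemma occs0 b : occs b [::] = b.
Proof. by apply: funext => i; rewrite /occs addn0. Qed.

(** Each [h] that is passed raises the count in front of the moving letter by one, so the labels are
    consecutive. *)
Lemma moves_through fl b h u :
  moves fl b ((h, false) :: positive u) (positive u ++ [:: (h, false)])
    (run h (b h) (count_mem h u)).
Proof.
elim: u fl b => [|k u IH] fl b; first exact: moves_nil.
have -> : run h (b h) (count_mem h (k :: u)) =
    cross_label (occs b [::]) h k ++ run h (add_occ b k h) (count_mem h u).
  rewrite /cross_label /add_occ occs0 /= [k == h]eq_sym.
  by have [_|_] := eqVneq h k; rewrite ?addn0 ?addn1.
apply: (@moves_cross fl b [::]); rewrite cat0s.
by apply: (@moves_prefix fl b _ _ _ [:: (k, true)]); rewrite occs1; exact: IH.
Qed.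

(* The mutations moving the letters of u one after the other (with flipped sign)
   through the rest of u and W; in [far_moves], those through T only, once the
   letters of u have been moved through W. *)
Fixpoint near_moves c (u W : seq I) : seq (I * nat) :=
  if u is h :: u' then run h (c h) (count_mem h (u' ++ W)) ++ near_moves c u' W
  else [::].

Fixpoint far_moves c (u W T : seq I) : seq (I * nat) :=
  if u is h :: u' then
    run h (c h + count_mem h (u' ++ W)) (count_mem h T) ++ far_moves c u' W T
  else [::].

(** Each letter stops in front of those moved before it, hence the reversal. *)
Lemma near_movesP c u W :
  moves true c (positive u ++ positive W) (positive W ++ negative (rev u))
    (near_moves c u W).
Proof.
elim: u => [|h u IH] /=; first by rewrite cats0; exact: moves_nil.
apply: moves_flip => //; rewrite -positive_cat.
apply: moves_trans; first exact: moves_through.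
rewrite positive_cat rev_cons -cats1 /negative map_cat catA; exact: moves_cat.
Qed.

Lemma near_moves_rcons c u h W :
  near_moves c (rcons u h) W = near_moves c u (h :: W) ++ run h (c h) (count_mem h W).
Proof.
elim: u => [|k u IH] /=; first by rewrite cats0.
by rewrite IH cat_rcons catA.
Qed.

(** The passage of [h] through [T] happens to the right of all moves of the remaining letters within
    [u] and [W], so it can be postponed past them. *)
Lemma near_moves_split c u W T R s : good_seed pos s ->
  double_seed c (positive u ++ positive W ++ positive T ++ R) s ->
  mutate_seq (near_moves c u (W ++ T)) s =
  mutate_seq (near_moves c u W ++ far_moves c u W T) s.
Proof.
elim: u R s => [|h u IH] R s gs hs //=.
rewrite catA count_cat runD; set P := run h (c h) _; set Q := run h _ (count_mem h T).
set s1 := mutate_seq P s; set s2 := mutate_seq Q s1.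
have gs1 : good_seed pos s1 by exact: mutate_seq_good.
have gs2 : good_seed pos s2 by exact: mutate_seq_good.
have hs1 : double_seed c (positive u ++ positive W ++ [:: (h, false)] ++ positive T ++ R) s1.
  have hs' := @double_seed_flip c h true false _ s hs.
  have m := moves_cat (positive T ++ R) (@moves_through true c h (u ++ W)).
  have := double_seed_moves (s := s) m; rewrite positive_cat /= -!catA.
  by move/(_ hs').
have mQ : moves false (occs c (positive u ++ positive W))
    ([:: (h, false)] ++ positive T ++ R) (positive T ++ [:: (h, false)] ++ R) Q.
  rewrite /Q -(occs_positive c (u ++ W) h) positive_cat.
  have := moves_cat R (@moves_through false (occs c (positive u ++ positive W)) h T).
  by rewrite -!catA.
have hs2 : double_seed c (positive u ++ positive W ++ positive T ++ [:: (h, false)] ++ R) s2.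
  rewrite !(catA (positive u)).
  by apply: (double_seed_moves (moves_prefix true mQ)); rewrite -catA.
rewrite !mutate_seq_cat -/s1 -/s2 (IH _ _ gs2 hs2) !mutate_seq_cat.
congr (mutate_seq (far_moves c u W T) _).
apply: esym; apply: (moves_commute gs1 _ (near_movesP c u W) mQ).
by rewrite -catA.
Qed.

Lemma far_moves_shift c u i T :
  far_moves c u [:: i] T = far_moves (add_occ c i) u [::] T.
Proof.
elim: u => //= h u ->; congr (run _ _ _ ++ _).
by rewrite /add_occ count_cat cats0 /= addn0; lia.
Qed.

(** [u] collects the kept letters and [c] counts the removed ones. A removed [h] contributes one
    factor of the sequence of γ: forwards for [u] followed by [h], then backwards for [u] with
    labels shifted past [h]. *)
Fixpoint removal_moves c (u : seq I) (g : dword) : seq (I * nat) :=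
  if g is (h, sigma) :: g' then
    if sigma then removal_moves c (rcons u h) g'
    else near_moves c u [:: h] ++ rev (near_moves (add_occ c h) u [::])
         ++ removal_moves (add_occ c h) u g'
  else [::].

Fixpoint direct_moves c (g : dword) : seq (I * nat) :=
  if g is (h, sigma) :: g' then
    if sigma then run h (c h) (count_mem h (map fst g')) ++ direct_moves c g'
    else direct_moves (add_occ c h) g'
  else [::].

Definition kept (g : dword) : seq I := [seq l.1 | l <- g & l.2].
Definition removed (g : dword) : seq I := [seq l.1 | l <- g & ~~ l.2].

(** Generalised to a set [u] of letters read and kept: they are first moved through the rest of the
    word. A kept letter joins [u]; a removed [h] is passed by [u], and the moves of [u] through the
    remaining word are postponed. At the end the moves of [u] cancel against the backward
    sequence. *)
Lemma direct_removal_moves c u g s : good_seed pos s ->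
  double_seed c (positive u ++ positive (map fst g)) s ->
  mutate_seq (near_moves c u (map fst g) ++ direct_moves c g ++
    rev (near_moves (fun i => c i + count_mem i (removed g))%N (u ++ kept g) [::])) s =
  mutate_seq (removal_moves c u g) s.
Proof.
elim: g c u s => [|[h [] ] g IH] c u s gs hs /=.
- rewrite cats0; have -> : (fun i => c i + 0)%N = c by apply: funext => i; rewrite addn0.
  by rewrite mutate_seq_cat (mutate_seqK cone).
- rewrite -IH //; last by move: hs; rewrite -cats1 positive_cat -catA.
  by rewrite near_moves_rcons -!catA cat_rcons.
set T := map fst g; set c' := add_occ c h.
have -> : (fun i => c i + count_mem i (removed ((h, false) :: g)))%N =
    (fun i => c' i + count_mem i (removed g))%N.
  by apply: funext => i; rewrite /c' /add_occ /= addnA.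
set s1 := mutate_seq (near_moves c u [:: h]) s.
set s2 := mutate_seq (rev (near_moves c' u [::])) s1.
have gs1 : good_seed pos s1 by exact: mutate_seq_good.
have gs2 : good_seed pos s2 by exact: mutate_seq_good.
have hs1 : double_seed c ((h, true) :: negative (rev u) ++ positive T) s1.
  have := double_seed_moves (moves_cat (positive T) (near_movesP c u [:: h])).
  by apply; rewrite -catA.
have hs2 : double_seed c' (positive u ++ positive T) s2.
  have := double_seed_rev (moves_cat (positive T) (near_movesP c' u [::])).
  rewrite /= cats0; apply; exact: double_seed_drop hs1.
rewrite !mutate_seq_cat -/s1 -/s2 -IH // !mutate_seq_cat.
congr (mutate_seq _ (mutate_seq _ _)).
rewrite -cat1s (@near_moves_split c u [:: h] T [::] s) ?cats0 //.
rewrite -[map fst g]/T -[T in RHS]cat0s (@near_moves_split c' u [::] T [::] s2) ?cats0 //.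
by rewrite !mutate_seq_cat -/s1 far_moves_shift /s2 (mutate_seqVK cone).
Qed.

End Moves.

(** * The exchange matrix of a word counts crossings *)

Section WordExchange.

Variables (I : finType) (a : I -> I -> int) (w : seq I).
Implicit Types (j k : 'I_(size w)).

Lemma bigmin_le (T : finType) (n : nat) (p : pred T) (f : T -> nat) x : p x ->
  (\big[minn/n]_(y | p y) f y <= f x)%N.
Proof.
move=> px; have := mem_index_enum x; elim: (index_enum T) => // y r IH.
rewrite inE big_cons => /orP[/eqP <-|/IH h]; first by rewrite px geq_minl.
by case: ifP => // _; rewrite (leq_trans (geq_minr _ _)).
Qed.

Lemma next_pos_le j k : (j < k)%N -> letter k = letter j -> (next_pos j <= k)%N.
Proof.
move=> jk e; apply: (@bigmin_le _ _ (fun k : 'I_(size w) => (j < k)%N && (letter k == letter j))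
  (fun k : 'I_(size w) => k : nat) k).
by rewrite jk e eqxx.
Qed.

Lemma next_posP j : next_pos j = size w \/
  exists k : 'I_(size w), [/\ next_pos j = k, (j < k)%N & letter k = letter j].
Proof.
rewrite /next_pos; elim/big_ind: _ => [|x y hx hy|k /andP[jk /eqP e]]; first by left.
  by rewrite /minn; case: ifP.
by right; exists k.
Qed.

Lemma next_pos_gt j : (j < next_pos j <= size w)%N.
Proof.
by case: (next_posP j) => [->|[k [-> -> _]]]; rewrite ?ltn_ord ?leqnn // ltnW.
Qed.

Lemma prev_pos1E j k : (j.+1 == prev_pos1 k)%N = (nat_of_ord k == next_pos j).
Proof.
have attained : prev_pos1 k = 0%N \/ exists l : 'I_(size w),
    [/\ prev_pos1 k = l.+1, (l < k)%N & letter l = letter k].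
  rewrite /prev_pos1; elim/big_ind: _ => [|x y hx hy|l /andP[lk /eqP e]]; first by left.
    by rewrite /maxn; case: ifP.
  by right; exists l.
have upper (l : 'I_(size w)) : (l < k)%N -> letter l = letter k -> (l.+1 <= prev_pos1 k)%N.
  move=> lk e.
  by apply: (@leq_bigmax_cond _ _ (fun l : 'I_(size w) => l.+1) l); rewrite lk e eqxx.
apply/eqP/eqP => [jp|kn].
  case: attained => [|[l [pl lk e]]]; first by rewrite -jp.
  have lj : l = j by apply: val_inj => /=; move: jp; rewrite pl => -[].
  rewrite {l}lj in pl lk e; apply/eqP; rewrite eqn_leq (next_pos_le lk) ?e // andbT.
  rewrite leqNgt; apply/negP => nk.
  case: (next_posP j) => [en|[l [nl jl el]]].
    by move: nk; rewrite en ltnNge ltnW.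
  have := upper l; rewrite -nl nk el e => /(_ isT erefl).
  by rewrite -jp nl ltnS leqNgt jl.
case: (next_posP j) => [en|[l [nl jl el]]].
  by have := ltn_ord k; rewrite kn en ltnn.
have lk : l = k by apply: val_inj => /=; rewrite -nl.
rewrite {l}lk in nl jl el; apply/eqP; rewrite eqn_leq upper //=.
case: attained => [->//|[m [-> mk em]]]; rewrite ltnS leqNgt; apply/negP => jm.
by have := next_pos_le jm; rewrite em el -kn => /(_ erefl); rewrite leqNgt mk.
Qed.

(** The count grows only at occurrences of the letter, and none lies strictly between [j] and
    [next_pos j]. *)
Lemma occ_interval j t : (t <= size w)%N ->
  (count_mem (letter j) (take t w) == occ j) = (j < t <= next_pos j)%N.
Proof.
move=> tw; set i := letter j; have [tj|jt] := leqP t j.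
  by rewrite ltn_eqF //= occE ltnS count_take_le.
have oj : occ j = count_mem i (take j.+1 w) by [].
have [tn|nt] := leqP t (next_pos j).
  have {tn} : (t <= next_pos j)%N by []; rewrite /= -(subnKC jt).
  elim: (t - j.+1)%N => [|m IH] le_m; first by rewrite addn0 oj eqxx.
  have le_m' : (j.+1 + m < next_pos j)%N by rewrite -addnS.
  have mw : (j.+1 + m < size w)%N.
    by case/andP: (next_pos_gt j) => _; apply: leq_trans.
  have := IH (ltnW le_m'); rewrite addnS (take_letter (Ordinal mw)) -cats1 count_cat /= addn0.
  have [e|_] := eqVneq (letter (Ordinal mw)) i; last by rewrite addn0.
  have := @next_pos_le j (Ordinal mw) _ e; rewrite /= addSnnS => /(_ _)/wrap[].
    by rewrite -addSnnS leq_addr.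
  by move=> h; move: le_m'; rewrite addSnnS ltnNge h.
case: (next_posP j) => [en|[k [nk jk ek]]]; first by move: nt; rewrite en ltnNge tw.
rewrite gtn_eqF // oj; rewrite nk in nt.
apply: leq_trans (count_take_le w (pred1 i) nt); rewrite (take_letter k) -cats1 count_cat /= ek eqxx.
by rewrite addn0 addn1 ltnS; exact: count_take_le.
Qed.

Lemma crossing_positive (x y : I * nat) : crossing (fun=> 0%N) (positive w) x y =
  \sum_(t < size w) ((count_mem x.1 (take t.+1 w) == x.2)%:R * (count_mem y.1 (take t w) == y.2)%:R
     - (count_mem x.1 (take t w) == x.2)%:R * (count_mem y.1 (take t.+1 w) == y.2)%:R).
Proof.
suff h n : (n <= size w)%N -> crossing (fun=> 0%N) (positive (take n w)) x y =
   \sum_(t < n) ((count_mem x.1 (take t.+1 w) == x.2)%:R * (count_mem y.1 (take t w) == y.2)%:R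
     - (count_mem x.1 (take t w) == x.2)%:R * (count_mem y.1 (take t.+1 w) == y.2)%:R).
  by rewrite -h // take_size.
elim: n => [|n IH] nw; first by rewrite take0 big_ord0.
rewrite big_ord_recr /= -IH ?(ltnW nw) // (take_letter (Ordinal nw)) -cats1 positive_cat.
rewrite crossing_cat; congr (_ + _); rewrite /= addr0 mul1r /ind /add_occ !occs_positive !add0n.
by rewrite !count_cat /= !addn0.
Qed.

Lemma sum_delta n m (f : nat -> rat) :
  \sum_(t < n) ((t : nat) == m)%:R * f t = if (m < n)%N then f m else 0.
Proof.
case: ltnP => [mn|nm].
  rewrite (bigD1 (Ordinal mn)) //= eqxx mul1r big1 ?addr0 // => t tm.
  by rewrite (_ : (t : nat) == m = false) ?mul0r //; apply/negP => /eqP e; case/eqP: tm; apply: val_inj.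
by rewrite big1 // => t _; rewrite ltn_eqF ?mul0r // (leq_trans (ltn_ord t)).
Qed.

(** An indicator jumps only at [j] and at [next_pos j], so the sum collapses to at most four values.
    The jump at [next_pos j] is absent when this is [size w], that is, infinite. *)
Lemma crossing_word j k : crossing (fun=> 0%N) (positive w) (vertex j) (vertex k) =
  (k < j <= next_pos k)%N%:R
  - (if (next_pos j < size w)%N then (k < next_pos j <= next_pos k)%N%:R else 0)
  - ((j < k <= next_pos j)%N%:R
     - (if (next_pos k < size w)%N then (j < next_pos k <= next_pos j)%N%:R else 0)).
Proof.
pose X (l : 'I_(size w)) (t : nat) : rat := (l < t <= next_pos l)%N%:R.
rewrite crossing_positive.
have XS (l : 'I_(size w)) (t : nat) : X l t.+1 = X l t + (t == l :> nat)%:R - (t == next_pos l)%:R.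
  have := next_pos_gt l; rewrite /X !ltnS; case/andP => ln _.
  case: (ltngtP t l) => tl; rewrite /= ?(eqP tl).
  - by rewrite ltn_eqF ?(ltn_trans tl) //; rewrite !addr0 subr0.
  - by case: ltngtP => //= _; rewrite ?addr0 ?subr0 ?subrr.
  - by rewrite tl ln ltn_eqF // add0r subr0.
transitivity (\sum_(t < size w) (((t : nat) == j)%:R * X k t - ((t : nat) == next_pos j)%:R * X k t
   - (((t : nat) == k)%:R * X j t - ((t : nat) == next_pos k)%:R * X j t))).
  apply: eq_bigr => t _ /=; have tw := ltn_ord t.
  by rewrite !occ_interval ?(ltnW tw) // -!/(X _ _) !XS; ring.
rewrite !sumrB !(sum_delta _ _ (X _)) !ltn_ord /X //.
Qed.

(** The entries of [word_exch] and the value in [crossing_word] are written as functions of four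
    positions, with [r] for infinity, which reduces their comparison to linear arithmetic. *)
Let signed_cases (j k nj nk r : nat) (c : rat) : rat :=
  if [&& k < j, j < nk & nk < nj]%N then c
  else if [&& j < k, k < nj & nj < nk]%N then - c
  else if [&& k < j, nk == r & nj == r]%N then c / 2
  else if [&& j < k, nk == r & nj == r]%N then - c / 2
  else if j == nk then 1 else if k == nj then -1 else 0.

Let gap_cases (j k nj nk r : nat) : rat :=
  (k < j <= nk)%N%:R - (if (nj < r)%N then (k < nj <= nk)%N%:R else 0)
  - ((j < k <= nj)%N%:R - (if (nk < r)%N then (j < nk <= nj)%N%:R else 0)).

(** A genuine crossing is counted at a left end and at a right end. If both right ends are infinite
    only the left one counts, whence the half in frozen entries; for nested intervals the
    contributions cancel. *)
Let cases_neq (j k nj nk r : nat) c : (j < nj <= r)%N -> (k < nk <= r)%N -> j != k -> nj != k ->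
  nk != j -> (nj = nk -> nj = r) -> signed_cases j k nj nk r c = c / 2 * gap_cases j k nj nk r.
Proof.
move=> hj hk jk njk nkj e; rewrite /signed_cases /gap_cases.
by do ![case: ifP => ?]; do ![case: (boolP (_ && _)) => ?]; rewrite ?mulr1n ?mulr0n //=;
  first [field | exfalso; lia].
Qed.

Let cases_eq (j k nj nk r : nat) c : (j < nj <= r)%N -> (k < nk <= r)%N -> (j < r)%N -> (k < r)%N ->
  ((j < k)%N -> (nj <= k)%N) -> ((k < j)%N -> (nk <= j)%N) -> (j = k -> nj = nk) ->
  signed_cases j k nj nk r c = gap_cases j k nj nk r.
Proof.
move=> hj hk jr kr hjk hkj e; rewrite /signed_cases /gap_cases.
by do ![case: ifP => ?]; do ![case: (boolP (_ && _)) => ?]; rewrite ?mulr1n ?mulr0n //=;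
  first [ring | exfalso; lia].
Qed.

Lemma word_exchE j k : word_exch a w j k =
  weight a (vertex j) (vertex k) / 2 *
    crossing (fun=> 0%N) (positive w) (vertex j) (vertex k).
Proof.
rewrite crossing_word mxE prev_pos1E /weight /=.
have hj := next_pos_gt j; have hk := next_pos_gt k.
rewrite -/(signed_cases _ _ _ _ _ _) -/(gap_cases _ _ _ _ _).
have [e|ne] := eqVneq (letter j) (letter k).
  rewrite divff // mul1r; apply: cases_eq => //.
  - by move=> jk; apply: next_pos_le; rewrite ?e.
  - by move=> kj; apply: next_pos_le; rewrite ?e.
  - by move=> /val_inj ->.
have neq_next (l m : 'I_(size w)) : letter l != letter m -> next_pos l != m.
  move=> lm; apply/eqP => en; case: (next_posP l) => [er|[q [nq _ eq]]].
    by have := ltn_ord m; rewrite -en er ltnn.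
  have qm : q = m by apply: val_inj => /=; rewrite -nq.
  by move/eqP: lm; rewrite -eq qm.
apply: cases_neq => //.
- by apply: contra ne => /eqP/val_inj ->.
- exact: neq_next.
- by apply: neq_next; rewrite eq_sym.
- move=> en; case: (next_posP j) => [//|[q [nq _ eq]]].
  by have := neq_next k q; rewrite -en nq eqxx eq [letter k == _]eq_sym ne => /(_ isT).
Qed.

End WordExchange.

(** * Mutation sequences as moves on double words *)

Section Lists.

Variables (I : finType).

Lemma map_letter_enum (w : seq I) : [seq letter j | j <- enum 'I_(size w)] = w.
Proof. exact: map_tnth_enum. Qed.

Lemma enum_ord_split n (j : 'I_n) : exists s1 s2, [/\ enum 'I_n = s1 ++ j :: s2,
  forall k, (k \in s1) = (k < j)%N & forall k, (k \in s2) = (j < k)%N].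
Proof.
exists (take j (enum 'I_n)), (drop j.+1 (enum 'I_n)).
have jn := ltn_ord j; have nthj : nth j (enum 'I_n) j = j.
  by apply: val_inj; rewrite /= nth_enum_ord.
have e : enum 'I_n = take j (enum 'I_n) ++ j :: drop j.+1 (enum 'I_n).
  by rewrite -{1}(cat_take_drop j (enum 'I_n)) (drop_nth j) ?size_enum_ord // nthj.
have im (p : pred nat) (s : seq 'I_n) k : (map val s =i p) -> (k \in s) = p (val k).
  by move=> h; rewrite -(mem_map val_inj) h.
split=> // k.
  apply: (im (fun m => m < j)%N) => m; rewrite map_take val_enum_ord take_iota.
  by rewrite (minn_idPl (ltnW jn)) mem_iota.
rewrite -[(j < k)%N]andbT -(ltn_ord k); apply: (im (fun m => j < m < n)%N) => m /=.
  rewrite map_drop val_enum_ord drop_iota mem_iota add0n.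
  by rewrite subnKC.
Qed.

(** Common shape of the sequences: one block per position, depending on the letters before it, on
    the letter itself and on those after it. *)
Fixpoint scan_with (X : Type) (f : seq (I * bool) -> I * bool -> seq (I * bool) -> seq X) pre g :=
  if g is l :: g' then f pre l g' ++ scan_with f (rcons pre l) g' else [::].

Lemma flatten_enum (X : Type) n (A : 'I_n -> I * bool) (F : 'I_n -> seq X) f :
  (forall j s1 s2, enum 'I_n = s1 ++ j :: s2 -> F j = f (map A s1) (A j) (map A s2)) ->
  flatten [seq F j | j <- enum 'I_n] = scan_with f [::] (map A (enum 'I_n)).
Proof.
move=> FE; suff h s2 s1 : enum 'I_n = s1 ++ s2 ->
    flatten [seq F j | j <- s2] = scan_with f (map A s1) (map A s2) by exact: (h _ [::]).
elim: s2 s1 => //= j s2 IH s1 e; rewrite (FE j s1 s2) // (IH (rcons s1 j)) ?map_rcons //.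
by rewrite cat_rcons.
Qed.

Definition removed_occs (g : seq (I * bool)) : I -> nat := fun i => count_mem i (removed g).

Lemma removed_occs_rcons (g : seq (I * bool)) h sigma : removed_occs (rcons g (h, sigma)) =
  if sigma then removed_occs g else add_occ (removed_occs g) h.
Proof.
apply: funext => i; rewrite /removed_occs /removed -cats1 filter_cat map_cat count_cat /=.
by case: sigma; rewrite /add_occ /= !addn0.
Qed.

Lemma kept_rcons (g : seq (I * bool)) h sigma : kept (rcons g (h, sigma)) =
  if sigma then rcons (kept g) h else kept g.
Proof.
rewrite /kept -cats1 filter_cat map_cat /=.
by case: sigma; rewrite /= ?cats1 ?cats0.
Qed.

Lemma scan_direct (pre g : seq (I * bool)) :
  scan_with (fun pre l g' => if l.2 then
    run l.1 (removed_occs pre l.1) (count_mem l.1 (map fst g')) else [::]) pre g =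
  direct_moves (removed_occs pre) g.
Proof.
by elim: g pre => //= -[h [] ] g IH pre; rewrite IH removed_occs_rcons.
Qed.

Lemma scan_removal (pre g : seq (I * bool)) :
  scan_with (fun pre l g' => if l.2 then [::] else
    near_moves (removed_occs pre) (kept pre) [:: l.1] ++
    rev (near_moves (add_occ (removed_occs pre) l.1) (kept pre) [::])) pre g =
  removal_moves (removed_occs pre) (kept pre) g.
Proof.
elim: g pre => //= -[h [] ] g IH pre; rewrite IH removed_occs_rcons kept_rcons //=.
by rewrite catA.
Qed.

Lemma scan_near (pre g : seq (I * bool)) :
  scan_with (fun pre l g' => run l.1 0 (count_mem l.1 (map fst g'))) pre g =
  near_moves (fun=> 0%N) (map fst g) [::].
Proof. by elim: g pre => //= l g IH pre; rewrite IH cats0. Qed.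

Section Word.

Variable w : seq I.

Lemma occ_split (j : 'I_(size w)) s1 s2 : enum 'I_(size w) = s1 ++ j :: s2 ->
  [/\ map (@letter I w) s1 = take j w, map (@letter I w) s2 = drop j.+1 w,
      forall k, (k \in s1) = (k < j)%N, j \notin s1
    & (count_mem (letter j) w = occ j + count_mem (letter j) (map (@letter I w) s2))%N].
Proof.
move=> e; have s1j : size s1 = j.
  have : nth j (enum 'I_(size w)) (size s1) = j by rewrite e nth_cat ltnn subnn.
  move/(congr1 val); rewrite /= nth_enum_ord // -[X in (_ < X)%N](size_enum_ord (size w)) e.
  by rewrite size_cat /= addnS ltnS leq_addr.
have t1 : map (@letter I w) s1 = take j w.
  transitivity (take (size s1) (map (@letter I w) (enum 'I_(size w)))).
    by rewrite -map_take e take_size_cat.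
  by rewrite map_letter_enum s1j.
have t2 : map (@letter I w) s2 = drop j.+1 w.
  transitivity (drop (size s1).+1 (map (@letter I w) (enum 'I_(size w)))).
    by rewrite -map_drop e -cat_rcons drop_size_cat ?size_rcons.
  by rewrite map_letter_enum s1j.
split=> //.
- move=> k; have [r1 [r2 [er m1 _]]] := enum_ord_split j.
  suff -> : s1 = r1 by exact: m1.
  have : take (size s1) (enum 'I_(size w)) = take (size s1) (enum 'I_(size w)) by [].
  rewrite {1}e take_size_cat // => ->; rewrite er.
  suff -> : size s1 = size r1 by rewrite take_size_cat.
  have : index j (enum 'I_(size w)) = j by rewrite index_enum_ord.
  rewrite er index_cat m1 ltnn /= eqxx addn0 => ->.
  by [].
- have := enum_uniq 'I_(size w); rewrite e -cat_rcons cat_uniq rcons_uniq.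
  by case/andP => /andP[].
- by rewrite t2 /occ -count_cat cat_take_drop.
Qed.

Lemma mu_fwdE : mu_fwd w = near_moves (fun=> 0%N) w [::].
Proof.
rewrite /mu_fwd (@flatten_enum _ _ (fun j => (letter j, true)) _
  (fun pre l g' => run l.1 0 (count_mem l.1 (map fst g')))).
  by rewrite scan_near -map_comp map_letter_enum.
move=> j s1 s2 e; have [_ _ _ _ cw] := occ_split e.
rewrite /run -map_comp /= cw addKn /index_iota subSS subn0.
by congr map.
Qed.

End Word.

Section Subexpression.

Variables (w : seq I) (gamma : {ffun 'I_(size w) -> bool}).

Let A (j : 'I_(size w)) := (letter j, gamma j).

Definition annotated : seq (I * bool) := map A (enum 'I_(size w)).

Lemma map_fst_annotated : map fst annotated = w.
Proof. by rewrite -map_comp map_letter_enum. Qed.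

Lemma kept_map s : kept (map A s) = [seq letter j | j <- s & gamma j].
Proof. by rewrite /kept filter_map -map_comp. Qed.

Lemma removed_map s : removed (map A s) = [seq letter j | j <- s & ~~ gamma j].
Proof. by rewrite /removed filter_map -map_comp. Qed.

Lemma neg_before_split j s1 s2 : enum 'I_(size w) = s1 ++ j :: s2 ->
  neg_before gamma j = removed_occs (map A s1) (letter j).
Proof.
move=> e; have [_ _ m1 _ _] := occ_split e.
have m2 k : k \in s2 -> (k < j)%N = false.
  move=> ks2; apply/negbTE; rewrite -m1; have := enum_uniq 'I_(size w).
  rewrite e cat_uniq => /and3P[_ /hasPn/(_ k) h _]; apply: h.
  by rewrite inE ks2 orbT.
rewrite /neg_before cardE size_filter -enumT e count_cat /= inE ltnn add0n.
rewrite [X in (_ + X)%N](_ : _ = 0%N) ?addn0; last first.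
  apply/eqP; rewrite -leqn0 leqNgt -has_count; apply/hasPn => k /m2 kj.
  by rewrite /= in_set kj.
rewrite /removed_occs removed_map count_map count_filter.
by apply: eq_in_count => k; rewrite m1 !inE => ->.
Qed.

Lemma neg_before_lt j : (neg_before gamma j < occ j)%N.
Proof.
have [s1 [s2 [e _ _]]] := enum_ord_split j; have [t1 _ _ _ _] := occ_split e.
rewrite (neg_before_split e) occE -t1 ltnS /removed_occs removed_map !count_map count_filter.
by apply: sub_count => k /andP[].
Qed.

Lemma menard_seqE : menard_seq gamma = direct_moves (fun=> 0%N) annotated.
Proof.
have -> : (fun=> 0%N) = removed_occs [::] by [].
rewrite -scan_direct; apply: flatten_enum => j s1 s2 e /=.
have [_ _ _ _ cw] := occ_split e.
have nb := neg_before_lt j.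
have -> : map fst (map A s2) = map (@letter I w) s2 by rewrite -map_comp.
rewrite -(neg_before_split e); case: (gamma j) => //=; rewrite cw.
move: (count_mem _ _) => n; case: ltnP => h.
  by rewrite /run /index_iota; congr map; congr iota; move: nb; lia.
(* The excluded case, a last occurrence, corresponds to an empty run. *)
by move: h; rewrite -[X in (_ <= X)%N]addn0 leq_add2l leqn0 => /eqP ->.
Qed.

(** Each removal shifts the occurrences of its own letter by one, so only the number of removals of
    each letter matters. *)
Lemma iota_compE l x : iota_comp gamma l x =
  (x.1, (x.2 + count_mem x.1 [seq letter j | j <- take l (neg_pos gamma)])%N).
Proof.
rewrite /iota_comp; elim: (take l _) => [|j s IH] /=; first by rewrite addn0; case: x.
by rewrite IH /iota_map /=; case: eqVneq => _ /=; rewrite ?add1n ?addnS ?add0n.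
Qed.

Lemma map_run (c d : I -> nat) h n m : n = c h ->
  [seq (x.1, x.2 + d x.1)%N | x <- run h n m] = run h (c h + d h) m.
Proof.
move=> ->; rewrite /run -map_comp.
have -> : iota (c h + d h).+1 m = map (addn (d h)) (iota (c h).+1 m).
  by rewrite -iotaDl addnS addnC.
by rewrite -map_comp; apply: eq_map => k /=; rewrite addnC.
Qed.

Lemma map_near_moves (c d : I -> nat) u W :
  [seq (x.1, x.2 + d x.1)%N | x <- near_moves c u W] =
  near_moves (fun i => c i + d i)%N u W.
Proof. by elim: u => //= h u IH; rewrite map_cat IH (@map_run c d). Qed.

Lemma nu_seqE (l : 'I_(size (neg_pos gamma))) s1 s2
    (j := tnth (in_tuple (neg_pos gamma)) l) : enum 'I_(size w) = s1 ++ j :: s2 ->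
  map (iota_comp gamma l) (nu_seq l) =
  near_moves (removed_occs (map A s1)) (kept (map A s1)) [:: letter j] ++
  rev (near_moves (add_occ (removed_occs (map A s1)) (letter j)) (kept (map A s1)) [::]).
Proof.
move=> e; have [t1 t2 m1 js1 _] := occ_split e.
have js2 : j \notin s2.
  have := enum_uniq 'I_(size w); rewrite e cat_uniq => /and3P[_ _] /=.
  by case/andP.
have ss1 : size s1 = j.
  have := congr1 size t1; rewrite size_map size_takel //; exact: ltnW.
have gj : ~~ gamma j.
  have : j \in neg_pos gamma by exact: mem_tnth.
  by rewrite mem_filter => /andP[].
have negE : neg_pos gamma = filter (fun k => ~~ gamma k) s1 ++ j :: filter (fun k => ~~ gamma k) s2.
  by rewrite /neg_pos e filter_cat /= gj.
have lE : nat_of_ord l = size (filter (fun k => ~~ gamma k) s1).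
  have : index j (neg_pos gamma) = l.
    by rewrite /j (tnth_nth j) index_uniq // filter_uniq // enum_uniq.
  move: (nat_of_ord l) => m <-.
  by rewrite negE index_cat mem_filter (negPf js1) andbF /= eqxx addn0.
have takeE : take l (neg_pos gamma) = filter (fun k => ~~ gamma k) s1.
  by move: (nat_of_ord l) lE => m ->; rewrite negE take_size_cat.
have pw : partial_word gamma l = kept (map A s1) ++ letter j :: map (@letter I w) s2.
  rewrite /partial_word takeE e filter_cat map_cat /= mem_filter (negPf js1) andbF /=.
  rewrite kept_map; congr (_ ++ _ :: _).
    by congr map; apply: eq_in_filter => k ks1; rewrite mem_filter ks1 andbT negbK.
  rewrite (@eq_in_filter _ _ predT) ?filter_predT // => k ks2.
  rewrite mem_filter negb_and; apply/orP; right.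
  have := enum_uniq 'I_(size w); rewrite e cat_uniq => /and3P[_ /hasPn/(_ k) h _].
  by apply: h; rewrite inE ks2 orbT.
(* For the 0-based [l], exactly [j - l] letters before [j] are kept, so the prefix one letter longer
   ends with the letter to be removed. *)
have sk : size (kept (map A s1)) = (j - l)%N.
  rewrite kept_map size_map size_filter lE size_filter -ss1 -(count_predC (fun k => gamma k) s1).
  by rewrite addnK.
have tk : take (j - l).+1 (partial_word gamma l) = rcons (kept (map A s1)) (letter j).
  by rewrite pw -cat_rcons take_size_cat // size_rcons sk.
have tk' : take (j - l) (partial_word gamma l) = kept (map A s1).
  by rewrite pw take_size_cat // sk.
have ic x : iota_comp gamma l x = (x.1, (x.2 + removed_occs (map A s1) x.1)%N).
  by rewrite iota_compE takeE /removed_occs removed_map.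
rewrite /nu_seq -/j /mu_bwd tk tk' !mu_fwdE map_cat (eq_map ic) map_near_moves.
(* The last letter of the prefix has nothing to its right, so its own run is empty. *)
rewrite near_moves_rcons /= /run /= cats0; congr (_ ++ _).
set b := add_occ _ _.
rewrite -map_comp map_rev; congr rev; rewrite -[RHS](@map_near_moves (fun=> 0%N) b).
apply: eq_map => x /=; rewrite ic /iota_map /b /add_occ.
by case: eqVneq => _ /=; rewrite ?addSn ?addn0 ?addn1 ?addnS.
Qed.

Lemma mu_gammaE : mu_gamma gamma = removal_moves (fun=> 0%N) [::] annotated.
Proof.
pose H (j : 'I_(size w)) := let pre := map A (take j (enum 'I_(size w))) in
  near_moves (removed_occs pre) (kept pre) [:: letter j] ++
  rev (near_moves (add_occ (removed_occs pre) (letter j)) (kept pre) [::]).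
have takeE (j : 'I_(size w)) s1 s2 : enum 'I_(size w) = s1 ++ j :: s2 -> take j (enum 'I_(size w)) = s1.
  move=> e; have [t1 _ _ _ _] := occ_split e.
  have : size s1 = j by have := congr1 size t1; rewrite size_map size_takel //; exact: ltnW.
  by move: (nat_of_ord j) => m <-; rewrite e take_size_cat.
have -> : mu_gamma gamma = flatten [seq H j | j <- neg_pos gamma].
  rewrite -[X in map H X](map_tnth_enum (in_tuple (neg_pos gamma))) -map_comp.
  congr flatten; apply: eq_map => l.
  have [s1 [s2 [e _ _]]] := enum_ord_split (tnth (in_tuple (neg_pos gamma)) l).
  by rewrite (nu_seqE e) /= /H (takeE _ _ _ e).
have -> : flatten [seq H j | j <- neg_pos gamma] =
    flatten [seq if gamma j then [::] else H j | j <- enum 'I_(size w)].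
  rewrite /neg_pos; elim: (enum _) => //= j r IH.
  by case: (gamma j) => /=; rewrite IH.
have -> : (fun=> 0%N) = removed_occs [::] by [].
rewrite -[[::] in RHS]/(kept [::]) -scan_removal; apply: flatten_enum => j s1 s2 e /=.
by rewrite /H (takeE _ _ _ e).
Qed.

Lemma mu_bwd_posE :
  mu_bwd_pos gamma = rev (near_moves (removed_occs annotated) (kept annotated) [::]).
Proof.
have pwE : pos_word gamma = kept annotated by rewrite kept_map.
rewrite /mu_bwd_pos /mu_bwd mu_fwdE -pwE map_rev; congr rev.
have ic x : iota_comp gamma (size (neg_pos gamma)) x = (x.1, (x.2 + removed_occs annotated x.1)%N).
  by rewrite iota_compE take_size /removed_occs removed_map.
by rewrite (eq_map ic) map_near_moves.
Qed.

End Subexpression.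

End Lists.

(** * Positivity of the seed of a word *)

HB.instance Definition _ (R : pzSemiRingType) n :=
  Monoid.isLaw.Build 'M[R]_n 1%:M mulmx (@mulmxA R n n n n) (@mul1mx R n n) (@mulmx1 R n n).

Section PositivePoint.

Variables (F : numClosedFieldType) (I : finType) (D : pinned_group F I).
Notation N := (pg_dim D).
Variables (omega Delta : I -> 'M[F]_N -> F).
Hypothesis homega : fundamental_weights D omega.
Hypothesis hDelta : principal_minors D omega Delta.

Lemma braid_mxE i z : braid_mx D i z = pg_phi D i (wx z).
Proof.
rewrite -wx_up phiM //; first exact: SL2_up.
by apply: SL2P; ring.
Qed.

Variable w : seq I.

(** Indexing by natural numbers, with the identity matrix beyond the word, lets products over
    prefixes be extended by one factor. *)
Definition prefix_step (z : nat -> F) (k : nat) : 'M[F]_N :=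
  if insub k is Some o then pg_phi D (@letter I w o) (wx (z k)) else 1%:M.

Definition prefix_mx z m := \big[mulmx/1%:M]_(0 <= k < m) prefix_step z k.

Lemma prefix_mxE (z : nat -> F) (j : 'I_(size w)) :
  \big[mulmx/1%:M]_(k < size w | (k <= j)%N) braid_mx D (letter k) (z k) = prefix_mx z j.+1.
Proof.
rewrite /prefix_mx (big_nat_widen _ _ _ _ _ (ltn_ord j)) big_mkord.
by apply: eq_big => // k _; rewrite /prefix_step valK braid_mxE.
Qed.

Lemma prefix_mx_group z m : pg_G D (prefix_mx z m) /\ \det (prefix_mx z m) = 1.
Proof.
apply: (big_ind (fun g => pg_G D g /\ \det g = 1)).
- by split; [exact: pg_1 | exact: det1].
- by move=> g h [Gg dg] [Gh dh]; rewrite det_mulmx dg dh mulr1; split=> //; exact: pg_mul.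
- move=> k _; rewrite /prefix_step; case: insub => [o|].
    by split; [exact/phiG/SL2_wx | exact: det_phi_wx].
  by split; [exact: pg_1 | exact: det1].
Qed.

(* The parameters are chosen letter by letter: the next letter i affects only the
   minor indexed by i. *)
Lemma minors_one : exists z : nat -> F, forall m k, (m <= size w)%N -> Delta k (prefix_mx z m) = 1.
Proof.
have /choice[P hP] k : exists P, exists chi, semi_invariant k P chi /\
    forall g, pg_G D g -> \det g = 1 -> Delta k g = ev P g.
  by have [P [chi h]] := minor_semi_invariant homega hDelta k; exists P, chi.
have DP k z m : Delta k (prefix_mx z m) = ev (P k) (prefix_mx z m).
  by have [chi [_ h]] := hP k; have [] := prefix_mx_group z m; exact: h.
suff h M : exists z : nat -> F, forall m k, (m <= M)%N -> Delta k (prefix_mx z m) = 1.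
  exact: h.
elim: M => [|M [z hz]].
  exists (fun=> 0) => m k; rewrite leqn0 => /eqP ->.
  by rewrite DP /prefix_mx big_geq //; have [chi [[]]] := hP k.
have G0 : pg_G D (prefix_mx z M) by case: (prefix_mx_group z M).
suff [x hx] : exists x, forall k,
    ev (P k) (prefix_mx z M *m prefix_step (fun=> x) M) = 1.
  exists (fun n => if n == M then x else z n) => m k.
  have same n : (n <= M)%N -> prefix_mx (fun n => if n == M then x else z n) n = prefix_mx z n.
    move=> nM; apply: eq_big_nat => q /andP[_ qn]; rewrite /prefix_step.
    by case: insubP => // o _ _; rewrite ltn_eqF // (leq_trans qn).
  rewrite leq_eqVlt => /orP[/eqP ->|mM]; last by rewrite same // hz.
  rewrite DP /prefix_mx big_nat_recr //= -/(prefix_mx _ M) same //.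
  rewrite -[RHS](hx k); congr (ev _ (_ *m _)); rewrite /prefix_step.
  by case: insub => // o; rewrite eqxx.
rewrite /prefix_step; case: insub => [o|]; last first.
  by exists 0 => k; rewrite mulmx1 -DP hz.
have [chi [hs _]] := hP (letter o).
have [|x hx] := semi_wx_eq hs G0; first by rewrite -DP hz.
exists x => k; have [<-|ok] := eqVneq (letter o) k; first exact: hx.
by have [chi' [hs' _]] := hP k; rewrite (semi_wx_neq _ hs') // -DP hz.
Qed.

Lemma word_minors_point A : word_minors D Delta w A -> exists z, forall j, (A j).@[z] = 1.
Proof.
move=> hA; have [z hz] := minors_one; exists (fun k => z k) => j.
by rewrite hA prefix_mxE hz.
Qed.

End PositivePoint.

(** * The seed of a word is positive and comes from a double word *)

Section WordSeed.

Variables (I : finType) (a : I -> I -> int) (w : seq I).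

Lemma positive_at_point (F : numFieldType) n (z : 'I_n -> F) :
  positive_cone (fun f : {fraction {mpoly F[n]}} =>
    exists p q, [/\ f = tofrac p / tofrac q, 0 < p.@[z] & 0 < q.@[z]]).
Proof.
have nz (q : {mpoly F[n]}) : 0 < q.@[z] -> tofrac q != 0.
  by rewrite tofrac_eq0; apply: contraTneq => ->; rewrite meval0 ltxx.
split.
- by exists 1, 1; rewrite tofrac1 divr1 meval1 ltr01.
- move=> _ _ [p [q [-> p0 q0]]] [p' [q' [-> p'0 q'0]]].
  exists (p * q' + p' * q), (q * q'); rewrite !mevalD !mevalM; split.
  + by rewrite addf_div ?nz // tofracD !tofracM.
  + by rewrite addr_gt0 ?mulr_gt0.
  + by rewrite mulr_gt0.
- move=> _ _ [p [q [-> p0 q0]]] [p' [q' [-> p'0 q'0]]].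
  exists (p * p'), (q * q'); rewrite !mevalM !mulr_gt0 //; split=> //.
  by rewrite mulf_div !tofracM.
- by move=> _ [p [q [-> p0 q0]]]; exists q, p; rewrite invf_div.
- move=> [p [q [/esym/eqP]]]; rewrite mulf_eq0 invr_eq0 => /orP[] /eqP e p0 q0.
    by have := nz _ p0; rewrite e eqxx.
  by have := nz _ q0; rewrite e eqxx.
Qed.

(** Skewness comes from that of the crossing numbers; for different letters the symmetriser
    exchanges the two Cartan integers. *)
Lemma word_seed_good (F : fieldType) (d : I -> rat) (A : 'I_(size w) -> {mpoly F[size w]}) pos :
  (forall i, 0 < d i) -> (forall i j, (a i j)%:~R * d j = (a j i)%:~R * d i) ->
  (forall j, pos (tofrac (A j))) -> good_seed pos (word_seed a d A).
Proof.
move=> d_gt0 d_sym hA; split=> [j|j|j k]; rewrite !ffunE //.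
rewrite !word_exchE (crossing_skew _ _ (vertex k)) /weight /=.
have [->|_] := eqVneq (letter j) (letter k); first by ring.
set c := crossing _ _ _ _.
transitivity (- ((a (letter k) (letter j))%:~R * d (letter j) * (c / 2))); first by ring.
by rewrite d_sym; ring.
Qed.

Lemma word_seed_double (F : fieldType) (d : I -> rat) (A : 'I_(size w) -> {mpoly F[size w]}) :
  double_seed a (fun=> 0%N) (positive w) (word_seed a d A).
Proof. by split=> [j k _ _|i]; [exact: word_exchE | rewrite occs_positive]. Qed.

End WordSeed.

(** * Passage to the simply connected cover, and conclusion *)

Lemma cover_cartan (F : numClosedFieldType) (I : finType) (E D : pinned_group F I) pi a :
  simply_connected_cover E D pi -> cartan_matrix D a -> cartan_matrix E a.
Proof.
case=> _ _ _ hal hphi ha i j x x0.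
rewrite hal ?hphi; [exact: ha|exact: SL2_dg|exact: pg_phi_diag].
Qed.

Lemma cartan_matrix_nonpos (F : numClosedFieldType) (I : finType) (D : pinned_group F I)
    omega Delta a : cartan_matrix D a -> fundamental_weights D omega ->
  principal_minors D omega Delta -> forall i j, i != j -> a i j <= 0.
Proof.
move=> ha hom hD i j ij; have [P [chi [hP _]]] := minor_semi_invariant hom hD i.
exact: (cartan_nonpos ij hP hD.1.2 (ha i j)).
Qed.

Theorem proposition6p25 (R : realType) (I : finType)
    (G Gsc : pinned_group R[i] I)
    (pi : 'M[R[i]]_(pg_dim Gsc) -> 'M[R[i]]_(pg_dim G))
    (hpi : simply_connected_cover Gsc G pi)
    (a : I -> I -> int) (ha : cartan_matrix G a)
    (d : I -> rat) (d_gt0 : forall i, 0 < d i)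
    (d_sym : forall i j, (a i j)%:~R * d j = (a j i)%:~R * d i)
    (omega : I -> 'M[R[i]]_(pg_dim Gsc) -> R[i])
    (homega : fundamental_weights Gsc omega)
    (Delta : I -> 'M[R[i]]_(pg_dim Gsc) -> R[i])
    (hDelta : principal_minors Gsc omega Delta)
    (w : seq I)
    (A : 'I_(size w) -> {mpoly R[i][size w]})
    (hA : word_minors Gsc Delta w A)
    (gamma : {ffun 'I_(size w) -> bool}) :
  mutate_seq (mu_bwd_pos gamma) (mutate_seq (menard_seq gamma) (word_seed a d A))
  = mutate_seq (mu_gamma gamma) (word_seed a d A).
Proof.
have a_nonpos := cartan_matrix_nonpos (cover_cartan hpi ha) homega hDelta.
have [z Az] := word_minors_point homega hDelta hA.
have cone := positive_at_point z.
have gs : good_seed (fun f => exists p q, [/\ f = tofrac p / tofrac q, 0 < p.@[z] & 0 < q.@[z]]) (word_seed a d A).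
  apply: (word_seed_good d_gt0 d_sym) => j.
  (* The initial cluster variables equal 1 at [z], hence are positive there. *)
  exists (A j), 1; rewrite Az meval1 ltr01; split=> //.
  by rewrite tofrac1 divr1.
rewrite menard_seqE mu_bwd_posE mu_gammaE -mutate_seq_cat.
have := direct_removal_moves a_nonpos cone (c := fun=> 0%N) (u := [::]) (g := annotated gamma) gs.
rewrite map_fst_annotated; apply; exact: word_seed_double.
Qed.
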